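(* Let $\Omega\subseteq\mathbb{R}^2$ be a bounded, open, convex set. For each integer $n\ge1$ let $u_n:\mathbb{Z}^2\to\mathbb{Z}$ be the pointwise least function satisfying $\Delta u_n\le2$ in $\mathbb{Z}^2\cap n\Omega$ and $u_n\ge0$ in $\mathbb{Z}^2\setminus n\Omega$, and let $\bar u\in C(\mathbb{R}^2)$ be the unique viscosity solution of $D^2\bar u\in\partial\Gamma$ in $\Omega$, $\bar u=0$ on $\mathbb{R}^2\setminus\Omega$. If $\bar u$ is $\varepsilon$-approximated, then there is an $L>0$ such that $$\sup_{x\in\mathbb{Z}^2}|u_n(x)-n^2\bar u(n^{-1}x)|\le L n^{2-\varepsilon/8}$$ holds for all $n\ge1$.
   Context: $\Delta u(x)=\sum_{y\sim x}(u(y)-u(x))$ is the graph Laplacian on $\mathbb{Z}^2$ ($y\sim x$ means nearest neighbors). $B_R(x)$ is the Euclidean ball of radius $R$ centered at $x$. $n\Omega=\{nx:x\in\Omega\}$. $\Gamma$ is the set of real symmetric $2\times2$ matrices $A$ for which there is $v:\mathbb{Z}^2\to\mathbb{Z}$ with $v(x)\ge\frac12x\cdot Ax+o(|x|^2)$ and $\Delta v(x)\le2$ for all $x\in\mathbb{Z}^2$; $\partial\Gamma$ is its topological boundary in the space of symmetric matrices. The inclusion $D^2\bar u\in\partial\Gamma$ in $\Omega$ is understood in the viscosity sense: whenever $\varphi\in C^\infty(\Omega)$ touches $\bar u$ from below at $x\in\Omega$, $D^2\varphi(x)\in\Gamma$; whenever $\varphi\in C^\infty(\Omega)$ touches $\bar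 u$ from above at $x\in\Omega$, $D^2\varphi(x)$ lies in the closure of the complement of $\Gamma$. It is known that the solution $\bar u$ exists and is unique, and that $n^{-2}u_n([nx])\to\bar u(x)$ uniformly, where $[\cdot]$ is rounding to $\mathbb{Z}^2$. A function $v:\mathbb{Z}^2\to\mathbb{Z}$ is recurrent in $X\subseteq\mathbb{Z}^2$ if $\Delta v\le2$ in $X$ and $\sup_Y(v-w)\le\sup_{\mathbb{Z}^2\setminus Y}(v-w)$ whenever $Y\subseteq X$ is finite and $w:\mathbb{Z}^2\to\mathbb{Z}$ satisfies $\Delta w\le2$ in $Y$. $\bar u$ is $\varepsilon$-approximated if $\varepsilon\in(0,1/2)$ and there is a constant $K\ge1$ such that the following holds for all $n\ge1$: for at least a $1-Kn^{-\varepsilon}$ fraction of points $x\in\mathbb{Z}^2\cap n\Omega$, one has $B_{n^{1-\varepsilon}}(x)\subseteq n\Omega$ and there is $u:\mathbb{Z}^2\to\mathbb{Z}$ that is recurrent in $\mathbb{Z}^2\cap B_{n^{1-\varepsilon}}(x)$ and satisfies $\max_{y\in\mathbb{Z}^2\cap B_{n^{1-\varepsilon}}(x)}|u(y)-n^2\bar u(n^{-1}y)|\le Kn^{2-3\varepsilon}$. *)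

(* Defs.v *)
(* The plane R^2 is 'rV[R]_2 for R : realType; the lattice Z^2 is 'rV[int]_2. *)
From mathcomp Require Export all_boot all_order all_algebra finmap.
From mathcomp Require Export all_classical all_reals all_analysis.
Export Order.TTheory GRing.Theory Num.Theory.
Export numFieldNormedType.Exports.

#[export] Set Implicit Arguments.
#[export] Unset Strict Implicit.
#[export] Unset Printing Implicit Defensive.

Local Open Scope classical_set_scope.
Local Open Scope ring_scope.

Definition lattice := 'rV[int]_2.

Definition embed (R : realType) (x : lattice) : 'rV[R]_2 :=
  map_mx intr x.

(* The library norm `|x| on 'rV[R]_2 is the sup norm. *)
Definition enorm (R : realType) (x : 'rV[R]_2) : R :=
  Num.sqrt (\sum_(i < 2) x 0 i ^+ 2).

Definition eball (R : realType) (x : 'rV[R]_2) (r : R) : set 'rV[R]_2 :=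
  [set y | enorm (y - x) < r].

Definition dilate (R : realType) (n : nat) (Omega : set 'rV[R]_2) :
    set 'rV[R]_2 :=
  [set n%:R *: x | x in Omega].

Definition lattice_in (R : realType) (X : set 'rV[R]_2) : set lattice :=
  [set x | X (embed R x)].

(* The neighbours of x are x + e_i and x - e_i, for i = 0, 1. *)
Definition laplacian (u : lattice -> int) (x : lattice) : int :=
  \sum_(i < 2) ((u (x + delta_mx 0 i) - u x) + (u (x - delta_mx 0 i) - u x)).

Definition is_least (S : set (lattice -> int)) (u : lattice -> int) : Prop :=
  S u /\ forall v, S v -> forall x, u x <= v x.

Definition obstacle_class (R : realType) (Omega : set 'rV[R]_2) (n : nat) :
    set (lattice -> int) :=
  [set v | (forall x, lattice_in (dilate n Omega) x -> laplacian v x <= 2) /\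
           (forall x, ~ lattice_in (dilate n Omega) x -> 0 <= v x)].

Definition quad_form (R : realType) (A : 'M[R]_2) (x : 'rV[R]_2) : R :=
  (x *m A *m x^T) 0 0.

Definition symmetric_matrices (R : realType) : set 'M[R]_2 :=
  [set A | A^T = A].

(* [e] is the error term, [o(|x|^2)] as [|x|] tends to infinity. *)
Definition Gamma (R : realType) : set 'M[R]_2 :=
  [set A | symmetric_matrices A /\
    exists (v : lattice -> int) (e : lattice -> R),
      [/\ forall d : R, 0 < d -> exists r : R, forall x : lattice,
            r <= enorm (embed R x) -> `|e x| <= d * enorm (embed R x) ^+ 2,
          forall x, 2^-1 * quad_form A (embed R x) + e x <= (v x)%:~R
        & forall x, laplacian v x <= 2]].

Definition partial (R : realType) (i : 'I_2) (f : 'rV[R]_2 -> R) :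
    'rV[R]_2 -> R :=
  'D_(delta_mx 0 i) f.

Fixpoint Ck (R : realType) (k : nat) (Omega : set 'rV[R]_2)
    (f : 'rV[R]_2 -> R) : Prop :=
  (forall x, Omega x -> {for x, continuous f}) /\
  (if k is k'.+1 then
     forall i : 'I_2,
       (forall x, Omega x -> derivable f x (delta_mx 0 i)) /\
       Ck k' Omega (partial i f)
   else True).

(* Meant for open [Omega], for which the values of [f] outside [Omega] are
   irrelevant. *)
Definition smooth (R : realType) (Omega : set 'rV[R]_2)
    (f : 'rV[R]_2 -> R) : Prop :=
  forall k, Ck k Omega f.

Definition hessian (R : realType) (f : 'rV[R]_2 -> R) (x : 'rV[R]_2) :
    'M[R]_2 :=
  \matrix_(i, j) partial i (partial j f) x.

Definition touches_below (R : realType) (phi u : 'rV[R]_2 -> R)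
    (x : 'rV[R]_2) : Prop :=
  phi x = u x /\ \forall y \near x, phi y <= u y.

Definition touches_above (R : realType) (phi u : 'rV[R]_2 -> R)
    (x : 'rV[R]_2) : Prop :=
  phi x = u x /\ \forall y \near x, u y <= phi y.

(* [D^2 u \in \partial Gamma] in [Omega] in the viscosity sense.  The complement
   is taken in the space of symmetric matrices; this space is closed in
   'M[R]_2, so that the closure there is also the closure in 'M[R]_2. *)
Definition viscosity_boundary_Gamma (R : realType) (Omega : set 'rV[R]_2)
    (u : 'rV[R]_2 -> R) : Prop :=
  forall (phi : 'rV[R]_2 -> R) (x : 'rV[R]_2), smooth Omega phi -> Omega x ->
    (touches_below phi u x -> Gamma (hessian phi x)) /\
    (touches_above phi u x ->
       closure (@symmetric_matrices R `\` @Gamma R) (hessian phi x)).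

Definition is_viscosity_solution (R : realType) (Omega : set 'rV[R]_2)
    (u : 'rV[R]_2 -> R) : Prop :=
  [/\ continuous u, viscosity_boundary_Gamma Omega u
    & forall x, ~ Omega x -> u x = 0].

(* The suprema are taken in the extended reals: that of the empty set is -oo,
   and that over the complement of [Y] may be +oo. *)
Definition sup_diff (R : realType) (v w : lattice -> int) (Y : set lattice) :
    \bar R :=
  ereal_sup [set ((v x - w x)%:~R)%:E | x in Y].

Definition recurrent (R : realType) (v : lattice -> int) (X : set lattice) :
    Prop :=
  (forall x, X x -> laplacian v x <= 2) /\
  forall (Y : set lattice) (w : lattice -> int),
    Y `<=` X -> finite_set Y -> (forall x, Y x -> laplacian w x <= 2) ->
    (sup_diff R v w Y <= sup_diff R v w (~` Y))%E.

Definition good_point (R : realType) (Omega : set 'rV[R]_2)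
    (ubar : 'rV[R]_2 -> R) (eps K : R) (n : nat) (x : lattice) : Prop :=
  let B := eball (embed R x) (n%:R `^ (1 - eps)) in
  B `<=` dilate n Omega /\
  exists u : lattice -> int,
    recurrent R u (lattice_in B) /\
    forall y, lattice_in B y ->
      `|(u y)%:~R - n%:R ^+ 2 * ubar (n%:R^-1 *: embed R y)|
        <= K * n%:R `^ (2 - 3 * eps).

(* [fset_set] is only meaningful on finite sets, as is the case here for
   bounded [Omega]. *)
Definition approximated (R : realType) (Omega : set 'rV[R]_2)
    (ubar : 'rV[R]_2 -> R) (eps : R) : Prop :=
  (0 < eps < 2^-1) /\
  exists K : R, 1 <= K /\ forall n : nat, (1 <= n)%N ->
    let P := lattice_in (dilate n Omega) in
    (1 - K * n%:R `^ (- eps)) * #|` fset_set P|%:R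
      <= #|` fset_set (P `&` good_point Omega ubar eps K n)|%:R :> R.

(* Main.v *)
Require Import Defs.
From mathcomp Require Import ring lra zify.

(** Write U(x) = n^2 ubar(x/n), s = n^(-eps/8) and W = n Omega. Both
    inequalities u_n - U <= L n^2 s and U - u_n <= L n^2 s are instances of one
    statement about a function F on the plane (F = U or F = - U) and a function
    g on the lattice (g = u_n or g = - u_n): the lemma [doubling_bound].

    Of the equation D^2 ubar in the boundary of Gamma only |Delta U| <= 2 in the
    viscosity sense is kept ([Gamma_tr], [closure_setD_Gamma_tr]); it is
    symmetric under U -> - U. All finer information on Gamma sits in the good
    points, around which U is close to a recurrent function r. Recurrent
    functions and u_n obey the same comparison principle ([has_comparison]), and
    it is compatible with lattice translations and with adding linear functions
    of integer slope. Hence, if r lives near k and u_n near l, the difference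
    r(k + z) - u_n(l + z) - q.z cannot drop by 1 between the centre z = 0 and
    the circle of radius about rho = n s^8 = n^(1 - eps)
    ([translation_contact]).

    Suppose now that F - g is at least m = L n^2 s somewhere. For each integer
    slope p with |p| up to a constant times m / n, maximize
      F(x) - g(y) - |x - y|^2 / 2a + delta |y|^2 / 2 - p.y
    over x in the plane and y in the lattice, with a = s^2 and delta a constant
    times s^8 ([contact]). At a maximum both points are deep inside W, because
    explicit barriers on half planes containing W control F and g near the
    boundary; this is the use of convexity ([half_plane_barrier],
    [lattice_barrier], [contact_deep]).

    If the lattice point k next to x were good, translating x and y together
    would make r(k + z) - g(y + z) - q.z, with q the rounding of p - delta y,
    lose delta rho^2 / 8 or more on the circle |z| = rho, up to three errors:
    the approximation error n^(2 - 3 eps), the rounding error rho of the slope,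
    and the error of replacing x by k. All are below delta rho^2 / 8 because
    eps < 1/2. So k is a bad point ([contact_bad]).

    The third error is not visible in the variational problem, since x is not a
    lattice point and ubar is only continuous. It is bounded by a Harnack
    inequality for the gap between F and the paraboloid touching it at x
    ([harnack]), proved with viscosity comparison alone: a large gap at k
    spreads to one point on each circle around k, because Delta F <= 2, and a
    logarithmic potential with poles at these points brings it back to x,
    because Delta F >= -2. Any connected set has positive capacity in the
    plane, and one point per circle is as good as a connected set.

    It remains to count. Given a bad k, the maximizing y stay within a bounded
    distance of each other, because two paraboloids touching F at nearby points
    have nearby centres ([centres_close]); given also y, the slope p is
    determined up to O(1/a), because the Laplacian of g is at most 2
    ([slope_fiber]). There are about (m/n)^2 slopes and O(n^2 s^8) bad points,
    so (L n s)^2 <= O(a^(-2) n^2 s^8) = O(n^2 s^4), which bounds L. *)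

(** Linear arithmetic on the hypotheses that are present in the goal, which
    keeps large contexts out of the search. *)
Ltac goal_lra := clear; intros; lra.

Local Open Scope classical_set_scope.
Local Open Scope ring_scope.

(** * Test functions *)

(** Every test function of the proof is the value of such a tree. The trees are
    closed under partial differentiation, so smoothness of all orders and the
    Hessian reduce to the symbolic derivative [diff_expr]. *)
Inductive expr (R : Type) : Type :=
| Xv of bool
| Cst of R
| Add of expr R & expr R
| Mul of expr R & expr R
| Inv of expr R
| Ln of expr R.
Arguments Xv {R} _.

Section Expressions.
Variable R : realType.
Implicit Types e : expr R.

Fixpoint ev e (x y : R) : R :=
  match e with
  | Xv b => if b then y else x
  | Cst c => c
  | Add e1 e2 => ev e1 x y + ev e2 x y
  | Mul e1 e2 => ev e1 x y * ev e2 x y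
  | Inv e1 => (ev e1 x y)^-1
  | Ln e1 => ln (ev e1 x y)
  end.

(** Inverses and logarithms need an argument that is positive on the whole
    plane: a test function has to be smooth on all of the domain and not only
    near the contact point. *)
Fixpoint wf e : Prop :=
  match e with
  | Xv _ | Cst _ => True
  | Add e1 e2 | Mul e1 e2 => wf e1 /\ wf e2
  | Inv e1 | Ln e1 => wf e1 /\ forall x y, 0 < ev e1 x y
  end.

Fixpoint diff_expr (b : bool) e : expr R :=
  match e with
  | Xv b' => Cst (b == b')%:R
  | Cst _ => Cst 0
  | Add e1 e2 => Add (diff_expr b e1) (diff_expr b e2)
  | Mul e1 e2 => Add (Mul (diff_expr b e1) e2) (Mul e1 (diff_expr b e2))
  | Inv e1 => Mul (Cst (-1)) (Mul (diff_expr b e1) (Mul (Inv e1) (Inv e1)))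
  | Ln e1 => Mul (diff_expr b e1) (Inv e1)
  end.

Definition lap_expr e (x y : R) : R :=
  ev (diff_expr false (diff_expr false e)) x y + ev (diff_expr true (diff_expr true e)) x y.

Lemma wf_diff b e : wf e -> wf (diff_expr b e).
Proof. by elim: e => //= [e1 IH1 e2 IH2|e1 IH1 e2 IH2|e1 IH1|e1 IH1] []; tauto. Qed.

Definition evp e (p : 'rV[R]_2) : R := ev e (p 0 0) (p 0 1).

Definition axis (b : bool) : 'I_2 := if b then 1 else 0.

Lemma evp_differentiable e p : wf e -> differentiable (evp e) p.
Proof.
elim: e => [b|c|e1 IH1 e2 IH2|e1 IH1 e2 IH2|e1 IH1|e1 IH1] /=.
- by move=> _; case: b; exact: differentiable_coord.
- by move=> _; exact: differentiable_cst.
- by case=> o1 o2; apply: differentiableD; [exact: IH1|exact: IH2].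
- by case=> o1 o2; apply: differentiableM; [exact: IH1|exact: IH2].
- case=> o1 pos; apply: differentiableV; first exact: IH1.
  by rewrite gt_eqF //; exact: pos.
- case=> o1 pos.
  apply: (@differentiable_comp _ _ _ _ (evp e1) (@ln R)); first exact: IH1.
  apply/derivable1_diffP.
  exact: (@ex_derive _ _ _ _ _ _ _ (is_derive1_ln (pos _ _))).
Qed.

Lemma evp_derive e p b : wf e ->
  'D_(delta_mx 0 (axis b)) (evp e) p = evp (diff_expr b e) p.
Proof.
have dd e1 : wf e1 -> derivable (evp e1) p (delta_mx 0 (axis b)).
  by move=> o1; apply: diff_derivable; exact: evp_differentiable.
elim: e => [b'|c|e1 IH1 e2 IH2|e1 IH1 e2 IH2|e1 IH1|e1 IH1] /=.
- move=> _.
  have -> : evp (Xv b') = fun q : 'rV[R]_2 => q 0 (axis b').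
    by apply/funext => q; rewrite /evp /=; case: b'.
  have /(congr1 (fun M : 'rV[R]_2 => M 0 (axis b'))) :=
    @derive_mx R 'rV[R]_2 1 2 id p _ (@derivable_id _ _ p (delta_mx 0 (axis b))).
  rewrite derive_id !mxE eqxx /= => <-.
  by rewrite /evp /=; case: b {dd}; case: b'.
- by move=> _; rewrite derive_cst.
- by case=> o1 o2; rewrite deriveD ?IH1 ?IH2 //; exact: dd.
- case=> o1 o2; rewrite deriveM ?IH1 ?IH2 //; try exact: dd.
  transitivity (evp e1 p * evp (diff_expr b e2) p + evp e2 p * evp (diff_expr b e1) p).
    by [].
  by rewrite /evp /=; ring.
- case=> o1 pos; rewrite (@deriveV _ _ (evp e1)) ?IH1 //; try exact: dd.
    transitivity (- (evp e1 p) ^- 2 * evp (diff_expr b e1) p); first by [].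
    by rewrite /evp /= -exprVn; ring.
  by rewrite gt_eqF //; exact: pos.
- case=> o1 pos.
  have d1 : differentiable (evp e1) p by exact: evp_differentiable.
  have il : is_derive (evp e1 p) 1 (@ln R) (evp e1 p)^-1.
    exact: is_derive1_ln (pos _ _).
  have d2 : differentiable (@ln R) (evp e1 p).
    by apply/derivable1_diffP; exact: (@ex_derive _ _ _ _ _ _ _ il).
  have e1' : 'd (evp e1) p (delta_mx 0 (axis b)) = evp (diff_expr b e1) p.
    by rewrite -deriveE // IH1.
  have -> : evp (Ln e1) = @ln R \o evp e1 by [].
  rewrite deriveE; last exact: differentiable_comp.
  by rewrite (@diff_comp _ _ _ _ (evp e1) (@ln R)) //= e1' diff1E // derive1E derive_val.
Qed.

Lemma evp_continuous e : wf e -> continuous (evp e).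
Proof. by move=> oe p; apply: differentiable_continuous; exact: evp_differentiable. Qed.

Lemma axis_surj (i : 'I_2) : exists b, i = axis b.
Proof.
by case: i => [[|[|//]] hi]; [exists false|exists true]; apply: val_inj.
Qed.

Lemma evp_partial e b : wf e -> partial (axis b) (evp e) = evp (diff_expr b e).
Proof. by move=> oe; apply/funext => p; rewrite /partial evp_derive. Qed.

Lemma evp_smooth e (Omega : set 'rV[R]_2) : wf e -> smooth Omega (evp e).
Proof.
move=> oe k; elim: k e oe => [|k IH] e oe; split => //.
- by move=> x _; exact: evp_continuous.
- by move=> x _; exact: evp_continuous.
move=> i; have [b ->] := axis_surj i; split.
  by move=> x _; apply: diff_derivable; exact: evp_differentiable.
by rewrite evp_partial //; apply: IH; exact: wf_diff.
Qed.

Lemma tr_hessian_evp e p : wf e -> \tr (hessian (evp e) p) = lap_expr e (p 0 0) (p 0 1).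
Proof.
move=> oe; rewrite /mxtrace big_ord_recl big_ord1 !mxE.
have a0 : ord0 = axis false by apply: val_inj.
have a1 : lift ord0 ord0 = axis true by apply: val_inj.
by rewrite a1 a0 !evp_partial //; exact: wf_diff.
Qed.

End Expressions.

(** * Coordinates on the lattice, and the trace on Gamma *)

Definition zpt (i j : int) : lattice := \row_k (if k == 0 then i else j).

Definition lapz (g : int -> int -> int) (i j : int) : int :=
  g (i + 1) j + g (i - 1) j + g i (j + 1) + g i (j - 1) - 4 * g i j.

Lemma zptE (x : lattice) : x = zpt (x 0 0) (x 0 1).
Proof.
by apply/rowP => k; rewrite !mxE; have [b ->] := axis_surj k; case: b.
Qed.

Lemma zptD i j k l : zpt i j + zpt k l = zpt (i + k) (j + l).
Proof. by apply/rowP => a; rewrite !mxE; case: ifP. Qed.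

Lemma zpt0 i j : zpt i j 0 0 = i. Proof. by rewrite mxE. Qed.
Lemma zpt1 i j : zpt i j 0 1 = j. Proof. by rewrite mxE. Qed.

Lemma laplacian_zpt u i j :
  laplacian u (zpt i j) = lapz (fun i j => u (zpt i j)) i j.
Proof.
have e0 : delta_mx 0 0 = zpt 1 0.
  by apply/rowP => k; rewrite !mxE; have [b ->] := axis_surj k; case: b.
have e1 : delta_mx 0 (lift ord0 ord0) = zpt 0 1.
  by apply/rowP => k; rewrite !mxE; have [b ->] := axis_surj k; case: b.
have n0 : - zpt 1 0 = zpt (-1) 0.
  by apply/rowP => k; rewrite !mxE; case: ifP; rewrite ?oppr0.
have n1 : - zpt 0 1 = zpt 0 (-1).
  by apply/rowP => k; rewrite !mxE; case: ifP; rewrite ?oppr0.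
rewrite /laplacian big_ord_recl big_ord1 e0 e1 n0 n1 !zptD !addr0 /lapz; ring.
Qed.

Definition zrange (N : nat) : seq int :=
  [seq k%:Z - N%:Z | k <- iota 0 (2 * N).+1].

Definition zbox (N : nat) : seq (int * int) :=
  [seq (i, j) | i <- zrange N, j <- zrange N].

Lemma mem_zrange N (i : int) : (i \in zrange N) = (`|i| <= N%:Z).
Proof.
apply/mapP/idP => [[k]|hi]; first by rewrite mem_iota => hk ->; lia.
by exists (absz (i + N%:Z)); rewrite ?mem_iota; lia.
Qed.

Lemma mem_zbox N i j : ((i, j) \in zbox N) = (`|i| <= N%:Z) && (`|j| <= N%:Z).
Proof.
rewrite -!mem_zrange; apply/allpairsP/andP => [[[a b] /= [ha hb [-> ->]]] //|[hi hj]].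
by exists (i, j).
Qed.

Lemma size_zbox N : size (zbox N) = ((2 * N).+1 ^ 2)%N.
Proof. by rewrite size_allpairs /zrange size_map size_iota mulnn. Qed.

Lemma uniq_zbox N : uniq (zbox N).
Proof.
have u : uniq (zrange N).
  by rewrite map_inj_uniq ?iota_uniq // => a b /(congr1 (fun z => z + N%:Z)); rewrite !subrK => -[].
by apply: allpairs_uniq => // -[a b] [c d].
Qed.

Lemma seq_argmax (R : realType) (T : eqType) (s : seq T) (x0 : T) (f : T -> R) :
  x0 \in s -> exists2 x, x \in s & forall y, y \in s -> f y <= f x.
Proof.
elim: s x0 => // a s IH x0 _.
case: s IH => [_|b s IH]; first by exists a => [|y]; rewrite ?inE // => /eqP ->.
have [x xs xm] := IH b (mem_head _ _).
have [h|h] := leP (f x) (f a).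
  exists a; rewrite ?mem_head // => y; rewrite inE => /predU1P[-> //|/xm]; lra.
exists x; first by rewrite inE xs orbT.
by move=> y; rewrite inE => /predU1P[->|/xm]; lra.
Qed.

Section Gamma.
Variable R : realType.

Lemma lapzR (g : int -> int -> int) i j :
  (lapz g i j)%:~R = (g (i + 1) j)%:~R + (g (i - 1) j)%:~R + (g i (j + 1))%:~R
    + (g i (j - 1))%:~R - 4 * (g i j)%:~R :> R.
Proof. by rewrite /lapz !(intrD, mulrNz, intrM). Qed.

Lemma enorm_zpt i j :
  enorm (embed R (zpt i j)) ^+ 2 = i%:~R ^+ 2 + j%:~R ^+ 2.
Proof.
rewrite /enorm sqr_sqrtr; last by apply: sumr_ge0 => k _; exact: sqr_ge0.
by rewrite big_ord_recl big_ord1 !mxE.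
Qed.

Lemma quad_formE (A : 'M[R]_2) (x : 'rV[R]_2) :
  quad_form A x = A 0 0 * x 0 0 ^+ 2 + (A 0 1 + A 1 0) * (x 0 0 * x 0 1)
    + A 1 1 * x 0 1 ^+ 2.
Proof.
rewrite /quad_form !mxE big_ord_recl big_ord1 !mxE !big_ord_recl !big_ord0.
have -> : lift ord0 ord0 = 1 :> 'I_2 by apply: val_inj.
have -> : ord0 = 0 :> 'I_2 by apply: val_inj.
by ring.
Qed.

Lemma mxtrace2 (A : 'M[R]_2) : \tr A = A 0 0 + A 1 1.
Proof.
rewrite /mxtrace big_ord_recl big_ord1.
have -> : lift ord0 ord0 = 1 :> 'I_2 by apply: val_inj.
by [].
Qed.

(** If the trace of A exceeded 2, subtracting from v a quadratic form slightly
    below the one of A would leave a function tending to infinity; at its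
    minimum the Laplacian of v would exceed 2. *)
Lemma Gamma_tr (A : 'M[R]_2) : Gamma A -> \tr A <= 2.
Proof.
case=> _ [v [e [he hv lv]]]; rewrite leNgt; apply/negP => tr2.
rewrite mxtrace2 in tr2.
pose mu := (A 0 0 + A 1 1 - 2) / 8.
have muE : 8 * mu = A 0 0 + A 1 1 - 2 by rewrite /mu; lra.
have mu0 : 0 < mu by rewrite /mu; lra.
clearbody mu.
have [r hr] := he (mu / 2) ltac:(lra).
pose sq (p : int * int) : R := p.1%:~R ^+ 2 + p.2%:~R ^+ 2.
pose q (p : int * int) : R := 2^-1 * quad_form A (embed R (zpt p.1 p.2)).
pose f (p : int * int) : R := (v (zpt p.1 p.2))%:~R - q p + mu * sq p.
pose N := (Num.truncn (`|r| + 2 * `|f (0, 0)| / mu)).+1.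
have hN : `|r| + 2 * `|f (0, 0)| / mu < N%:R by rewrite truncnS_gt.
clearbody N.
have f0N : f (0, 0) <= mu / 2 * N%:R.
  have h : 2 * `|f (0, 0)| / mu < N%:R by have := normr_ge0 r; lra.
  rewrite ltr_pdivrMr // in h.
  by have := ler_norm (f (0, 0)); lra.
have rN : r <= N%:R.
  have h : 0 <= 2 * `|f (0, 0)| / mu.
    by apply: divr_ge0; [apply: mulr_ge0 => //|exact: ltW].
  by have := ler_norm r; lra.
have out p : p \notin zbox N -> f (0, 0) <= f p.
  case: p => i j; rewrite mem_zbox => hp.
  have sqN : N%:R ^+ 2 <= sq (i, j).
    have H (k : int) : ~~ (`|k| <= N%:Z) -> N%:R ^+ 2 <= (k%:~R : R) ^+ 2.
      move=> hk; have hk' : N%:Z <= `|k| by lia.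
      rewrite -[(k%:~R) ^+ 2]real_normK ?num_real // lerXn2r ?nnegrE //.
      by rewrite -intr_norm -[N%:R]/(N%:Z%:~R) ler_int.
    rewrite /sq /=; move: hp; rewrite negb_and => /orP[/H|/H] h.
      by rewrite ler_wpDr // sqr_ge0.
    by rewrite ler_wpDl // sqr_ge0.
  have en : enorm (embed R (zpt i j)) ^+ 2 = sq (i, j) by rewrite enorm_zpt.
  have N1 : 1 <= N%:R :> R.
    rewrite ler1n lt0n; apply/eqP => N0; move: hN; rewrite N0.
    have : 0 <= 2 * `|f (0, 0)| / mu by apply: divr_ge0; [apply: mulr_ge0|exact: ltW].
    by have := normr_ge0 r; lra.
  have rle : r <= enorm (embed R (zpt i j)).
    apply: le_trans rN _.
    rewrite -(@ler_pXn2r _ 2) ?nnegrE ?en //.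
    exact: sqrtr_ge0.
  have := hr _ rle; rewrite en => /ler_normlP[e1 _].
  have h1 := hv (zpt i j).
  have h2 : N%:R <= N%:R ^+ 2 :> R by rewrite expr2; nra.
  have h3 : mu / 2 * N%:R <= mu / 2 * sq (i, j).
    by apply: ler_wpM2l; lra.
  rewrite {2}/f /q /=; lra.
have z0 : (0 : int, 0 : int) \in zbox N by rewrite mem_zbox; lia.
have [[i j] _ mn] := seq_argmax (fun p => - f p) z0.
have glob p : f (i, j) <= f p.
  have [/mn|/out h] := boolP (p \in zbox N); first lra.
  by have := mn _ z0; lra.
have := glob (i + 1, j); have := glob (i - 1, j).
have := glob (i, j + 1); have := glob (i, j - 1).
have := lv (zpt i j); rewrite laplacian_zpt -(@ler_int R) lapzR.
rewrite /f /q /sq /= !quad_formE !mxE /= !(intrD, mulrNz, mulr1z).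
by lra.
Qed.

(** Rounding a function up to integers increases its lattice Laplacian by less
    than 4. *)
Lemma Gamma_of_tr (A : 'M[R]_2) :
  symmetric_matrices A -> \tr A <= -2 -> Gamma A.
Proof.
move=> sA; rewrite mxtrace2 => trA; split => //.
pose q i j : R := 2^-1 * quad_form A (embed R (zpt i j)).
pose v (x : lattice) : int := Num.ceil (q (x 0 0) (x 0 1)).
exists v, (fun=> 0); split.
- by move=> d d0; exists 0 => x _; rewrite normr0 mulr_ge0 ?sqr_ge0 // ltW.
- by move=> x; rewrite addr0 {1}(zptE x); exact: ceil_ge.
move=> x; rewrite (zptE x); move: (x 0 0) (x 0 1) => {x} i j.
rewrite laplacian_zpt -ltzD1 -(@ltr_int R) lapzR /v !zpt0 !zpt1.
have up a b : (Num.ceil (q a b))%:~R < q a b + 1.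
  by have := gt_pred_ceil (q a b); rewrite intrB; lra.
have := up (i + 1) j; have := up (i - 1) j.
have := up i (j + 1); have := up i (j - 1); have := ceil_ge (q i j).
rewrite /q /= !quad_formE !mxE /= !(intrD, mulrNz, mulr1z).
by lra.
Qed.

Lemma closure_setD_Gamma_tr (A : 'M[R]_2) :
  closure (@symmetric_matrices R `\` @Gamma R) A -> -2 <= \tr A.
Proof.
move=> cA; rewrite leNgt; apply/negP => trA.
have op : open [set B : 'M[R]_2 | \tr B < -2].
  have -> : [set B : 'M[R]_2 | \tr B < -2] =
      (fun B : 'M[R]_2 => B 0 0 + B 1 1) @^-1` [set r | r < -2].
    by apply/seteqP; split => B /=; rewrite mxtrace2.
  apply: open_comp; last exact: open_lt.
  move=> B _; apply: continuousD; exact: coord_continuous.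
have [B [[sB nB] /= tB]] := cA _ (open_nbhs_nbhs (conj op trA)).
by apply: nB; apply: Gamma_of_tr => //; exact: ltW.
Qed.

End Gamma.

(** * Viscosity bounds on the Laplacian *)

Section Viscosity.
Variable R : realType.
Implicit Types (e : expr R) (F : R -> R -> R) (W : R -> R -> Prop).

Definition pt (x y : R) : 'rV[R]_2 := \row_k (if k == 0 then x else y).

Lemma pt0 x y : pt x y 0 0 = x. Proof. by rewrite mxE. Qed.
Lemma pt1 x y : pt x y 0 1 = y. Proof. by rewrite mxE. Qed.

Lemma ptE (p : 'rV[R]_2) : p = pt (p 0 0) (p 0 1).
Proof.
by apply/rowP => k; rewrite !mxE; have [b ->] := axis_surj k; case: b.
Qed.

Definition onplane F (p : 'rV[R]_2) : R := F (p 0 0) (p 0 1).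

(** Delta F >= -2 in the viscosity sense. Asked of F and of - F, it is all that
    the proof retains of the equation. *)
Definition visc_lap_ge F W := forall e x y, wf e -> W x y ->
  (exists2 d, 0 < d & forall x' y', `|x' - x| < d -> `|y' - y| < d ->
     F x' y' - ev e x' y' <= F x y - ev e x y) ->
  -2 <= lap_expr e x y.

(** Both sides are the true derivative of the same function. *)
Lemma ev_diff_ext e1 e2 b : wf e1 -> wf e2 ->
  (forall x y, ev e1 x y = ev e2 x y) ->
  forall x y, ev (diff_expr b e1) x y = ev (diff_expr b e2) x y.
Proof.
move=> o1 o2 h x y.
have E : evp e1 = evp e2 by apply/funext => p; exact: h.
have := evp_derive (pt x y) b o1; rewrite E evp_derive //.
by rewrite /evp !pt0 !pt1 => ->.
Qed.

Fixpoint scale_expr (c : R) e : expr R :=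
  match e with
  | Xv b => Mul (Cst c) (Xv b)
  | Cst a => Cst a
  | Add e1 e2 => Add (scale_expr c e1) (scale_expr c e2)
  | Mul e1 e2 => Mul (scale_expr c e1) (scale_expr c e2)
  | Inv e1 => Inv (scale_expr c e1)
  | Ln e1 => Ln (scale_expr c e1)
  end.

Lemma ev_scale c e x y : ev (scale_expr c e) x y = ev e (c * x) (c * y).
Proof. by elim: e => //= [[]//|? -> ? ->|? -> ? ->|? ->|? ->]. Qed.

Lemma wf_scale c e : wf e -> wf (scale_expr c e).
Proof.
elim: e => //= [e1 I1 e2 I2|e1 I1 e2 I2|e1 I1|e1 I1] [] /I1 h h'; split => //;
  by [exact: I2|move=> x y; rewrite ev_scale].
Qed.

Lemma diff_scale c e b x y : wf e ->
  ev (diff_expr b (scale_expr c e)) x y = c * ev (diff_expr b e) (c * x) (c * y).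
Proof.
elim: e => /= [b'|a|e1 I1 e2 I2|e1 I1 e2 I2|e1 I1|e1 I1].
- by move=> _; ring.
- by rewrite mulr0.
- by case=> o1 o2; rewrite I1 // I2 // mulrDr.
- by case=> o1 o2; rewrite I1 // I2 // !ev_scale; ring.
- by case=> o1 _; rewrite I1 // !ev_scale; ring.
- by case=> o1 _; rewrite I1 // !ev_scale; ring.
Qed.

Lemma lap_expr_scale c e x y : wf e ->
  lap_expr (scale_expr c e) x y = c ^+ 2 * lap_expr e (c * x) (c * y).
Proof.
move=> oe; rewrite /lap_expr.
have H b : ev (diff_expr b (diff_expr b (scale_expr c e))) x y =
           c ^+ 2 * ev (diff_expr b (diff_expr b e)) (c * x) (c * y).
  rewrite (@ev_diff_ext _ (Mul (Cst c) (scale_expr c (diff_expr b e)))).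
  - by rewrite /= diff_scale ?ev_scale; [ring|exact: wf_diff].
  - by apply: wf_diff; exact: wf_scale.
  - by split => //; apply: wf_scale; exact: wf_diff.
  - by move=> x' y' /=; rewrite diff_scale // ev_scale.
by rewrite !H mulrDr.
Qed.

Lemma lap_exprZ c e x y : lap_expr (Mul (Cst c) e) x y = c * lap_expr e x y.
Proof. by rewrite /lap_expr /=; ring. Qed.

Lemma lap_exprD e1 e2 x y : lap_expr (Add e1 e2) x y = lap_expr e1 x y + lap_expr e2 x y.
Proof. by rewrite /lap_expr /=; ring. Qed.

Lemma lap_exprC (c x y : R) : lap_expr (Cst c) x y = 0.
Proof. by rewrite /lap_expr /=; ring. Qed.

Lemma near_pt (p : 'rV[R]_2) (P : 'rV[R]_2 -> Prop) (d : R) : 0 < d ->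
  (forall q : 'rV[R]_2, `|q 0 0 - p 0 0| < d -> `|q 0 1 - p 0 1| < d -> P q) ->
  \forall q \near p, P q.
Proof.
move=> d0 H; apply/nbhs_ballP; exists d => //= q [_ bq].
by apply: H; rewrite distrC; exact: bq.
Qed.

(** On the scale of the lattice the Laplacian bounds have no small parameter;
    Hessians are invariant under this rescaling. *)
Definition blowup (n : R) (u : 'rV[R]_2 -> R) (x y : R) : R :=
  n ^+ 2 * u (n^-1 *: pt x y).

Definition region (n : R) (Omega : set 'rV[R]_2) (x y : R) : Prop :=
  Omega (n^-1 *: pt x y).

Section Transfer.
Variables (Omega : set 'rV[R]_2) (u : 'rV[R]_2 -> R) (n : R).
Hypotheses (n0 : 0 < n) (us : is_viscosity_solution Omega u).

(** The sign [sg] treats touching from above and from below together. *)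
Lemma touch_scaled e x y (sg : R) : wf e -> sg ^+ 2 = 1 ->
  (exists2 d, 0 < d & forall x' y', `|x' - x| < d -> `|y' - y| < d ->
     sg * blowup n u x' y' - ev e x' y' <= sg * blowup n u x y - ev e x y) ->
  exists f, [/\ wf f, lap_expr f (n^-1 * x) (n^-1 * y) = sg * lap_expr e x y,
    evp f (n^-1 *: pt x y) = u (n^-1 *: pt x y)
    & \forall q \near n^-1 *: pt x y, sg * u q <= sg * evp f q].
Proof.
move=> oe sg2 [d d0 H].
pose c0 := u (n^-1 *: pt x y) - sg * n ^- 2 * ev e x y.
pose f := Add (Cst c0) (Mul (Cst (sg * n ^- 2)) (scale_expr n e)).
have nn : n != 0 by rewrite gt_eqF.
have nK z : n * (n^-1 * z) = z by rewrite mulrA mulfV // mul1r.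
exists f; split.
- by do 2!split => //; exact: wf_scale.
- rewrite /f lap_exprD lap_exprC add0r lap_exprZ lap_expr_scale // !nK.
  by rewrite -mulrA [_^-1 * _]mulrA mulVf ?expf_neq0 // mul1r.
- by rewrite /evp /f /= !mxE /= ev_scale !nK /c0 subrK.
have dn : 0 < d / n by exact: divr_gt0.
apply: (near_pt dn) => q; rewrite !mxE /= => hx hy.
have scal z w : `|z - n^-1 * w| < d / n -> `|n * z - w| < d.
  move=> h; have -> : n * z - w = n * (z - n^-1 * w).
    by rewrite mulrBr mulrA mulfV // mul1r.
  by rewrite normrM gtr0_norm // mulrC -ltr_pdivlMr.
have := H _ _ (scal _ _ hx) (scal _ _ hy).
rewrite /blowup.
have -> : n^-1 *: pt (n * q 0 0) (n * q 0 1) = q.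
  rewrite {3}(ptE q); apply/rowP => k; rewrite !mxE.
  by case: ifP => _; rewrite mulrA mulVf // mul1r.
rewrite /evp /f /= ev_scale /c0.
set U := u (_ *: _); set E := ev e x y; set E' := ev e _ _ => h.
have n2 : 0 < n ^- 2 by rewrite invr_gt0 exprn_gt0.
have := ler_wpM2l (ltW n2) h.
have nV : n ^- 2 * n ^+ 2 = 1 by rewrite mulVf // expf_neq0.
have e1 (v w : R) : n ^- 2 * (sg * (n ^+ 2 * v) - w) =
   sg * (n ^- 2 * n ^+ 2) * v - n ^- 2 * w by ring.
rewrite !e1 nV mulr1 => h'.
have -> : sg * (U - sg * n ^- 2 * E + sg * n ^- 2 * E') =
  sg * U + sg ^+ 2 * (n ^- 2 * E' - n ^- 2 * E) by ring.
by rewrite sg2; lra.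
Qed.

Lemma visc_blowup : visc_lap_ge (blowup n u) (region n Omega).
Proof.
case: us => _ v _ e x y oe Wxy loc.
have [f [fo lf ff near_f]] : exists f, [/\ wf f,
    lap_expr f (n^-1 * x) (n^-1 * y) = 1 * lap_expr e x y,
    evp f (n^-1 *: pt x y) = u (n^-1 *: pt x y)
    & \forall q \near n^-1 *: pt x y, 1 * u q <= 1 * evp f q].
  apply: touch_scaled => //; first by rewrite expr1n.
  case: loc => d d0 H; exists d => // x' y' hx hy; rewrite !mul1r; exact: H.
have [_ ] := v (evp f) _ (@evp_smooth _ f Omega fo) Wxy.
have ta : touches_above (evp f) u (n^-1 *: pt x y).
  by split => //; apply: filterS near_f => q; rewrite !mul1r.
move=> /(_ ta) /closure_setD_Gamma_tr.
by rewrite tr_hessian_evp // !mxE /= lf mul1r.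
Qed.

Lemma viscN_blowup : visc_lap_ge (fun x y => - blowup n u x y) (region n Omega).
Proof.
case: us => _ v _ e x y oe Wxy loc.
have [f [fo lf ff near_f]] : exists f, [/\ wf f,
    lap_expr f (n^-1 * x) (n^-1 * y) = -1 * lap_expr e x y,
    evp f (n^-1 *: pt x y) = u (n^-1 *: pt x y)
    & \forall q \near n^-1 *: pt x y, -1 * u q <= -1 * evp f q].
  apply: touch_scaled => //; first by rewrite sqrrN expr1n.
  case: loc => d d0 H; exists d => // x' y' hx hy; rewrite !mulN1r; exact: H.
have [+ _] := v (evp f) _ (@evp_smooth _ f Omega fo) Wxy.
have ta : touches_below (evp f) u (n^-1 *: pt x y).
  by split => //; apply: filterS near_f => q; rewrite !mulN1r lerN2.
move=> /(_ ta) /Gamma_tr.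
by rewrite tr_hessian_evp // !mxE /= lf mulN1r; lra.
Qed.

End Transfer.

Definition cont2 F := continuous (onplane F).

Lemma cont2_ev e : wf e -> cont2 (ev e).
Proof. exact: evp_continuous. Qed.

Lemma cont2B F G : cont2 F -> cont2 G -> cont2 (fun x y => F x y - G x y).
Proof. by move=> cF cG p; apply: continuousB; [exact: cF|exact: cG]. Qed.

(** The maximum of F - e over K lies in O, where e, up to a constant, touches F
    from above. *)
Lemma max_principle F W e (K O : set 'rV[R]_2) (z0 : 'rV[R]_2) :
  cont2 F -> wf e -> visc_lap_ge F W -> compact K -> open O -> O `<=` K ->
  (forall z, O z -> W (z 0 0) (z 0 1)) -> K z0 ->
  (forall z, K z -> ~ O z -> onplane F z - evp e z < onplane F z0 - evp e z0) ->
  exists2 z, O z & -2 <= lap_expr e (z 0 0) (z 0 1).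
Proof.
move=> cF oe vF cK oO OK OW Kz0 bd.
have cG : {within K, continuous (fun z => onplane F z - evp e z)}.
  by apply: continuous_subspaceT; exact: cont2B cF (cont2_ev oe).
have [z Kz zmax] := EVT_max_rV (ex_intro _ z0 Kz0) cK cG.
rewrite inE in Kz.
have Oz : O z.
  apply: contrapT => nO; have := bd _ Kz nO.
  by have := zmax z0; rewrite inE => /(_ Kz0); lra.
exists z => //; apply: (vF) => //; first exact: OW.
have /nbhs_ballP [d /= d0 bO] := open_nbhs_nbhs (conj oO Oz).
exists d => // x' y' hx hy.
have : ball z d (pt x' y').
  split => // i j; rewrite (ord1 i) mxE; have [b ->] := axis_surj j.
  by case: b => /=; rewrite /ball /= distrC.
move=> /bO /OK Kp; have := zmax (pt x' y'); rewrite inE => /(_ Kp).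
by rewrite /onplane /evp !pt0 !pt1.
Qed.

End Viscosity.

(** * Maximum principles on discs *)

Section Discs.
Variable R : realType.
Implicit Types (e : expr R) (F : R -> R -> R) (W : R -> R -> Prop).

Definition box (M : R) : set 'rV[R]_2 := [set p | `|p 0 0| <= M /\ `|p 0 1| <= M].

Lemma box_norm (p : 'rV[R]_2) M : 0 <= M -> box M p -> `|p| <= M.
Proof.
move=> M0 [h0 h1]; rewrite [leLHS]/Num.Def.normr/= mx_normrE.
rewrite bigmax_le // => -[i j] _ /=; rewrite (ord1 i).
by have [b ->] := axis_surj j; case: b.
Qed.

Lemma subbox_compact (K : set 'rV[R]_2) M : closed K -> K `<=` box M -> compact K.
Proof.
move=> cK KM; apply: bounded_closed_compact => //.
exists `|M|; split; first exact: num_real.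
move=> t Mt p Kp; apply: (@box_norm _ t).
  by apply: le_trans (ltW Mt).
have [h0 h1] := KM _ Kp; have hM := ler_norm M.
by split; [apply: le_trans h0 _|apply: le_trans h1 _]; lra.
Qed.

Lemma closed_ev_ge0 (c : nat -> expr R) N : (forall i, wf (c i)) ->
  closed [set p | forall i, (i < N)%N -> 0 <= evp (c i) p].
Proof.
move=> okc; elim: N => [|N IH].
  rewrite (_ : [set p | _] = setT); first exact: closedT.
  by apply/seteqP; split.
rewrite (_ : [set p | _] = [set p | forall i, (i < N)%N -> 0 <= evp (c i) p]
   `&` (evp (c N) @^-1` [set r | 0 <= r])).
  apply: closedI => //; apply: closed_comp; last exact: closed_ge.
  by move=> p _; exact: evp_continuous.
apply/seteqP; split => p /= => [h|[h1 h2] i]; last first.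
  by rewrite ltnS leq_eqVlt => /predU1P[->|/h1].
by split => [i hi|]; apply: h; rewrite ltnS // ltnW.
Qed.

Lemma open_ev_gt0 (c : nat -> expr R) N : (forall i, wf (c i)) ->
  open [set p | forall i, (i < N)%N -> 0 < evp (c i) p].
Proof.
move=> okc; elim: N => [|N IH].
  rewrite (_ : [set p | _] = setT); first exact: openT.
  by apply/seteqP; split.
rewrite (_ : [set p | _] = [set p | forall i, (i < N)%N -> 0 < evp (c i) p]
   `&` (evp (c N) @^-1` [set r | 0 < r])).
  apply: openI => //; apply: open_comp; last exact: open_gt.
  by move=> p _; exact: evp_continuous.
apply/seteqP; split => p /= => [h|[h1 h2] i]; last first.
  by rewrite ltnS leq_eqVlt => /predU1P[->|/h1].
by split => [i hi|]; apply: h; rewrite ltnS // ltnW.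
Qed.

Lemma max_principle_ev F W e (c : nat -> expr R) N M (x0 y0 : R) :
  cont2 F -> wf e -> visc_lap_ge F W -> (forall i, wf (c i)) ->
  (forall x y, (forall i, (i < N)%N -> 0 <= ev (c i) x y) ->
     `|x| <= M /\ `|y| <= M) ->
  (forall x y, (forall i, (i < N)%N -> 0 < ev (c i) x y) -> W x y) ->
  (forall i, (i < N)%N -> 0 <= ev (c i) x0 y0) ->
  (forall x y i, (forall i, (i < N)%N -> 0 <= ev (c i) x y) ->
     (i < N)%N -> ev (c i) x y = 0 ->
     F x y - ev e x y < F x0 y0 - ev e x0 y0) ->
  exists x y, (forall i, (i < N)%N -> 0 < ev (c i) x y) /\ -2 <= lap_expr e x y.
Proof.
move=> cF oe vF okc bK OW K0 bd.
set K := [set p | forall i, (i < N)%N -> 0 <= evp (c i) p].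
set O := [set p | forall i, (i < N)%N -> 0 < evp (c i) p].
have OK : O `<=` K by move=> p Op i /Op /ltW.
have cK : compact K.
  by apply: (@subbox_compact _ M); [exact: closed_ev_ge0|move=> p /bK].
have oO : open O by exact: open_ev_gt0.
have Kz0 : K (pt x0 y0) by move=> i hi; rewrite /evp pt0 pt1; exact: K0.
have [z /OW //|p Kp nOp|z Oz lz] := max_principle cF oe vF cK oO OK _ Kz0.
  have [i hi] : exists i, (i < N)%N /\ evp (c i) p = 0.
    apply: contrapT => h; apply: nOp => i hi.
    have := Kp i hi; rewrite le_eqVlt => /predU1P[e0|//].
    by exfalso; apply: h; exists i.
  by case: hi => hi e0; rewrite /onplane /evp !pt0 !pt1; exact: (bd _ _ i).
by exists (z 0 0), (z 0 1).
Qed.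

(** Squared distance to (a, b). *)
Definition sqd (a b : R) : expr R :=
  let u := Add (Xv false) (Cst (- a)) in let v := Add (Xv true) (Cst (- b)) in
  Add (Mul u u) (Mul v v).

Lemma ev_sqd a b x y : ev (sqd a b) x y = (x - a) ^+ 2 + (y - b) ^+ 2.
Proof. by rewrite /= !expr2. Qed.

Lemma lap_sqd a b x y : lap_expr (sqd a b) x y = 4.
Proof. by rewrite /lap_expr /=; ring. Qed.

Lemma sq_ball_le (x y M : R) : 0 <= M -> x ^+ 2 + y ^+ 2 <= M ^+ 2 ->
  `|x| <= M /\ `|y| <= M.
Proof.
move=> M0 h.
have := sqr_ge0 x; have := sqr_ge0 y => hy hx.
by split; rewrite -(@ler_pXn2r _ 2) ?nnegrE // real_normK ?num_real //; lra.
Qed.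

Lemma max_principle_disc F W e (x1 x2 r : R) :
  cont2 F -> wf e -> visc_lap_ge F W -> 0 < r ->
  (forall x y, (x - x1) ^+ 2 + (y - x2) ^+ 2 < r ^+ 2 -> W x y) ->
  (forall x y, (x - x1) ^+ 2 + (y - x2) ^+ 2 = r ^+ 2 ->
     F x y - ev e x y < F x1 x2 - ev e x1 x2) ->
  exists x y, (x - x1) ^+ 2 + (y - x2) ^+ 2 < r ^+ 2 /\ -2 <= lap_expr e x y.
Proof.
move=> cF oe vF r0 BW bd.
pose c (_ : nat) := Add (Cst (r ^+ 2)) (Mul (Cst (-1)) (sqd x1 x2)).
have cE i x y : ev (c i) x y = r ^+ 2 - ((x - x1) ^+ 2 + (y - x2) ^+ 2).
  by rewrite /c /= !expr2; ring.
have [||||//|x [y [h l]]] := @max_principle_ev F W e c 1 (r + `|x1| + `|x2|) x1 x2 cF oe vF.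
- by [].
- move=> x y /(_ 0%N isT); rewrite cE => h.
  have [] : `|x - x1| <= r /\ `|y - x2| <= r by apply: sq_ball_le; lra.
  have := ler_normD (x - x1) x1; have := ler_normD (y - x2) x2.
  rewrite !subrK; have := normr_ge0 x1; have := normr_ge0 x2; lra.
- by move=> x y /(_ 0%N isT); rewrite cE => h; apply: BW; lra.
- by move=> i _; rewrite cE !subrr expr0n /= addr0 subr0 exprn_ge0 // ltW.
- by move=> x y i _ _; rewrite cE => h; apply: bd; lra.
by exists x, y; split => //; have := h 0%N isT; rewrite cE; lra.
Qed.

(** Paraboloid with centre (a, b), minimum c and Hessian 1/h. *)
Definition parab (h c a b : R) : expr R := Add (Cst c) (Mul (Cst (2 * h)^-1) (sqd a b)).

Lemma ev_parab h c a b x y :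
  ev (parab h c a b) x y = c + (2 * h)^-1 * ((x - a) ^+ 2 + (y - b) ^+ 2).
Proof. by rewrite /= !expr2. Qed.

Lemma lap_parab h c a b x y : h != 0 -> lap_expr (parab h c a b) x y = 2 / h.
Proof. by move=> h0; rewrite /parab lap_exprD lap_exprC lap_exprZ lap_sqd; field. Qed.

(** Two paraboloids of the same Hessian lie above F and touch it at nearby
    points. They differ by an affine function S, so their minimum has a concave
    crease between the two contact points. Bending the crease into a parabola
    gives a test function whose Laplacian is very negative if the slope of S,
    which is the difference of the centres divided by a, is large. *)
Lemma centres_close F W (a c1 c2 x1 x2 x1' x2' y1 y2 y1' y2' : R) :
  cont2 F -> visc_lap_ge F W -> 0 < a -> a <= 1 ->
  `|x1' - x1| <= 1 -> `|x2' - x2| <= 1 ->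
  (forall x y, (x - x1) ^+ 2 + (y - x2) ^+ 2 <= 256 ->
    [/\ W x y, F x y <= ev (parab a c1 y1 y2) x y
      & F x y <= ev (parab a c2 y1' y2') x y]) ->
  F x1 x2 = ev (parab a c1 y1 y2) x1 x2 ->
  F x1' x2' = ev (parab a c2 y1' y2') x1' x2' ->
  `|y1' - y1| + `|y2' - y2| <= 200.
Proof.
move=> cF vF a0 a1 hx1 hx2 H e1 e2.
pose q1 : R := (y1' - y1) / a; pose q2 : R := (y2' - y2) / a.
pose s0 : R := c1 - c2 + (2 * a)^-1 * (y1 ^+ 2 + y2 ^+ 2 - y1' ^+ 2 - y2' ^+ 2).
pose S x y := s0 + (q1 * x + q2 * y).
have an : a != 0 by rewrite gt_eqF.
have SE x y : ev (parab a c1 y1 y2) x y - ev (parab a c2 y1' y2') x y = S x y.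
  by rewrite !ev_parab /S /s0 /q1 /q2; field.
pose Q : R := `|q1| + `|q2|.
have Q0 : 0 <= Q by exact: addr_ge0.
have -> : `|y1' - y1| + `|y2' - y2| = a * Q.
  rewrite /Q /q1 /q2 !normrM !normfV (gtr0_norm a0); field; exact: an.
clearbody q1 q2 s0.
have [Qz|Qn] := eqVneq Q 0; first by rewrite Qz mulr0.
have {Q0}Q0 : 0 < Q by rewrite lt_neqAle eq_sym Qn.
pose tau : R := 17 * Q; pose mu : R := Q / 500.
have tau0 : 0 < tau by rewrite /tau; lra.
(* On the disc |S| <= tau, so subtracting S^2 / (2 tau) instead of |S| / 2
   from the mean of the paraboloids still gives a function above F. The term in
   mu makes the circle lose against x1, where that function exceeds F by at most
   Q / 2; it costs 4 mu = Q / 125 in the Laplacian, less than the gain of at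
   least Q / 34 from the bent crease. *)
have Slin x y z w : S x y - S z w = q1 * (x - z) + q2 * (y - w) by rewrite /S; ring.
have qw (u v M : R) : `|u| <= M -> `|v| <= M -> `|q1 * u + q2 * v| <= Q * M.
  move=> hu hv; apply: le_trans (ler_normD _ _) _; rewrite !normrM /Q mulrDl.
  by apply: lerD; apply: ler_pM.
have n0 : 0 <= `|x1' - x1| by [].
have z2 : 0 ^+ 2 + 0 ^+ 2 = 0 :> R by rewrite expr0n /= addr0.
have [W1 _ P21] : [/\ W x1 x2, F x1 x2 <= ev (parab a c1 y1 y2) x1 x2
      & F x1 x2 <= ev (parab a c2 y1' y2') x1 x2].
  by apply: H; rewrite !subrr expr0n /=; lra.
rewrite e1 in P21.
have S1 : S x1 x2 <= 0 by rewrite -SE; lra.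
have le2 (t : R) : `|t| <= 1 -> t ^+ 2 <= 1.
  by move=> h; rewrite -[t ^+ 2]real_normK ?num_real // expr_le1.
have [W2 P12 _] : [/\ W x1' x2', F x1' x2' <= ev (parab a c1 y1 y2) x1' x2'
      & F x1' x2' <= ev (parab a c2 y1' y2') x1' x2'].
  by apply: H; have := le2 _ hx1; have := le2 _ hx2; lra.
rewrite e2 in P12.
have S2 : 0 <= S x1' x2' by rewrite -SE; lra.
have S1Q : - Q <= S x1 x2.
  have := qw _ _ _ hx1 hx2; rewrite -Slin mulr1 => /ler_normlP []; lra.
have Sb x y : (x - x1) ^+ 2 + (y - x2) ^+ 2 <= 256 -> `|S x y| <= tau.
  move=> h; have [h1 h2] : `|x - x1| <= 16 /\ `|y - x2| <= 16.
    by apply: sq_ball_le => //; lra.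
  have := qw _ _ _ h1 h2; rewrite -Slin => /ler_normlP [u1 u2].
  by apply/ler_normlP; rewrite /tau; split; lra.
have sqS x y : (x - x1) ^+ 2 + (y - x2) ^+ 2 <= 256 ->
    (2 * tau)^-1 * S x y ^+ 2 <= `|S x y| / 2.
  move=> /Sb h; rewrite -[S x y ^+ 2]real_normK ?num_real //.
  rewrite mulrC ler_pdivrMr; last by lra.
  have := normr_ge0 (S x y); move: `|S x y| h => v vt v0.
  have : v * v <= v * tau by exact: ler_wpM2l.
  by rewrite expr2; lra.
pose SX := Add (Cst s0) (Add (Mul (Cst q1) (Xv false)) (Mul (Cst q2) (Xv true))).
pose f := Add (Mul (Cst 2^-1) (Add (parab a c1 y1 y2) (parab a c2 y1' y2')))
  (Add (Mul (Cst (- (2 * tau)^-1)) (Mul SX SX)) (Mul (Cst mu) (sqd x1 x2))).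
have fE x y : ev f x y = 2^-1 * (ev (parab a c1 y1 y2) x y + ev (parab a c2 y1' y2') x y)
   - (2 * tau)^-1 * S x y ^+ 2 + mu * ((x - x1) ^+ 2 + (y - x2) ^+ 2).
  by rewrite -ev_sqd /f /S; cbn [ev SX]; rewrite expr2; ring.
have [||||x [y [hxy lf]]] := @max_principle_disc F W f x1 x2 16 cF _ vF.
- by do !split.
- lra.
- by move=> x y h; have [] := H x y; [lra|].
- move=> x y h; rewrite !fE !subrr e1 h.
  have [_ h1 h2] : [/\ W x y, F x y <= ev (parab a c1 y1 y2) x y
      & F x y <= ev (parab a c2 y1' y2') x y] by apply: H; lra.
  have h3 : (2 * tau)^-1 * S x y ^+ 2 <= `|S x y| / 2 by apply: sqS; lra.
  have h4 : 0 <= (2 * tau)^-1 * S x1 x2 ^+ 2.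
    by apply: mulr_ge0; [rewrite invr_ge0; lra|exact: sqr_ge0].
  move: h3 h4 (SE x y) (SE x1 x2) S1Q h1 h2; rewrite /mu z2 mulr0 addr0.
  move: (ev (parab a c1 y1 y2) x y) (ev (parab a c2 y1' y2') x y)
    (ev (parab a c1 y1 y2) x1 x2) (ev (parab a c2 y1' y2') x1 x2)
    ((2 * tau)^-1 * S x y ^+ 2) ((2 * tau)^-1 * S x1 x2 ^+ 2) (F x y).
  move: (S x y) (S x1 x2) => s s1 E1 E2 E3 E4 u1 u2 Fxy; clear -Q0.
  by case: (ger0P s) => hs *; lra.
have lfE : lap_expr f x y = 2 / a - tau^-1 * (q1 ^+ 2 + q2 ^+ 2) + 4 * mu.
  rewrite /f !lap_exprD !lap_exprZ lap_exprD !lap_parab // lap_sqd /lap_expr /=.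
  by field; rewrite gt_eqF.
have qQ : Q ^+ 2 <= 2 * (q1 ^+ 2 + q2 ^+ 2).
  rewrite /Q -(real_normK (num_real q1)) -(real_normK (num_real q2)).
  by have := sqr_ge0 (`|q1| - `|q2|); rewrite !expr2; lra.
have tQ : Q / 34 <= tau^-1 * (q1 ^+ 2 + q2 ^+ 2).
  by rewrite [leRHS]mulrC ler_pdivlMr // /tau; move: qQ; rewrite expr2; lra.
have h0 : 0 <= 2 + 2 / a - Q / 34 + 4 * mu by lra.
have := mulr_ge0 (ltW a0) h0.
have -> : a * (2 + 2 / a - Q / 34 + 4 * mu) =
  2 * a + 2 - (a * Q) / 34 + 4 / 500 * (a * Q) by rewrite /mu; field.
by move: (a * Q) a1 => aQ; clear; lra.
Qed.

End Discs.

(** * Logarithmic potentials *)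

Section Logs.
Variable R : realType.

(** In logarithmic form, N^N <= e^N N!. *)
Lemma sum_log_le (N : nat) : (0 < N)%N ->
  \sum_(1 <= i < N) ln (N%:R / i%:R : R) <= N%:R.
Proof.
case: N => // N _; elim: N => [|N IH]; first by rewrite big_geq.
have p0 k : 0 < k.+1%:R :> R by rewrite ltr0n.
rewrite big_nat_recr //=.
have -> : \sum_(1 <= i < N.+1) ln (N.+2%:R / i%:R : R) =
  \sum_(1 <= i < N.+1) ln (N.+1%:R / i%:R : R) + N%:R * ln (N.+2%:R / N.+1%:R).
  rewrite -[X in X%:R * _](_ : (N.+1 - 1)%N = N); last by lia.
  rewrite mulr_natl -sumr_const_nat -big_split /=.
  apply: eq_big_nat => i /andP[i1 _].
  have i0 : 0 < i%:R :> R by rewrite ltr0n.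
  by rewrite -lnM ?posrE ?divr_gt0 //; congr ln; field; rewrite !gt_eqF.
have lb : ln (N.+2%:R / N.+1%:R : R) <= N.+1%:R^-1.
  have -> : N.+2%:R / N.+1%:R = 1 + N.+1%:R^-1 :> R.
    by rewrite -[N.+2]addn1 natrD; field; rewrite gt_eqF.
  by apply: le_ln1Dx; apply: lt_trans (ltrN10 _) _; rewrite invr_gt0.
set l := ln _ in lb *; set S := \sum_(_ <= _ < _) _ in IH *.
have h1 : N.+1%:R * l <= 1 by rewrite mulrC -ler_pdivlMr // div1r.
have h2 : N.+1%:R * l = N%:R * l + l by rewrite -natr1 mulrDl mul1r.
have h3 : N.+2%:R = N.+1%:R + 1 :> R by rewrite natr1.
by rewrite h3; move: h1; rewrite h2; move: (N%:R * l) IH => *; lra.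
Qed.

(** Each value of the folded index is taken at most twice. *)
Lemma sum_fold (h : nat -> R) (m N : nat) :
  (forall i j, (i <= j)%N -> h j <= h i) ->
  (forall i, (i < N)%N -> 0 <= h i) ->
  \sum_(0 <= j < N) h (if (j < m)%N then (m - j.+1)%N else (j - m)%N) <=
  2 * \sum_(0 <= j < N) h j.
Proof.
move=> mono pos; pose M := minn m N.
have part k : (k <= N)%N -> \sum_(0 <= j < k) h j <= \sum_(0 <= j < N) h j.
  move=> kN; rewrite (@big_cat_nat _ _ _ k 0 N) //= lerDl.
  by rewrite big_nat_cond sumr_ge0 // => i /andP[/andP[_ iN] _]; exact: pos.
have MN : (M <= N)%N by exact: geq_minr.
rewrite (@big_cat_nat _ _ _ M 0 N) //= mulr_natl mulr2n; apply: lerD.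
  apply: le_trans (part _ MN); rewrite [leRHS]big_nat_rev /=.
  apply: ler_sum_nat => i /andP[_ iM]; rewrite add0n.
  have im : (i < m)%N by apply: leq_trans iM (geq_minl _ _).
  by rewrite im; apply: mono; rewrite leq_sub2r // geq_minl.
apply: le_trans (part _ (leq_subr M N)); rewrite -{1}[M]add0n big_addn.
apply: ler_sum_nat => i /andP[_ iM].
have [mN|Nm] := leqP m N.
  have Mm : M = m by exact/minn_idPl.
  by rewrite Mm ltnNge leq_addl /= addnK.
by exfalso; move: iM; rewrite /M (minn_idPr (ltnW Nm)) subnn.
Qed.

(** D j is the squared distance from a point, at distance d from a centre, to a
    pole at distance (j + 1) / N from that centre. Only the difference of the
    two distances is used: it behaves like an arithmetic progression of step
    1 / N, over which the logarithm is summable. The one or two nearest poles,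
    for which this gives nothing, are controlled by tau. *)
Lemma log_potential_le (N : nat) (tau d t2 : R) (D : nat -> R) :
  (0 < N)%N -> 0 < tau -> tau <= 1 -> ln (6 / tau) <= N%:R -> 0 <= t2 -> 0 <= d ->
  (forall j, (j < N)%N -> tau ^+ 2 <= D j) ->
  (forall j, (j < N)%N -> (d - j.+1%:R / N%:R) ^+ 2 <= D j) ->
  \sum_(0 <= j < N) (ln 36 - ln (D j + t2)) <= 52 * N%:R.
Proof.
move=> N0 tau0 tau1 Nbig t0 d0 D1 D2.
have n0 : 0 < N%:R :> R by rewrite ltr0n.
have lt0 : 0 <= ln (6 / tau).
  by apply: ln_ge0; rewrite ler_pdivlMr //; lra.
have l6 : 0 <= ln (6 * N%:R : R) by apply: ln_ge0; have : 1 <= N%:R :> R; [rewrite ler1n|lra].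
pose h i : R := if i is 0%N then 2 * (ln (6 / tau) + ln (6 * N%:R)) else 2 * ln (6 * N%:R / i%:R).
have hm i j : (i <= j)%N -> h j <= h i.
  have H k l : (0 < k)%N -> (k <= l)%N -> ln (6 * N%:R / l%:R : R) <= ln (6 * N%:R / k%:R).
    move=> k0 kl; have k0' : 0 < k%:R :> R by rewrite ltr0n.
    have l0' : 0 < l%:R :> R by rewrite ltr0n (leq_trans k0).
    rewrite ler_ln ?posrE ?divr_gt0 ?mulr_gt0 //.
    by rewrite ler_pM2l ?mulr_gt0 // lef_pV2 ?posrE // ler_nat.
  case: i => [|i]; case: j => [//|j] // ij; rewrite /h; last first.
    by have := @H i.+1 j.+1 isT ij; lra.
  by have := @H 1%N j.+1 isT isT; rewrite divr1; lra.
have hp i : (i < N)%N -> 0 <= h i.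
  case: i => [|i] iN; first by rewrite /h; lra.
  rewrite /h mulr_ge0 // ln_ge0 // ler_pdivlMr ?ltr0n // mul1r.
  by have : i.+1%:R <= N%:R :> R; [rewrite ler_nat ltnW|lra].
pose m := Num.truncn (N%:R * d).
have [m1 m2] : m%:R <= N%:R * d /\ N%:R * d < m.+1%:R.
  by have /andP[] := truncn_itv (mulr_ge0 (ltW n0) d0).
have term j : (j < N)%N ->
    ln 36 - ln (D j + t2) <= h (if (j < m)%N then (m - j.+1)%N else (j - m)%N).
  move=> jN; set c := (if _ then _ else _).
  have Dp : 0 < D j + t2.
    by have := D1 j jN; have : 0 < tau ^+ 2; [rewrite exprn_gt0|lra].
  have lower (v : R) : 0 < v -> v ^+ 2 <= D j -> ln 36 - ln (D j + t2) <= 2 * ln (6 / v).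
    move=> v0 vD; have : ln (v ^+ 2) <= ln (D j + t2).
      by rewrite ler_ln ?posrE ?exprn_gt0 //; lra.
    rewrite lnXn // ln_div ?posrE // (_ : 36 = 6 ^+ 2 :> R); last by ring.
    by rewrite lnXn //; lra.
  case ce : c => [|i].
    by have := lower _ tau0 (D1 j jN); rewrite /h; lra.
  have -> : h i.+1 = 2 * ln (6 / (i.+1%:R / N%:R)).
    by rewrite /h; congr (_ * ln _); field; rewrite !gt_eqF // ltr0n.
  apply: lower; first by rewrite divr_gt0 // ltr0n.
  apply: le_trans (D2 j jN).
  have ge (v : R) : i.+1%:R <= N%:R * v -> (i.+1%:R / N%:R) ^+ 2 <= v ^+ 2.
    move=> hv; have hv' : i.+1%:R / N%:R <= v by rewrite ler_pdivrMr // mulrC.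
    have h0 : 0 <= i.+1%:R / N%:R :> R by rewrite divr_ge0.
    by rewrite ler_pXn2r // nnegrE //; lra.
  have [jm|mj] := ltnP j m.
    have cE : c = (m - j.+1)%N by rewrite /c jm.
    apply: ge; rewrite mulrBr mulrCA divff ?gt_eqF // mulr1.
    by rewrite -ce cE natrB //; lra.
  have cE : c = (j - m)%N by rewrite /c ltnNge mj.
  rewrite -(sqrrN (d - _)) opprB; apply: ge.
  rewrite mulrBr mulrCA divff ?gt_eqF // mulr1 -ce cE natrB //.
  by move: m2; rewrite -natr1 -[j.+1%:R]natr1; lra.
apply: le_trans (_ : \sum_(0 <= j < N) h (if (j < m)%N then (m - j.+1)%N else (j - m)%N) <= _).
  by apply: ler_sum_nat => j /andP[_ jN]; exact: term.
apply: le_trans (sum_fold m hm hp) _.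
suff : \sum_(0 <= j < N) h j <= 26 * N%:R by lra.
rewrite (@big_cat_nat _ _ _ 1) //= big_nat1.
have l6N : ln (6 * N%:R : R) <= 6 * N%:R by apply/ltW/ln_sublinear; rewrite mulr_gt0.
have -> : h 0%N = 2 * (ln (6 / tau) + ln (6 * N%:R)) by [].
suff : \sum_(1 <= i < N) h i <= 12 * N%:R by lra.
have ln6 : ln 6 <= 5 :> R.
  have -> : 6 = 1 + 5 :> R by ring.
  by apply: le_ln1Dx; lra.
apply: le_trans (_ : \sum_(1 <= i < N) (10 + 2 * ln (N%:R / i%:R)) <= _).
  apply: ler_sum_nat => -[//|i] _; rewrite /h.
  have i0 : 0 < i.+1%:R :> R by rewrite ltr0n.
  by rewrite -mulrA lnM ?posrE ?divr_gt0 //; lra.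
rewrite big_split /= sumr_const_nat -mulr_sumr -mulr_natr.
have := sum_log_le N0; have : (N - 1)%:R <= N%:R :> R by rewrite ler_nat leq_subr.
lra.
Qed.
End Logs.

(** * A Harnack inequality *)

Section Harnack.
Variable R : realType.
Implicit Types (e : expr R) (F : R -> R -> R) (W : R -> R -> Prop).

Lemma cauchy_dist (u1 u2 v1 v2 d r : R) : 0 <= d -> 0 <= r ->
  d ^+ 2 = u1 ^+ 2 + u2 ^+ 2 -> r ^+ 2 = v1 ^+ 2 + v2 ^+ 2 ->
  (d - r) ^+ 2 <= (u1 - v1) ^+ 2 + (u2 - v2) ^+ 2.
Proof.
move=> d0 r0 hd hr.
have cs : (u1 * v1 + u2 * v2) ^+ 2 <= (d * r) ^+ 2.
  rewrite exprMn hd hr; have := sqr_ge0 (u1 * v2 - u2 * v1).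
  by rewrite !expr2; lra.
have : u1 * v1 + u2 * v2 <= d * r.
  apply: le_trans (ler_norm _) _.
  by rewrite -(@ler_pXn2r _ 2) ?nnegrE ?mulr_ge0 // real_normK ?num_real.
by move: hd hr; rewrite !expr2; lra.
Qed.

Lemma cont2N F : cont2 F -> cont2 (fun x y => - F x y).
Proof. by move=> cF p; apply: continuousN; exact: cF. Qed.

(** Uniform continuity on a disc of radius 8, by compactness of the set of
    pairs of points between which F varies by 1 or more. *)
Lemma unit_oscillation F (x1 x2 : R) : cont2 F -> exists tau : R, [/\ 0 < tau, tau <= 1 &
  forall x y x' y', (x - x1) ^+ 2 + (y - x2) ^+ 2 <= 64 ->
    (x' - x1) ^+ 2 + (y' - x2) ^+ 2 <= 64 ->
    (x' - x) ^+ 2 + (y' - y) ^+ 2 <= tau ^+ 2 -> `|F x y - F x' y'| <= 1].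
Proof.
move=> cF.
pose c (_ : nat) := Add (Cst 64) (Mul (Cst (-1)) (sqd x1 x2)).
have cE i x y : ev (c i) x y = 64 - ((x - x1) ^+ 2 + (y - x2) ^+ 2).
  by rewrite /c /= !expr2; ring.
pose K := [set p | forall i, (i < 1)%N -> 0 <= evp (c i) p].
have KE (p : 'rV[R]_2) : K p <-> (p 0 0 - x1) ^+ 2 + (p 0 1 - x2) ^+ 2 <= 64.
  split; first by move=> /(_ 0%N isT); rewrite /evp cE; lra.
  by move=> h i _; rewrite /evp cE; lra.
have clK : closed K by apply: closed_ev_ge0.
have cK : compact K.
  apply: (@subbox_compact _ _ (8 + `|x1| + `|x2|)) => // p /KE h.
  have [] : `|p 0 0 - x1| <= 8 /\ `|p 0 1 - x2| <= 8 by apply: sq_ball_le; lra.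
  have := ler_normD (p 0 0 - x1) x1; have := ler_normD (p 0 1 - x2) x2.
  by rewrite !subrK /box /=; have := normr_ge0 x1; have := normr_ge0 x2; lra.
pose V : Type := ('rV[R]_2 * 'rV[R]_2)%type.
have cf1 : continuous (fun z : V => onplane F z.1).
  by move=> z; apply: (@continuous_comp _ _ _ fst (onplane F)); [exact: cvg_fst|exact: cF].
have cf2 : continuous (fun z : V => onplane F z.2).
  by move=> z; apply: (@continuous_comp _ _ _ snd (onplane F)); [exact: cvg_snd|exact: cF].
pose B := [set z : V | 1 <= `|onplane F z.1 - onplane F z.2| ].
have clB : closed B.
  apply: (@closed_comp _ _ (fun z : V => `|onplane F z.1 - onplane F z.2|) [set r | 1 <= r]);
    last exact: closed_ge.
  move=> z _; apply: (@continuous_comp _ _ _ (fun z : V => onplane F z.1 - onplane F z.2)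
    (fun t => `|t|)); last exact: norm_continuous.
  by apply: continuousB; [exact: cf1|exact: cf2].
have cKB : compact ((K `*` K) `&` B).
  by apply: compact_closedI => //; exact: compact_setX.
pose f (z : V) : R := (z.2 0 0 - z.1 0 0) ^+ 2 + (z.2 0 1 - z.1 0 1) ^+ 2.
have cf : continuous f.
  have cc (b : bool) : continuous (fun z : V => z.2 0 (axis b) - z.1 0 (axis b)).
    move=> z; apply: continuousB.
      apply: (@continuous_comp _ _ _ snd (fun p : 'rV[R]_2 => p 0 (axis b)));
        [exact: cvg_snd|exact: coord_continuous].
    apply: (@continuous_comp _ _ _ fst (fun p : 'rV[R]_2 => p 0 (axis b)));
      [exact: cvg_fst|exact: coord_continuous].
  have -> : f = fun z => (z.2 0 0 - z.1 0 0) * (z.2 0 0 - z.1 0 0) +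
      (z.2 0 1 - z.1 0 1) * (z.2 0 1 - z.1 0 1).
    by apply/funext => z; rewrite /f !expr2.
  move=> z; apply: cvgD; apply: cvgM;
    by [exact: (cc false)|exact: (cc true)].
have [ne|em] := pselect ((K `*` K) `&` B !=set0); last first.
  exists 1; split => // x y x' y' h h' _; rewrite leNgt; apply/negP => big.
  apply: em; exists (pt x y, pt x' y'); split; first split => /=.
  - by apply/KE; rewrite pt0 pt1.
  - by apply/KE; rewrite pt0 pt1.
  - by rewrite /B /= /onplane !pt0 !pt1 ltW.
have [w /set_mem [[Kw1 Kw2] Bw] wmin] := compact_EVT_min ne cKB (continuous_subspaceT cf).
have fw : 0 < f w.
  rewrite lt_neqAle addr_ge0 ?sqr_ge0 // andbT eq_sym.
  apply/eqP; rewrite /f => /eqP; rewrite paddr_eq0 ?sqr_ge0 //.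
  rewrite !sqrf_eq0 !subr_eq0 => /andP[/eqP e0 /eqP e1].
  by move: Bw; rewrite /B /= /onplane e0 e1 subrr normr0; lra.
exists (Num.min 1 (f w) / 2); set m := Num.min _ _.
have m0 : 0 < m by rewrite lt_min ltr01.
have m1 : m <= 1 by rewrite ge_min lexx.
have mf : m <= f w by rewrite ge_min lexx orbT.
split; [lra|lra|] => x y x' y' h h' d; rewrite leNgt; apply/negP => big.
have := wmin (pt x y, pt x' y'); rewrite inE => H.
have : f w <= f (pt x y, pt x' y').
  apply: H; split; first split => /=.
  - by apply/KE; rewrite pt0 pt1.
  - by apply/KE; rewrite pt0 pt1.
  - by rewrite /B /= /onplane !pt0 !pt1 ltW.
rewrite {2}/f /= !pt0 !pt1; move: d; rewrite [(m / 2) ^+ 2]expr2.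
have : m * m <= m by rewrite ger_pMl.
lra.
Qed.

(** The gap P - F between F and a paraboloid P is subharmonic up to a bounded
    error, because Delta F <= 2. *)
Lemma circle_large F W (a c y1 y2 k1 k2 r : R) :
  cont2 F -> visc_lap_ge (fun x y => - F x y) W -> 0 < a -> 0 < r -> r <= 1 ->
  (forall x y, (x - k1) ^+ 2 + (y - k2) ^+ 2 < r ^+ 2 -> W x y) ->
  exists s : R * R, (s.1 - k1) ^+ 2 + (s.2 - k2) ^+ 2 = r ^+ 2 /\
    ev (parab a c y1 y2) k1 k2 - F k1 k2 - 1 <=
    ev (parab a c y1 y2) s.1 s.2 - F s.1 s.2.
Proof.
move=> cF vF a0 r0 r1 BW; apply: contrapT => nex.
have z2 : 0 ^+ 2 + 0 ^+ 2 = 0 :> R by rewrite expr0n /= addr0.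
pose f := Mul (Cst (-1)) (Add (parab a c y1 y2) (Mul (Cst 2^-1) (sqd k1 k2))).
have fE x y : ev f x y =
    - ev (parab a c y1 y2) x y - 2^-1 * ((x - k1) ^+ 2 + (y - k2) ^+ 2).
  by rewrite -ev_sqd /f; cbn [ev]; ring.
have [//||x [y [_ lf]]] := @max_principle_disc _ _ W f k1 k2 r (cont2N cF) _ vF r0 BW.
  move=> x y h; rewrite !fE h !subrr z2 mulr0 subr0.
  have n : ~ (ev (parab a c y1 y2) k1 k2 - F k1 k2 - 1 <=
             ev (parab a c y1 y2) x y - F x y).
    by move=> h'; apply: nex; exists (x, y).
  move/negP: n; rewrite -ltNge.
  have : r ^+ 2 <= 1 by rewrite expr_le1 // ltW.
  by move: (ev _ x y) (ev _ k1 k2) => *; lra.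
move: lf; rewrite /f lap_exprZ lap_exprD lap_parab ?gt_eqF // lap_exprZ lap_sqd.
have : 0 < 2 / a by rewrite divr_gt0.
lra.
Qed.

(** The logarithmic singularities are smoothed at scale t2^(1/2), to be valid
    test functions across the poles; the price is a Laplacian of order
    t2 / tau^4 at distance tau from them. *)
Fixpoint logsum (s : nat -> R * R) (t2 : R) (N : nat) : expr R :=
  if N is N'.+1
  then Add (logsum s t2 N') (Ln (Add (sqd (s N').1 (s N').2) (Cst t2)))
  else Cst 0.

Lemma wf_logsum s t2 N : 0 < t2 -> wf (logsum s t2 N).
Proof.
move=> t0; elim: N => //= N IH; split => //; split; first by do !split.
by move=> x y; rewrite -!expr2 ltr_wpDl // addr_ge0 // sqr_ge0.
Qed.

Lemma ev_logsum s t2 N x y : ev (logsum s t2 N) x y =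
  \sum_(0 <= j < N) ln ((x - (s j).1) ^+ 2 + (y - (s j).2) ^+ 2 + t2).
Proof.
by elim: N => [|N IH]; [rewrite big_geq|rewrite big_nat_recr //= IH !expr2].
Qed.

Lemma lap_logsum s t2 N x y (tau : R) : 0 < t2 -> 0 < tau ->
  (forall j, (j < N)%N -> tau ^+ 2 <= (x - (s j).1) ^+ 2 + (y - (s j).2) ^+ 2) ->
  lap_expr (logsum s t2 N) x y <= N%:R * (4 * t2 / tau ^+ 4).
Proof.
move=> t0 tau0; elim: N => [|N IH] h; first by rewrite mul0r lap_exprC.
rewrite [logsum _ _ _]/= lap_exprD -natr1 mulrDl mul1r; apply: lerD.
  by apply: IH => j jN; apply: h; rewrite ltnS ltnW.
have hN := h N (ltnSn N).
have tp : 0 < tau ^+ 2 by rewrite exprn_gt0.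
set D := _ + _ in hN.
have Dt : 0 < D + t2 by lra.
have -> : lap_expr (Ln (Add (sqd (s N).1 (s N).2) (Cst t2))) x y = 4 * t2 / (D + t2) ^+ 2.
  rewrite /lap_expr /= -!expr2 -/D; set u := x - _; set v := y - _.
  have -> : t2 = (D + t2) - u ^+ 2 - v ^+ 2 by rewrite /D -/u -/v; ring.
  have -> : D + (D + t2 - u ^+ 2 - v ^+ 2) = D + t2 by rewrite /D -/u -/v; ring.
  by field; rewrite gt_eqF.
apply: ler_wpM2l; first lra.
rewrite lef_pV2 ?posrE ?exprn_gt0 // (exprM tau 2 2).
by rewrite ler_pXn2r ?nnegrE //; lra.
Qed.

Lemma sq_sum2_le4 (u v k1 k2 x1 x2 : R) :
  (u - k1) ^+ 2 + (v - k2) ^+ 2 <= 1 -> (k1 - x1) ^+ 2 + (k2 - x2) ^+ 2 <= 1 ->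
  (u - x1) ^+ 2 + (v - x2) ^+ 2 <= 4.
Proof.
have := sqr_ge0 ((u - k1) - (k1 - x1)); have := sqr_ge0 ((v - k2) - (k2 - x2)).
by rewrite !expr2; lra.
Qed.

(** A gap T at k gives on each circle of radius r j = (j + 1) / N around k a
    point s j with gap at least T - 1. The barrier is the paraboloid minus A
    times the potential w of the points s j, plus a multiple of
    64 - |z - x|^2 that makes its Laplacian less than -2. It lies above F on the
    circle of radius 8, where w <= 0, and on the circles of radius tau around
    the poles, where the gap is still T - 2 while w is bounded independently of
    N. At x, where F meets the paraboloid, w is bounded below, so that the
    barrier passes below F when T exceeds a multiple of A. *)
Lemma harnack F W (a c x1 x2 y1 y2 k1 k2 : R) :
  cont2 F -> visc_lap_ge F W -> visc_lap_ge (fun x y => - F x y) W -> 0 < a -> a <= 1 ->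
  (forall x y, (x - x1) ^+ 2 + (y - x2) ^+ 2 <= 64 ->
     W x y /\ F x y <= ev (parab a c y1 y2) x y) ->
  F x1 x2 = ev (parab a c y1 y2) x1 x2 ->
  (k1 - x1) ^+ 2 + (k2 - x2) ^+ 2 <= 1 ->
  ev (parab a c y1 y2) k1 k2 - F k1 k2 <= 8400 / a.
Proof.
move=> cF vF vNF a0 a1 H Fx kx; rewrite leNgt; apply/negP => big.
have ai : 1 <= a^-1 by rewrite invf_ge1.
pose G x y : R := ev (parab a c y1 y2) x y - F x y.
have cG : cont2 G by apply: cont2B => //; apply: cont2_ev.
have GE x y : F x y = ev (parab a c y1 y2) x y - G x y by rewrite /G subKr.
have [T TE] : exists T, T = G k1 k2 by exists (G k1 k2).
have [A AE] : exists A : R, A = 320 / a by exists (320 / a).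
have A320 : 320 <= A by rewrite AE; move: ai; goal_lra.
have A0 : 0 < A by move: A320; goal_lra.
have A20 : 0 < 2 * A by move: A0; goal_lra.
have TA : 26 * A + 2 <= T.
  have : 8400 / a < T by rewrite TE.
  by move: ai; rewrite AE; goal_lra.
have [tau [tau0 tau1 unif]] := unit_oscillation x1 x2 cG.
(* The modulus of continuity fixes tau, and only then is the number of poles
   chosen: this keeps the contribution of the nearest pole bounded. *)
have [N [N0 Nbig]] : exists N : nat, (0 < N)%N /\ ln (6 / tau) <= N%:R.
  by exists (Num.truncn (ln (6 / tau))).+1; split => //; apply/ltW/truncnS_gt.
have n0 : 0 < N%:R :> R by rewrite ltr0n.
pose r (j : nat) : R := j.+1%:R / N%:R.
have r0 j : 0 < r j by rewrite divr_gt0 // ltr0n.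
have r1 j : (j < N)%N -> r j <= 1.
  by move=> jN; rewrite ler_pdivrMr // mul1r ler_nat.
have rsq j : (j < N)%N -> r j ^+ 2 <= 1.
  by move=> jN; rewrite expr_le1 // ?r1 // ltW.
have ex_s j : exists s : R * R, (j < N)%N ->
    (s.1 - k1) ^+ 2 + (s.2 - k2) ^+ 2 = r j ^+ 2 /\ T - 1 <= G s.1 s.2.
  have [jN|_] := ltnP j N; last by exists (0, 0).
  have [] := @circle_large F W a c y1 y2 k1 k2 (r j) cF vNF a0 (r0 j) (r1 j jN).
    move=> x y h; have [] // := H x y; apply: le_trans (_ : 4 <= _); last by rewrite ler_nat.
    by apply: sq_sum2_le4 kx; apply: ltW (lt_le_trans h (rsq j jN)).
  by move=> s hs; exists s; rewrite TE.
have [s hs] := choice ex_s.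
have s4 j : (j < N)%N -> ((s j).1 - x1) ^+ 2 + ((s j).2 - x2) ^+ 2 <= 4.
  by move=> jN; have [h _] := hs j jN; apply: sq_sum2_le4 kx; rewrite h; exact: rsq.
have s64 j : (j < N)%N -> ((s j).1 - x1) ^+ 2 + ((s j).2 - x2) ^+ 2 <= 64.
  by move=> /s4 h; apply: le_trans h _; rewrite ler_nat.
have tau4 : 0 < tau ^+ 4 by rewrite exprn_gt0.
have [t2 t2E] : exists t2, t2 = tau ^+ 4 / (2 * A) by exists (tau ^+ 4 / (2 * A)).
have t20 : 0 < t2 by rewrite t2E divr_gt0.
have t21 : t2 <= 1.
  rewrite t2E ler_pdivrMr // mul1r.
  have : tau ^+ 4 <= 1 by rewrite expr_le1 // ltW.
  by move: (tau ^+ 4) A320; goal_lra.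
pose D j x y : R := (x - (s j).1) ^+ 2 + (y - (s j).2) ^+ 2.
pose f := Add (parab a c y1 y2) (Add
  (Mul (Cst (A / (2 * N%:R))) (Add (logsum s t2 N) (Cst (- (N%:R * ln 36)))))
  (Mul (Cst (2 / a)) (Add (Cst 64) (Mul (Cst (-1)) (sqd x1 x2))))).
have okf : wf f.
  split; first by do !split.
  split; last by do !split.
  by split => //; split => //; exact: wf_logsum.
pose w x y : R := \sum_(0 <= j < N) (ln 36 - ln (D j x y + t2)).
have fE x y : ev f x y = ev (parab a c y1 y2) x y - A / (2 * N%:R) * w x y
    + 2 / a * (64 - ((x - x1) ^+ 2 + (y - x2) ^+ 2)).
  have -> : w x y = N%:R * ln 36 - ev (logsum s t2 N) x y.
    by rewrite ev_logsum /w sumrB sumr_const_nat subn0 mulr_natl.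
  rewrite -ev_sqd /f; move: (parab _ _ _ _) (sqd _ _) (logsum _ _ _) => P Q L.
  by rewrite /=; ring.
pose cs (i : nat) : expr R :=
  if i is j.+1 then Add (sqd (s j).1 (s j).2) (Cst (- tau ^+ 2))
  else Add (Cst 64) (Mul (Cst (-1)) (sqd x1 x2)).
have csS j x y : ev (cs j.+1) x y = D j x y - tau ^+ 2 by rewrite /D -ev_sqd.
have cs0 x y : ev (cs 0%N) x y = 64 - ((x - x1) ^+ 2 + (y - x2) ^+ 2).
  by rewrite -ev_sqd /cs; cbn [ev]; rewrite mulN1r.
have AN : 0 < A / (2 * N%:R) by rewrite divr_gt0 // mulr_gt0.
have AN2 (v : R) : A / (2 * N%:R) * (v * N%:R) = A / 2 * v.
  by field; rewrite gt_eqF.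
have z2 : 0 ^+ 2 + 0 ^+ 2 = 0 :> R by rewrite expr0n /= addr0.
have fx : ev f x1 x2 < F x1 x2.
  rewrite fE Fx !subrr z2 subr0.
  have : 31 / 36 * N%:R <= w x1 x2.
    rewrite mulr_natr -[X in _ *+ X](subn0 N) -sumr_const_nat.
    apply: ler_sum_nat => j /andP[_ jN].
    have D4 : D j x1 x2 <= 4.
      by have := s4 j jN; rewrite /D -(sqrrN (x1 - _)) -(sqrrN (x2 - _)) !opprB.
    have D0 : 0 <= D j x1 x2 by rewrite addr_ge0 // sqr_ge0.
    have : ln (D j x1 x2 + t2) <= ln 5.
      by rewrite ler_ln ?posrE //; move: (D _ _ _) D4 D0 t20 t21; goal_lra.
    have : ln (5 / 36) <= (5 / 36 - 1) :> R.
      have -> : 5 / 36 = 1 + (5 / 36 - 1) :> R by ring.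
      by apply: le_trans (le_ln1Dx _) _; clear; lra.
    rewrite ln_div ?posrE ?ltr0n //; move: (ln _) (ln 5) (ln 36); goal_lra.
  move=> /(ler_wpM2l (ltW AN)); rewrite AN2 AE.
  by move: (_ / (2 * N%:R) * w x1 x2) ai (ev _ _ _); goal_lra.
have Kx i : (i < N.+1)%N -> 0 <= ev (cs i) x1 x2.
  case: i => [_|j jN]; first by rewrite cs0 !subrr z2 subr0.
  rewrite csS leNgt subr_lt0; apply/negP => lt.
  have [_ Gs] := hs j jN.
  have /ler_normlP [_] : `|G (s j).1 (s j).2 - G x1 x2| <= 1.
    apply: unif; [exact: s64|by rewrite !subrr z2 ler0n|exact: ltW].
  have -> : G x1 x2 = 0 by rewrite /G Fx subrr.
  by move: Gs TA A320; move: (G _ _); goal_lra.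
have [|||||x [y [hO lf]]] :=
  @max_principle_ev _ F W f cs N.+1 (8 + `|x1| + `|x2|) x1 x2 cF okf vF.
- by case.
- move=> x y /(_ 0%N isT); rewrite cs0 subr_ge0 => h.
  have [] : `|x - x1| <= 8 /\ `|y - x2| <= 8.
    by apply: sq_ball_le => //; rewrite (_ : 8 ^+ 2 = 64) // expr2 -natrM.
  have := ler_normD (x - x1) x1; have := ler_normD (y - x2) x2.
  by rewrite !subrK; have := normr_ge0 x1; have := normr_ge0 x2; goal_lra.
- move=> x y /(_ 0%N isT); rewrite cs0 subr_gt0 => h.
  by have [] := H x y (ltW h).
- by [].
- move=> x y i hK iN ci; apply: le_lt_trans (_ : 0 < _); last by rewrite subr_gt0.
  have := hK 0%N isT; rewrite cs0 subr_ge0 => h64.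
  have [Wxy FP] := H x y h64.
  have pos : 0 <= 2 / a * (64 - ((x - x1) ^+ 2 + (y - x2) ^+ 2)).
    by rewrite mulr_ge0 ?subr_ge0 // divr_ge0 // ltW.
  rewrite fE; case: i iN ci => [_|j jN]; rewrite ?cs0 ?csS => /subr0_eq ci.
    suff : A / (2 * N%:R) * w x y <= 0.
      by move: FP pos; move: (_ * w x y) (ev _ _ _) (_ * (64 - _)) (F x y); goal_lra.
    rewrite pmulr_rle0 // /w big_nat_cond sumr_le0 // => j /andP[/andP[_ jN] _].
    have D36 : 36 <= D j x y.
      have q0 : 0 <= ((s j).1 - x1) ^+ 2 + ((s j).2 - x2) ^+ 2.
        by rewrite addr_ge0 // sqr_ge0.
      have e8 : 8 ^+ 2 = (x - x1) ^+ 2 + (y - x2) ^+ 2 by rewrite -ci expr2 -natrM.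
      have := cauchy_dist (ler0n _ 8) (sqrtr_ge0 _) e8 (sqr_sqrtr q0).
      have -> : x - x1 - ((s j).1 - x1) = x - (s j).1 by ring.
      have -> : y - x2 - ((s j).2 - x2) = y - (s j).2 by ring.
      rewrite -/(D j x y); apply: le_trans.
      have : Num.sqrt (((s j).1 - x1) ^+ 2 + ((s j).2 - x2) ^+ 2) <= 2.
        rewrite -(@ler_pXn2r _ 2) ?nnegrE ?sqrtr_ge0 // sqr_sqrtr //.
        by have := s4 j jN; rewrite [2 ^+ 2]expr2 -natrM.
      by move: (Num.sqrt _) => q; rewrite expr2; clear; intros; nra.
    rewrite subr_le0 ler_ln ?posrE //; move: (D _ _ _) D36 t20; goal_lra.
  have [_ Gs] := hs j jN.
  have /ler_normlP [_] : `|G (s j).1 (s j).2 - G x y| <= 1.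
    by apply: unif => //; [exact: s64|rewrite -/(D j x y) ci].
  have wb : w x y <= 52 * N%:R.
    pose dd := (x - k1) ^+ 2 + (y - k2) ^+ 2.
    have dd0 : 0 <= dd by rewrite addr_ge0 // sqr_ge0.
    apply: (@log_potential_le _ N tau (Num.sqrt dd)) => //.
    - exact: ltW.
    - by move=> l lN; have := hK l.+1 lN; rewrite csS subr_ge0.
    move=> l lN; have [hl _] := hs l lN.
    have := cauchy_dist (sqrtr_ge0 _) (ltW (r0 l)) (sqr_sqrtr dd0) (esym hl).
    have -> : x - k1 - ((s l).1 - k1) = x - (s l).1 by ring.
    by have -> : y - k2 - ((s l).2 - k2) = y - (s l).2 by ring.
  have := ler_wpM2l (ltW AN) wb; rewrite AN2.
  rewrite (GE x y); move: TA Gs pos; move: (ev _ _ _) (_ * w x y) => P v.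
  by move: (G x y) (G _ _) (_ * (64 - _)); goal_lra.
have lL : lap_expr (logsum s t2 N) x y <= N%:R * (4 * t2 / tau ^+ 4).
  by apply: lap_logsum => // j jN; have := hO j.+1 jN; rewrite csS subr_gt0 => /ltW.
have t24 : 4 * t2 / tau ^+ 4 = 2 / A.
  by rewrite t2E; field; rewrite !gt_eqF.
have lfE : lap_expr f x y = 2 / a + A / (2 * N%:R) * lap_expr (logsum s t2 N) x y - 8 / a.
  rewrite /f lap_exprD lap_parab ?gt_eqF // lap_exprD !lap_exprZ
    !lap_exprD !lap_exprC lap_exprZ lap_sqd.
  by field; rewrite !gt_eqF.
have := ler_wpM2l (ltW AN) lL; rewrite t24.
have -> : A / (2 * N%:R) * (N%:R * (2 / A)) = 1.
  by field; rewrite !gt_eqF.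
by move: lf ai; rewrite lfE; move: (_ * lap_expr _ _ _); goal_lra.
Qed.

End Harnack.

(** * Half planes and barriers *)

Section Separation.
Variable R : realType.

Lemma in_ball (p q : 'rV[R]_2) (d : R) : 0 < d ->
  `|p 0 0 - q 0 0| < d -> `|p 0 1 - q 0 1| < d -> ball p d q.
Proof.
move=> d0 h0 h1; split => // i j; rewrite (ord1 i).
by have [b ->] := axis_surj j; case: b.
Qed.

Lemma out_ball (p q : 'rV[R]_2) (d : R) : ball p d q ->
  `|p 0 0 - q 0 0| < d /\ `|p 0 1 - q 0 1| < d.
Proof. by move=> [_ h]; split; exact: h. Qed.

Lemma box_closure (C : set 'rV[R]_2) M : C `<=` box M -> closure C `<=` box M.
Proof.
move=> CM.
have clb : closed (@box R M).
  rewrite (_ : box M = ((fun p : 'rV[R]_2 => `|p 0 0|) @^-1` [set r | r <= M]) `&`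
    ((fun p : 'rV[R]_2 => `|p 0 1|) @^-1` [set r | r <= M])); last by apply/seteqP; split => p [].
  by apply: closedI; apply: closed_comp; try exact: closed_le;
    move=> p _; apply: (@continuous_comp _ _ _ (fun p : 'rV[R]_2 => p 0 _) (fun t => `|t|));
    [exact: coord_continuous|exact: norm_continuous
    |exact: coord_continuous|exact: norm_continuous].
by move: (closureS CM); rewrite closure_id in clb; rewrite -clb.
Qed.

Lemma unit_coord_le (v w : R) : v ^+ 2 + w ^+ 2 = 1 -> `|v| <= 1.
Proof.
move=> h; rewrite -(@ler_pXn2r _ 2) ?nnegrE // real_normK ?num_real // expr1n.
by rewrite -h lerDl sqr_ge0.
Qed.

Lemma unit_lin_le (v1 v2 x y : R) : v1 ^+ 2 + v2 ^+ 2 = 1 ->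
  `|v1 * x + v2 * y| <= `|x| + `|y|.
Proof.
move=> vv; have n1 : `|v1| <= 1 by exact: unit_coord_le vv.
have n2 : `|v2| <= 1 by apply: (@unit_coord_le _ v1); rewrite addrC.
apply: le_trans (ler_normD _ _) _.
by apply: lerD; rewrite normrM ler_piMl.
Qed.

Definition convex2 (C : set 'rV[R]_2) := forall p q (t : R),
  C p -> C q -> 0 < t -> t < 1 -> C (t *: p + (1 - t) *: q).

(** Pushing y away from x0 leaves the closure: otherwise y would lie strictly
    between an interior point and a point of the closure. *)
Lemma not_closure (C : set 'rV[R]_2) (x0 y : 'rV[R]_2) (la : R) :
  open C -> convex2 C -> C x0 -> ~ C y -> 0 < la ->
  ~ closure C (y + la *: (y - x0)).
Proof.
move=> oC cvC Cx0 nCy la0 cl.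
have /nbhs_ballP [rho /= rho0 ball_C] := open_nbhs_nbhs (conj oC Cx0).
have lr : 0 < la * rho by exact: mulr_gt0.
have [q [Cq /out_ball [h0 h1]]] := cl _ (nbhsx_ballx _ _ lr).
pose y' := y + la *: (y - x0).
pose x' := x0 + la^-1 *: (y' - q).
have lan : la != 0 by rewrite gt_eqF.
have Cx' : C x'.
  have sc (v : R) : `|v| < la * rho -> `|la^-1 * v| < rho.
    by move=> h; rewrite normrM gtr0_norm ?invr_gt0 // mulrC ltr_pdivrMr // mulrC.
  have x'E i : x0 0 i - x' 0 i = - (la^-1 * (y' 0 i - q 0 i)).
    by rewrite /x' !mxE; ring.
  by apply: ball_C; apply: in_ball => //; rewrite x'E normrN; exact: sc.
have l1 : 0 < 1 + la by lra.
apply: nCy; have -> : y = (1 + la)^-1 *: q + (1 - (1 + la)^-1) *: x'.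
  by apply/rowP => i; rewrite /x' /y' !mxE; field; rewrite lan gt_eqF.
by apply: cvC => //; [rewrite invr_gt0|rewrite invf_lt1 //; lra].
Qed.

(** The half plane is orthogonal to the segment from a point slightly beyond y
    to its nearest point in the closure of C. The loss eta avoids passing to the
    limit when y is on the boundary. *)
Lemma separation (C : set 'rV[R]_2) (M : R) (x0 y : 'rV[R]_2) (eta : R) :
  open C -> convex2 C -> C `<=` box M -> C x0 -> ~ C y -> 0 < eta ->
  exists v1 v2 c : R, [/\ v1 ^+ 2 + v2 ^+ 2 = 1, c <= 2 * M,
    forall z, C z -> v1 * z 0 0 + v2 * z 0 1 <= c
    & c - eta <= v1 * y 0 0 + v2 * y 0 1].
Proof.
move=> oC cvC CM Cx0 nCy eta0.
pose B := `|y 0 0 - x0 0 0| + `|y 0 1 - x0 0 1|.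
have B0 : 0 <= B by rewrite addr_ge0.
have [la [la0 laB]] : exists la : R, 0 < la /\ la * B <= eta.
  exists (eta / (B + 1)); split; first by rewrite divr_gt0 //; lra.
  by rewrite mulrAC ler_pdivrMr ?ler_wpM2l //; lra.
pose y' := y + la *: (y - x0).
have nK : ~ closure C y' by exact: not_closure.
have KM := box_closure CM.
have cK : compact (closure C).
  by apply: (@subbox_compact _ _ M) => //; exact: closed_closure.
pose e := sqd (y' 0 0) (y' 0 1).
have ce : continuous (evp e) by exact: evp_continuous.
have ne : closure C !=set0 by exists x0; exact: subset_closure.
have [z0 /set_mem Kz0 zmin] := EVT_min_rV ne cK (continuous_subspaceT ce).
have eE p : evp e p = (p 0 0 - y' 0 0) ^+ 2 + (p 0 1 - y' 0 1) ^+ 2.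
  by rewrite /evp ev_sqd.
pose a1 := y' 0 0 - z0 0 0; pose a2 := y' 0 1 - z0 0 1.
have obt z : C z -> a1 * (z 0 0 - z0 0 0) + a2 * (z 0 1 - z0 0 1) <= 0.
  move=> Cz; rewrite leNgt; apply/negP; set g := (X in 0 < X) => g0.
  pose Q := (z 0 0 - z0 0 0) ^+ 2 + (z 0 1 - z0 0 1) ^+ 2.
  have Q0 : 0 <= Q by rewrite addr_ge0 // sqr_ge0.
  have [t [t0 t1 tQ]] : exists t : R, [/\ 0 < t, t < 1 & t * Q < 2 * g].
    exists (g / (Q + g + 1)); have p : 0 < Q + g + 1 by lra.
    split; [by rewrite divr_gt0|by rewrite ltr_pdivrMr //; lra|].
    rewrite mulrAC ltr_pdivrMr //.
    have gQ : 0 <= g * Q by rewrite mulr_ge0 // ltW.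
    have gg : 0 < g * g by rewrite mulr_gt0.
    by clear -g0 gQ gg; lra.
  pose zt := t *: z + (1 - t) *: z0.
  have Kzt : closure C zt.
    move=> A /nbhs_ballP [d /= d0 dA].
    have [p [Cp /out_ball [h0 h1]]] := Kz0 _ (nbhsx_ballx _ _ d0).
    exists (t *: z + (1 - t) *: p); split; first exact: cvC.
    have sc (b : R) : `|b| < d -> `|(1 - t) * b| < d.
      move=> h; rewrite normrM gtr0_norm ?subr_gt0 //.
      by apply: le_lt_trans h; rewrite ler_piMl //; lra.
    by apply: dA; apply: in_ball => //; rewrite !mxE opprD addrACA subrr add0r
      -mulrN -mulrDr; exact: sc.
  have := zmin zt; rewrite inE => /(_ Kzt); rewrite !eE.
  have -> : zt 0 0 - y' 0 0 = t * (z 0 0 - z0 0 0) - a1 by rewrite /a1 !mxE; ring.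
  have -> : zt 0 1 - y' 0 1 = t * (z 0 1 - z0 0 1) - a2 by rewrite /a2 !mxE; ring.
  have -> : z0 0 0 - y' 0 0 = - a1 by rewrite /a1; ring.
  have -> : z0 0 1 - y' 0 1 = - a2 by rewrite /a2; ring.
  have -> : (t * (z 0 0 - z0 0 0) - a1) ^+ 2 + (t * (z 0 1 - z0 0 1) - a2) ^+ 2 =
     t * (t * Q - 2 * g) + (- a1) ^+ 2 + (- a2) ^+ 2 by rewrite /Q /g; ring.
  have : t * (t * Q - 2 * g) < 0 by rewrite (pmulr_rlt0 _ t0) subr_lt0; exact: tQ.
  by move: (t * _); goal_lra.
have aa0 : 0 < a1 ^+ 2 + a2 ^+ 2.
  rewrite lt_neqAle addr_ge0 ?sqr_ge0 // andbT eq_sym; apply/eqP.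
  move=> /eqP; rewrite paddr_eq0 ?sqr_ge0 // !sqrf_eq0 !subr_eq0.
  move=> /andP[/eqP e0 /eqP e1]; apply: nK.
  suff -> : y' = z0 by [].
  by rewrite (ptE y') (ptE z0) e0 e1.
pose m := Num.sqrt (a1 ^+ 2 + a2 ^+ 2).
have m0 : 0 < m by rewrite sqrtr_gt0.
have m2 : m ^+ 2 = a1 ^+ 2 + a2 ^+ 2 by rewrite sqr_sqrtr // ltW.
have mn : m != 0 by rewrite gt_eqF.
clearbody m.
have [v1 v1E] : exists v, v = a1 / m by exists (a1 / m).
have [v2 v2E] : exists v, v = a2 / m by exists (a2 / m).
have vv : v1 ^+ 2 + v2 ^+ 2 = 1.
  by rewrite v1E v2E !expr_div_n -mulrDl -m2 divff // expf_neq0.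
have vlin (z w : R) : v1 * z + v2 * w <= `|z| + `|w|.
  exact: le_trans (ler_norm _) (unit_lin_le z w vv).
exists v1, v2, (v1 * z0 0 0 + v2 * z0 0 1); split => //.
- have [b0 b1] := KM _ Kz0.
  by apply: le_trans (vlin _ _) _; move: b0 b1; goal_lra.
- move=> z /obt h; rewrite -subr_le0.
  have -> : v1 * z 0 0 + v2 * z 0 1 - (v1 * z0 0 0 + v2 * z0 0 1) =
    (a1 * (z 0 0 - z0 0 0) + a2 * (z 0 1 - z0 0 1)) / m by rewrite v1E v2E; field.
  by rewrite pmulr_lle0 // invr_gt0.
have y'E : v1 * y' 0 0 + v2 * y' 0 1 - (v1 * z0 0 0 + v2 * z0 0 1) = m.
  have -> : v1 * y' 0 0 + v2 * y' 0 1 - (v1 * z0 0 0 + v2 * z0 0 1) =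
    (a1 ^+ 2 + a2 ^+ 2) / m by rewrite v1E v2E /a1 /a2; field.
  by rewrite -m2 expr2 mulfK.
have y'y : v1 * y' 0 0 + v2 * y' 0 1 =
    v1 * y 0 0 + v2 * y 0 1 + la * (v1 * (y 0 0 - x0 0 0) + v2 * (y 0 1 - x0 0 1)).
  by rewrite !mxE; ring.
have := ler_wpM2l (ltW la0) (vlin (y 0 0 - x0 0 0) (y 0 1 - x0 0 1)).
rewrite -/B; move: y'E y'y laB m0; move: (v1 * y' 0 0 + v2 * y' 0 1); goal_lra.
Qed.

End Separation.

Section Barriers.
Variable R : realType.
Implicit Types (F : R -> R -> R) (g : int -> int -> int).

Definition inside (C : set 'rV[R]_2) (x y : R) : Prop := C (pt x y).

Lemma insideE C (z : 'rV[R]_2) : inside C (z 0 0) (z 0 1) = C z.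
Proof. by rewrite /inside -ptE. Qed.

(** With t the distance to the edge of a half plane containing C, the function
    2 t (4 M - t) has Laplacian -4 and is nonnegative on the closure of C. *)
Lemma half_plane_barrier (C : set 'rV[R]_2) (M : R) F (x1 x2 y1 y2 : R) :
  open C -> convex2 C -> C `<=` box M -> 0 < M ->
  cont2 F -> visc_lap_ge F (inside C) -> (forall x y, ~ inside C x y -> F x y = 0) ->
  inside C x1 x2 -> ~ inside C y1 y2 ->
  F x1 x2 <= 8 * M * (`|x1 - y1| + `|x2 - y2| + 1).
Proof.
move=> oC cvC CM M0 cF vF F0 Cx nCy.
have [v1 [v2 [c [vv cM hC hy]]]] := separation oC cvC CM Cx nCy ltr01.
have lin z w := unit_lin_le z w vv.
pose t x y := c - (v1 * x + v2 * y).
have clt z : closure C z -> 0 <= t (z 0 0) (z 0 1).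
  pose e := Add (Cst c) (Add (Mul (Cst (- v1)) (Xv false)) (Mul (Cst (- v2)) (Xv true))).
  have eE p : evp e p = t (p 0 0) (p 0 1) by rewrite /evp /t /=; ring.
  have cle : closed (evp e @^-1` [set r | 0 <= r]).
    by apply: closed_comp; [move=> p _; exact: evp_continuous|exact: closed_ge].
  have sub : C `<=` evp e @^-1` [set r | 0 <= r].
    by move=> p /hC h; rewrite /= eE /t subr_ge0.
  move: (closureS sub); rewrite closure_id in cle; rewrite -cle => H /H.
  by rewrite /= eE.
have KM := box_closure CM.
have cltM z : closure C z -> t (z 0 0) (z 0 1) <= 4 * M.
  move=> /KM [b0 b1]; have /ler_normlP [h _] := lin (z 0 0) (z 0 1).
  by rewrite /t; clear -h b0 b1 cM; lra.
pose tx := Add (Cst c) (Add (Mul (Cst (- v1)) (Xv false)) (Mul (Cst (- v2)) (Xv true))).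
pose f := Mul (Cst 2) (Mul tx (Add (Cst (4 * M)) (Mul (Cst (-1)) tx))).
have fE x y : ev f x y = 2 * (t x y * (4 * M - t x y)) by rewrite /f /tx /t /=; ring.
have f0 z : closure C z -> 0 <= ev f (z 0 0) (z 0 1).
  move=> Kz; rewrite fE; apply: mulr_ge0 => //.
  by apply: mulr_ge0; [exact: clt|rewrite subr_ge0; exact: cltM].
have cK : compact (closure C).
  by apply: (@subbox_compact _ _ M) => //; exact: closed_closure.
have Kx : closure C (pt x1 x2) by exact: subset_closure.
have main : F x1 x2 <= ev f x1 x2.
  rewrite leNgt; apply/negP => lt.
  have [||||z _] := @max_principle R F (inside C) f (closure C) C (pt x1 x2)
      cF _ vF cK oC (@subset_closure _ C).
  - by do !split.
  - by move=> z; rewrite insideE.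
  - exact: Kx.
  - move=> z Kz nCz; rewrite /onplane /evp !pt0 !pt1.
    rewrite (F0 (z 0 0) (z 0 1)); last by rewrite insideE.
    by have := f0 _ Kz; clear -lt; lra.
  have -> : lap_expr f (z 0 0) (z 0 1) = -4 * (v1 ^+ 2 + v2 ^+ 2).
    by rewrite /lap_expr /f /tx /=; ring.
  by rewrite vv; clear; lra.
apply: le_trans main _; rewrite fE.
have t0 : 0 <= t x1 x2 by have := clt _ Kx; rewrite pt0 pt1.
have t1 : t x1 x2 <= `|x1 - y1| + `|x2 - y2| + 1.
  have := lin (y1 - x1) (y2 - x2); rewrite !(distrC _ x1) !(distrC _ x2) => /ler_normlP [_].
  by rewrite /t; move: hy; rewrite pt0 pt1; clear; lra.
apply: le_trans (_ : 8 * M * t x1 x2 <= _); last by rewrite ler_wpM2l // mulr_ge0 // ltW.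
by have : 0 <= t x1 x2 * t x1 x2; [rewrite mulr_ge0|clear; lra].
Qed.

Definition in_obstacle_class (W : R -> R -> Prop) g :=
  (forall i j, W i%:~R j%:~R -> lapz g i j <= 2) /\
  (forall i j, ~ W i%:~R j%:~R -> 0 <= g i j).

Lemma int_le_norm (M : R) (i : int) : `|i%:~R| <= M -> `|i| <= (Num.truncn M)%:Z.
Proof.
move=> h; rewrite -[ `|i| ]gez0_abs ?normr_ge0 // lez_nat truncn_ge_nat ?(le_trans _ h) //.
by rewrite -[_%:R]/((absz `|i|)%:Z%:~R) gez0_abs ?normr_ge0 // intr_norm.
Qed.

(** The lattice version starts the barrier at t = -1 and ends it at t = 4 M + 1,
    because neighbours of points of C may lie outside C by one unit. *)
Lemma lattice_barrier (C : set 'rV[R]_2) (M : R) g (x1 x2 : int) (y1 y2 : R) :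
  open C -> convex2 C -> C `<=` box M -> 1 <= M ->
  in_obstacle_class (inside C) g ->
  inside C x1%:~R x2%:~R -> ~ inside C y1 y2 ->
  - (g x1 x2)%:~R <= 10 * M * (`|x1%:~R - y1| + `|x2%:~R - y2| + 2).
Proof.
move=> oC cvC CM M1 [gle gge] Cx nCy.
have [v1 [v2 [c [vv cM hC hy]]]] := separation oC cvC CM Cx nCy ltr01.
have lin z w := unit_lin_le z w vv.
pose t (x y : R) : R := c - (v1 * x + v2 * y).
have tC x y : inside C x y -> 0 <= t x y /\ t x y <= 4 * M.
  move=> Cxy; have := hC _ Cxy; have := CM _ Cxy.
  rewrite /box /= pt0 pt1 /t => -[b0 b1] h; split; first by rewrite subr_ge0.
  by have /ler_normlP [h' _] := lin x y; clear -h' b0 b1 cM; lra.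
pose b (x y : R) : R := - 2 * ((t x y + 1) * (4 * M + 1 - t x y)).
pose s := [seq p <- zbox (Num.truncn M) | asbool (inside C p.1%:~R p.2%:~R)].
have sP i j : ((i, j) \in s) <-> inside C i%:~R j%:~R.
  rewrite mem_filter mem_zbox /=; split; first by move=> /andP[/asboolP].
  move=> h; have := CM _ h; rewrite /box /= pt0 pt1 => -[b0 b1].
  by rewrite !int_le_norm // !andbT; apply/asboolP.
have [[i j] ijs mn] := seq_argmax (fun p => b p.1%:~R p.2%:~R - (g p.1 p.2)%:~R)
  (iffRL (sP _ _) Cx).
rewrite /= in mn; have /sP Cij := ijs.
have bnd k l (u : R) : `|u| <= 1 -> t k%:~R l%:~R = t i%:~R j%:~R + u ->
    0 < b i%:~R j%:~R - (g i j)%:~R ->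
    b k%:~R l%:~R - (g k l)%:~R <= b i%:~R j%:~R - (g i j)%:~R.
  move=> u1 tu p0; have [Ckl|nC] := pselect (inside C k%:~R l%:~R).
    by apply: (mn (k, l)); apply/sP.
  have g0 : 0 <= (g k l)%:~R :> R by rewrite ler0z; exact: gge.
  have [t0 t1] := tC _ _ Cij; have /ler_normlP [u2 u3] := u1.
  have : 0 <= (t k%:~R l%:~R + 1) * (4 * M + 1 - t k%:~R l%:~R).
    by rewrite tu; apply: mulr_ge0; clear -t0 t1 u2 u3; lra.
  by rewrite /b; move: p0 g0; rewrite /b; move: (_ * _) (_ * _); goal_lra.
have main : b x1%:~R x2%:~R <= (g x1 x2)%:~R.
  rewrite leNgt; apply/negP => lt.
  have p0 : 0 < b i%:~R j%:~R - (g i j)%:~R.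
    have := mn (x1, x2); rewrite /= => H; apply: lt_le_trans (H _); last by apply/sP.
    by rewrite subr_gt0.
  have n1 : `|v1| <= 1 by exact: unit_coord_le vv.
  have n2 : `|v2| <= 1 by apply: (@unit_coord_le _ _ v1); rewrite addrC.
  have := bnd (i + 1) j (- v1); have := bnd (i - 1) j v1.
  have := bnd i (j + 1) (- v2); have := bnd i (j - 1) v2.
  rewrite !normrN /t !(intrD, mulrNz, mulr1z) => A1 A2 A3 A4.
  have {}A1 := A1 n2 ltac:(ring) p0; have {}A2 := A2 n2 ltac:(ring) p0.
  have {}A3 := A3 n1 ltac:(ring) p0; have {}A4 := A4 n1 ltac:(ring) p0.
  have := gle i j Cij; rewrite -(@ler_int R) lapzR.
  move: A1 A2 A3 A4; rewrite /b /t.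
  have E : - 2 * ((c - (v1 * i%:~R + v2 * (j%:~R - 1)) + 1) *
      (4 * M + 1 - (c - (v1 * i%:~R + v2 * (j%:~R - 1)))))
   + - 2 * ((c - (v1 * i%:~R + v2 * (j%:~R + 1)) + 1) *
      (4 * M + 1 - (c - (v1 * i%:~R + v2 * (j%:~R + 1)))))
   + - 2 * ((c - (v1 * (i%:~R - 1) + v2 * j%:~R) + 1) *
      (4 * M + 1 - (c - (v1 * (i%:~R - 1) + v2 * j%:~R))))
   + - 2 * ((c - (v1 * (i%:~R + 1) + v2 * j%:~R) + 1) *
      (4 * M + 1 - (c - (v1 * (i%:~R + 1) + v2 * j%:~R))))
   - 4 * (- 2 * ((c - (v1 * i%:~R + v2 * j%:~R) + 1) *
      (4 * M + 1 - (c - (v1 * i%:~R + v2 * j%:~R)))))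
   = 4 * (v1 ^+ 2 + v2 ^+ 2) :> R by ring.
  rewrite vv mulr1 in E; move: E.
  by move: (- 2 * _) (- 2 * _) (- 2 * _) (- 2 * _) (- 2 * _); goal_lra.
have [t0 t1] := tC _ _ Cx.
have t2 : t x1%:~R x2%:~R <= `|x1%:~R - y1| + `|x2%:~R - y2| + 1.
  have := lin (y1 - x1%:~R) (y2 - x2%:~R).
  rewrite (distrC y1) (distrC y2) => /ler_normlP [_].
  by rewrite /t; move: hy; rewrite pt0 pt1; clear; lra.
apply: le_trans (_ : - b x1%:~R x2%:~R <= _); first by rewrite lerN2.
rewrite /b; move: (t _ _) (`|_| + `|_|) t0 t1 t2 M1 => T d; clear => T0 T1 Td M1.
have h : 0 <= (10 * M - 2 * (4 * M + 1 - T)) * (T + 1) by apply: mulr_ge0; lra.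
have h2 : 0 <= M * (d + 1 - T) by apply: mulr_ge0; lra.
by lra.
Qed.

End Barriers.

(** * Comparison principles on the lattice *)

Section Least.
Variable R : realType.
Implicit Types (g f w : int -> int -> int) (W : R -> R -> Prop).

Definition least_obstacle W g := in_obstacle_class W g /\
  forall v, in_obstacle_class W v -> forall i j, g i j <= v i j.

(** The comparison principle shared by recurrent functions and by the least
    function of the obstacle problem. *)
Definition has_comparison f (X : int -> int -> Prop) :=
  forall (Y : seq (int * int)) w,
    (forall i j, (i, j) \in Y -> X i j /\ lapz w i j <= 2) ->
    (forall i j, (i, j) \notin Y -> f i j <= w i j) ->
    forall i j, f i j <= w i j.

Lemma least_le0 W g : least_obstacle W g -> forall i j, g i j <= 0.
Proof.
by case=> _ H i j; apply: (H (fun _ _ => 0)); split.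
Qed.

Lemma least_eq0 W g i j : least_obstacle W g -> ~ W i%:~R j%:~R -> g i j = 0.
Proof.
move=> lg nW; apply/le_anti; rewrite (least_le0 lg) /=.
by case: lg => -[_ H] _; exact: H.
Qed.

(** Where the Laplacian is at most -2, the function can be lowered by 1. *)
Lemma least_lap_ge W g i j : least_obstacle W g -> W i%:~R j%:~R -> -1 <= lapz g i j.
Proof.
move=> [[gle gge] gmin] Wij; rewrite leNgt; apply/negP => lt.
pose v a b := if (a == i) && (b == j) then g i j - 1 else g a b.
have vg a b : v a b <= g a b.
  by rewrite /v; case: ifP => // /andP[/eqP -> /eqP ->]; lia.
suff ov : in_obstacle_class W v.
  by have := gmin v ov i j; rewrite /v !eqxx /=; lia.
split => a b; last first.
  move=> nW; rewrite /v; case: ifP => [/andP[/eqP ha /eqP hb]|_]; last exact: gge.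
  by case: nW; rewrite ha hb.
move=> Wab; have [/andP[/eqP ha /eqP hb]|ne] := boolP ((a == i) && (b == j)).
  have h1 := vg (i + 1) j; have h2 := vg (i - 1) j.
  have h3 := vg i (j + 1); have h4 := vg i (j - 1).
  have h5 : v i j = g i j - 1 by rewrite /v !eqxx.
  by move: lt; rewrite ha hb /lapz h5; lia.
have h1 := vg (a + 1) b; have h2 := vg (a - 1) b.
have h3 := vg a (b + 1); have h4 := vg a (b - 1).
have h5 : v a b = g a b by rewrite /v (negbTE ne).
by have := gle a b Wab; rewrite /lapz h5; lia.
Qed.

(** The minimum with w is a competitor in the obstacle problem. *)
Lemma least_comparison W g : least_obstacle W g -> has_comparison g (fun i j => W i%:~R j%:~R).
Proof.
move=> [[gle gge] gmin] Y w HY out i j.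
pose v a b := Num.min (g a b) (w a b).
have vg a b : v a b <= g a b by rewrite ge_min lexx.
have vw a b : v a b <= w a b by rewrite ge_min lexx orbT.
suff ov : in_obstacle_class W v by exact: le_trans (gmin v ov i j) (vw i j).
split => a b Wab.
  have h1 := vg (a + 1) b; have h2 := vg (a - 1) b.
  have h3 := vg a (b + 1); have h4 := vg a (b - 1).
  have k1 := vw (a + 1) b; have k2 := vw (a - 1) b.
  have k3 := vw a (b + 1); have k4 := vw a (b - 1).
  have [gw|wg] := leP (g a b) (w a b).
    have h5 : v a b = g a b by rewrite /v min_l.
    by have := gle a b Wab; rewrite /lapz h5; lia.
  have inY : (a, b) \in Y.
    by apply/negPn/negP => /out; rewrite leNgt wg.
  have [_ lw] := HY a b inY.
  have h5 : v a b = w a b by rewrite /v min_r // ltW.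
  by move: lw; rewrite /lapz h5; lia.
have nY : (a, b) \notin Y by apply/negP => /HY [].
by rewrite /v min_l ?out // gge.
Qed.

Lemma recurrent_comparison (r : lattice -> int) (X : set lattice) : recurrent R r X ->
  has_comparison (fun i j => r (zpt i j)) (fun i j => X (zpt i j)).
Proof.
move=> [_ H] Y w HY out.
pose w' (x : lattice) := w (x 0 0) (x 0 1).
pose Y' : set lattice := [set x | (x 0 0, x 0 1) \in Y].
have YX : Y' `<=` X by move=> x /HY []; rewrite -zptE.
have fY : finite_set Y'.
  have /sub_finite_set : Y' `<=` (fun p : int * int => zpt p.1 p.2) @` [set` Y].
    by move=> x xY; exists (x 0 0, x 0 1) => //=; rewrite -zptE.
  by apply; apply: finite_image; exact: finite_seq.
have lw x : Y' x -> laplacian w' x <= 2.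
  move=> /HY [_] h; rewrite [X in laplacian _ X](zptE x) laplacian_zpt.
  by move: h; rewrite /lapz /w' !zpt0 !zpt1.
have off x : ~ Y' x -> r x <= w' x.
  move=> /negP nY; have := out _ _ nY; by rewrite -zptE.
have := H Y' w' YX fY lw.
have : (sup_diff R r w' (~` Y') <= 0)%E.
  apply: ge_ereal_sup => _ [x nY <-]; rewrite lee_fin lerz0 subr_le0.
  exact: off.
move=> h1 h2 i j.
have [inY|nY] := boolP ((i, j) \in Y); last exact: out.
have : (((r (zpt i j) - w' (zpt i j))%:~R : R)%:E <= sup_diff R r w' Y')%E.
  by apply: ereal_sup_ubound; exists (zpt i j) => //; rewrite /Y' /= zpt0 zpt1.
move=> /le_trans /(_ (le_trans h2 h1)).
by rewrite lee_fin lerz0 subr_le0 /w' zpt0 zpt1.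
Qed.

Lemma comparison_sub f (X X' : int -> int -> Prop) :
  (forall i j, X' i j -> X i j) -> has_comparison f X -> has_comparison f X'.
Proof. by move=> sub H Y w HY; apply: H => i j /HY [/sub]. Qed.

Definition sqn (z1 z2 : int) : R := z1%:~R ^+ 2 + z2%:~R ^+ 2.

(** Near k, the translate of g shifted by an integer linear function and by an
    integer constant is a competitor in the comparison principle of f; farther
    away it is replaced by f itself. *)
Lemma translation_contact f g (k1 k2 l1 l2 q1 q2 : int) (rho : R) : 1 < rho ->
  has_comparison f (fun i j => sqn (i - k1) (j - k2) < rho ^+ 2) ->
  (forall z1 z2, sqn z1 z2 < rho ^+ 2 -> lapz g (l1 + z1) (l2 + z2) <= 2) ->
  (forall z1 z2, (rho - 1) ^+ 2 <= sqn z1 z2 -> sqn z1 z2 < rho ^+ 2 ->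
     f (k1 + z1) (k2 + z2) - g (l1 + z1) (l2 + z2) - (q1 * z1 + q2 * z2)
     <= f k1 k2 - g l1 l2 - 1) -> False.
Proof.
move=> rho1 mp lg bd.
pose c0 := f k1 k2 - g l1 l2 - 1.
pose w i j : int := if sqn (i - k1) (j - k2) < rho ^+ 2
  then g (l1 + (i - k1)) (l2 + (j - k2)) + (q1 * (i - k1) + q2 * (j - k2)) + c0
  else f i j.
pose N := Num.truncn rho.
pose Y := [seq (k1 + z.1, k2 + z.2) | z <- zbox N & sqn z.1 z.2 < (rho - 1) ^+ 2].
have rho0 : 0 < rho by lra.
have mono : (rho - 1) ^+ 2 < rho ^+ 2 by rewrite !expr2; nra.
have zb z1 z2 : sqn z1 z2 < rho ^+ 2 -> `|z1%:~R| < rho /\ `|z2%:~R| < rho.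
  rewrite /sqn => h; have := sqr_ge0 (z1%:~R : R); have := sqr_ge0 (z2%:~R : R) => p1 p2.
  by split; rewrite -(@ltr_pXn2r _ 2) ?nnegrE // ?real_normK ?num_real ?ltW //; lra.
have YP i j : ((i, j) \in Y) = (sqn (i - k1) (j - k2) < (rho - 1) ^+ 2).
  apply/mapP/idP => [[[z1 z2]]|h].
    rewrite mem_filter /= => /andP[h _] [-> ->].
    by rewrite ![_ + _ - _]addrAC !subrr !add0r.
  exists (i - k1, j - k2); last by rewrite /= !subrKC.
  rewrite mem_filter /= h mem_zbox /=.
  have [h1 h2] := zb _ _ (lt_trans h mono).
  by rewrite !(@int_le_norm R) // ltW.
have shift z1 z2 (e1 e2 : int) : sqn z1 z2 < (rho - 1) ^+ 2 ->
    (e1%:~R ^+ 2 + e2%:~R ^+ 2 = 1 :> R) -> sqn (z1 + e1) (z2 + e2) < rho ^+ 2.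
  move=> h e; rewrite /sqn !intrD.
  pose d := Num.sqrt (sqn z1 z2).
  have s0 : 0 <= sqn z1 z2 by rewrite addr_ge0 // sqr_ge0.
  have cs : (e1%:~R * z1%:~R + e2%:~R * z2%:~R : R) <= d.
    apply: le_trans (ler_norm _) _.
    rewrite -(@ler_pXn2r _ 2) ?nnegrE ?sqrtr_ge0 // real_normK ?num_real //.
    rewrite sqr_sqrtr // /sqn.
    have := sqr_ge0 (e1%:~R * z2%:~R - e2%:~R * z1%:~R : R).
    move: e; rewrite !expr2; move: (e1%:~R) (e2%:~R) (z1%:~R) (z2%:~R).
    clear => a b u v ab; have : (u * u + v * v) * (a * a + b * b) =
      (u * u + v * v) by rewrite ab mulr1.
    by lra.
  have d1 : d < rho - 1.
    by rewrite -(@ltr_pXn2r _ 2) ?nnegrE ?sqrtr_ge0 ?subr_ge0 // ?ltW // sqr_sqrtr.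
  have d2 : d ^+ 2 = z1%:~R ^+ 2 + z2%:~R ^+ 2 by rewrite sqr_sqrtr.
  have -> : (z1%:~R + e1%:~R) ^+ 2 + (z2%:~R + e2%:~R) ^+ 2 =
    (z1%:~R ^+ 2 + z2%:~R ^+ 2) + (e1%:~R ^+ 2 + e2%:~R ^+ 2)
      + 2 * (e1%:~R * z1%:~R + e2%:~R * z2%:~R) :> R by ring.
  rewrite -d2 e.
  have d0 : 0 <= d by exact: sqrtr_ge0.
  apply: le_lt_trans (_ : (d + 1) ^+ 2 < _).
    by move: cs; rewrite !expr2; clear; lra.
  by rewrite ltr_pXn2r ?nnegrE //; move: d0 d1 rho0; clear; lra.
have fw : f k1 k2 <= w k1 k2.
  apply: (mp Y w) => i j; rewrite YP.
    move=> h; split; first exact: lt_trans h mono.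
    have hz := lt_trans h mono.
    have sh a b (e1 e2 : int) : a - k1 = (i - k1) + e1 -> b - k2 = (j - k2) + e2 ->
        (e1%:~R ^+ 2 + e2%:~R ^+ 2 = 1 :> R) ->
        w a b = g (l1 + (a - k1)) (l2 + (b - k2)) + (q1 * (a - k1) + q2 * (b - k2)) + c0.
      by move=> ha hb e; rewrite /w ifT // ha hb; exact: shift.
    have sq1 : (1%:~R : R) ^+ 2 + 0%:~R ^+ 2 = 1 by rewrite mulr0z mulr1z expr1n expr0n addr0.
    have sq2 : ((-1)%:~R : R) ^+ 2 + 0%:~R ^+ 2 = 1 by rewrite mulrNz sqrrN.
    have sq3 : (0%:~R : R) ^+ 2 + 1%:~R ^+ 2 = 1 by rewrite addrC.
    have sq4 : (0%:~R : R) ^+ 2 + (-1)%:~R ^+ 2 = 1 by rewrite addrC.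
    rewrite /lapz (sh (i + 1) j 1 0) //; try ring.
    rewrite (sh (i - 1) j (-1) 0) //; try ring.
    rewrite (sh i (j + 1) 0 1) //; try ring.
    rewrite (sh i (j - 1) 0 (-1)) //; try ring.
    have -> : w i j = g (l1 + (i - k1)) (l2 + (j - k2)) + (q1 * (i - k1) + q2 * (j - k2)) + c0.
      by rewrite /w ifT.
    have := lg _ _ hz; rewrite /lapz.
    have -> : l1 + (i + 1 - k1) = l1 + (i - k1) + 1 by ring.
    have -> : l1 + (i - 1 - k1) = l1 + (i - k1) - 1 by ring.
    have -> : l2 + (j + 1 - k2) = l2 + (j - k2) + 1 by ring.
    have -> : l2 + (j - 1 - k2) = l2 + (j - k2) - 1 by ring.
    move: (g _ _) (g _ _) (g _ _) (g _ _) (g _ _) => g1 g2 g3 g4 g5; clear.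
    by lra.
  rewrite -leNgt => h; rewrite /w; case: ifP => // lt.
  have := bd _ _ h lt; rewrite !subrKC /c0; move: (f i j) (g _ _) (f _ _) (g _ _).
  by clear => *; lra.
move: fw; rewrite /w !subrr /sqn mulr0z expr0n /= addr0 exprn_gt0 //.
by rewrite !mulr0 !addr0 /c0; move: (f _ _) (g _ _); clear => *; lia.
Qed.

End Least.

(** * Doubling of variables *)

Section Contact.
Variable R : realType.
Implicit Types (F : R -> R -> R) (g : int -> int -> int).

Definition penalty (a x1 x2 y1 y2 : R) : R :=
  (2 * a)^-1 * ((x1 - y1) ^+ 2 + (x2 - y2) ^+ 2).

Definition doubled F g (a de : R) (p : int * int) (x1 x2 : R) (y1 y2 : int) : R :=
  F x1 x2 - (g y1 y2)%:~R - penalty a x1 x2 y1%:~R y2%:~R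
  + de / 2 * sqn R y1 y2 - (p.1%:~R * y1%:~R + p.2%:~R * y2%:~R).

Definition contact F g (a de : R) (N : nat) (p : int * int) (x1 x2 : R) (y1 y2 : int) :=
  [/\ `|x1| <= N%:R, `|x2| <= N%:R, (y1, y2) \in zbox N &
   forall u1 u2 w1 w2, `|u1| <= N%:R -> `|u2| <= N%:R -> (w1, w2) \in zbox N ->
     doubled F g a de p u1 u2 w1 w2 <= doubled F g a de p x1 x2 y1 y2].

Lemma contact_exists F g a de N p : cont2 F ->
  exists x : (R * R) * (int * int), contact F g a de N p x.1.1 x.1.2 x.2.1 x.2.2.
Proof.
move=> cF.
have ex y : exists x : R * R, [/\ `|x.1| <= N%:R, `|x.2| <= N%:R &
   forall u1 u2, `|u1| <= N%:R -> `|u2| <= N%:R ->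
     doubled F g a de p u1 u2 y.1 y.2 <= doubled F g a de p x.1 x.2 y.1 y.2].
  pose e := parab a ((g y.1 y.2)%:~R - de / 2 * sqn R y.1 y.2
    + (p.1%:~R * y.1%:~R + p.2%:~R * y.2%:~R)) y.1%:~R y.2%:~R.
  have PE u1 u2 : doubled F g a de p u1 u2 y.1 y.2 = F u1 u2 - ev e u1 u2.
    by rewrite /e ev_parab /doubled /penalty; ring.
  have ce : continuous (fun z => onplane F z - evp e z).
    by apply: (cont2B cF); apply: cont2_ev.
  have cb : compact (@box R N%:R).
    apply: (@subbox_compact _ _ N%:R) => //.
    by rewrite closure_id; apply/seteqP; split;
      [exact: subset_closure|exact: box_closure].
  have nb : @box R N%:R !=set0 by exists 0; split; rewrite mxE normr0 ler0n.
  have [z /set_mem [z1 z2] zm] := EVT_max_rV nb cb (continuous_subspaceT ce).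
  exists (z 0 0, z 0 1); split => // u1 u2 h1 h2; rewrite !PE.
  have := zm (pt u1 u2); rewrite inE /onplane /evp /box /= !pt0 !pt1; exact.
have [x hx] := choice ex.
have z0 : (0, 0) \in zbox N by rewrite mem_zbox normr0.
have [y yN ym] := seq_argmax (fun y => doubled F g a de p (x y).1 (x y).2 y.1 y.2) z0.
have [h1 h2 h3] := hx y.
exists (x y, y); split => //=; first by rewrite -surjective_pairing.
move=> u1 u2 w1 w2 b1 b2 wN; have [_ _ h] := hx (w1, w2).
exact: le_trans (h _ _ b1 b2) (ym _ wN).
Qed.

(** Optimality of y among its four neighbours. *)
Lemma contact_slope F g a de N p (x1 x2 : R) (y1 y2 : int) : 0 < a ->
  contact F g a de N p x1 x2 y1 y2 ->
  `|y1| + 1 <= N%:Z -> `|y2| + 1 <= N%:Z ->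
  [/\ (g y1 y2)%:~R - (g (y1 + 1) y2)%:~R + (x1 - y1%:~R) / a - 2^-1 / a + de * y1%:~R + de / 2
        <= p.1%:~R,
      p.1%:~R <= (g (y1 - 1) y2)%:~R - (g y1 y2)%:~R + (x1 - y1%:~R) / a + 2^-1 / a
        + de * y1%:~R - de / 2,
      (g y1 y2)%:~R - (g y1 (y2 + 1))%:~R + (x2 - y2%:~R) / a - 2^-1 / a + de * y2%:~R + de / 2
        <= p.2%:~R &
      p.2%:~R <= (g y1 (y2 - 1))%:~R - (g y1 y2)%:~R + (x2 - y2%:~R) / a + 2^-1 / a
        + de * y2%:~R - de / 2].
Proof.
move=> a0 [b1 b2 yN mx] N1 N2.
have m1 := mx x1 x2 (y1 + 1) y2 b1 b2 ltac:(rewrite mem_zbox; lia).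
have m2 := mx x1 x2 (y1 - 1) y2 b1 b2 ltac:(rewrite mem_zbox; lia).
have m3 := mx x1 x2 y1 (y2 + 1) b1 b2 ltac:(rewrite mem_zbox; lia).
have m4 := mx x1 x2 y1 (y2 - 1) b1 b2 ltac:(rewrite mem_zbox; lia).
move: m1 m2 m3 m4; rewrite /doubled /penalty /sqn invfM !(intrD, mulrNz, mulr1z).
move: a^-1 (F x1 x2) (g _ _)%:~R (g _ _)%:~R (g _ _)%:~R (g _ _)%:~R (g _ _)%:~R.
move: (y1%:~R) (y2%:~R) (p.1%:~R) (p.2%:~R).
move=> Y1 Y2 P1 P2 ia Fx gE g0 gW gN gS; clear => h1 h2 h3 h4.
by split; lra.
Qed.

End Contact.

(** * Counting *)

Section Counting.

Lemma fiber_size (S T : eqType) (phi : S -> T) c (B : seq T) (A : seq S) :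
  (forall a, a \in A -> phi a \in B) ->
  (forall b, (size [seq a <- A | phi a == b] <= c)%N) -> (size A <= c * size B)%N.
Proof.
elim: B A => [|b B IH] A hB hc.
  by case: A hB {hc} => // a A /(_ a (mem_head _ _)).
rewrite /= mulnS -(count_predC (fun a => phi a == b) A) leq_add //.
  by rewrite -size_filter.
rewrite -size_filter; apply: IH => [a|b'].
  rewrite mem_filter /= => /andP[ne /hB]; rewrite inE => /predU1P[e|//].
  by rewrite e eqxx in ne.
rewrite -filter_predI; apply: leq_trans (hc b').
by rewrite !size_filter sub_count // => a /= /andP[].
Qed.

Lemma diam_size (A : seq (int * int)) (l : nat) : uniq A ->
  (forall p q, p \in A -> q \in A -> `|p.1 - q.1| <= l%:Z /\ `|p.2 - q.2| <= l%:Z) ->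
  (size A <= (2 * l).+1 ^ 2)%N.
Proof.
case: A => [//|q A] uA dA; rewrite -(size_zbox l).
rewrite -(size_map (fun z => (q.1 + z.1, q.2 + z.2)) (zbox l)).
apply: uniq_leq_size => // p pA; have [h1 h2] := dA p q pA (mem_head _ _).
apply/mapP; exists (p.1 - q.1, p.2 - q.2); first by rewrite mem_zbox h1.
by rewrite /= !subrKC -surjective_pairing.
Qed.

End Counting.

Lemma sq_le_half (R : realType) (v : R) : `|v| <= 2^-1 -> v ^+ 2 <= 2^-1.
Proof.
move=> h; rewrite -[v ^+ 2]real_normK ?num_real // expr2.
have := normr_ge0 v; move: `|v| h => u h0 h1.
have : 0 <= (2^-1 - u) * u by apply: mulr_ge0 => //; rewrite subr_ge0.
by lra.
Qed.

Lemma quarter_sq (R : realType) (r : R) : 2 <= r -> r ^+ 2 / 4 <= (r - 1) ^+ 2.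
Proof.
move=> h; have : 0 <= (r - 2) * (3 * r - 2) by apply: mulr_ge0; lra.
by rewrite !expr2; lra.
Qed.

Lemma contact_arith (R : realType) (X ia rho dz KX rz gz rk gy Fz Fk Fx px pk A B
    P1 P2 q1 q2 : R) :
  Fz - gz - pk + A + dz - (P1 + P2) - B <= Fx - gy - px + A - B ->
  Fx - px + pk - Fk <= 8400 / ia ->
  rz - Fz <= KX -> Fk - rk <= KX ->
  8402 * X + 2 * KX <= dz -> P1 - q1 + (P2 - q2) <= rho ->
  ia^-1 <= X -> rho <= X -> 1 <= X ->
  rz - gz - (q1 + q2) <= rk - gy - 1.
Proof. by move: ia^-1 => ia'; lra. Qed.

(** * The comparison estimate *)

(** What is needed of F and g, in a form satisfied both by (U, u_n) and by
    (- U, - u_n). The recurrent function enters only through the last field: at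
    points outside [bad] some integer function rr approximates F and
    rr(k + z) - g(l + z) obeys the conclusion of [translation_contact]. *)
Record doubling_setup (R : realType) (C D K n s : R) (W : R -> R -> Prop)
    (F : R -> R -> R) (g : int -> int -> int) (bad : seq (int * int)) : Prop := {
  setup_C : 1 <= C;
  setup_D : 1 <= D;
  setup_K : 1 <= K;
  setup_n : 1 <= n;
  setup_s0 : 0 < s;
  setup_s1 : s <= 1;
  setup_ns : 1 <= n * s ^+ 16;
  setup_W : forall x y, W x y -> `|x| <= D * n /\ `|y| <= D * n;
  setup_cont : cont2 F;
  setup_visc : visc_lap_ge F W;
  setup_viscN : visc_lap_ge (fun x y => - F x y) W;
  setup_F0 : forall x y, ~ W x y -> F x y = 0;
  setup_g0 : forall i j : int, ~ W i%:~R j%:~R -> g i j = 0;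
  setup_lap : forall i j : int, W i%:~R j%:~R -> lapz g i j <= 2;
  setup_F : forall x1 x2 y1 y2, W x1 x2 -> ~ W y1 y2 ->
    F x1 x2 <= C * n * (`|x1 - y1| + `|x2 - y2| + 1);
  setup_g : forall (x1 x2 : int) (y1 y2 : R), W x1%:~R x2%:~R -> ~ W y1 y2 ->
    - (g x1 x2)%:~R <= C * n * (`|x1%:~R - y1| + `|x2%:~R - y2| + 1);
  setup_good : 4 <= n -> forall k1 k2 : int, W k1%:~R k2%:~R -> (k1, k2) \notin bad ->
    forall l1 l2 : int,
    (forall z1 z2, sqn R z1 z2 < (n * s ^+ 8) ^+ 2 -> W (l1 + z1)%:~R (l2 + z2)%:~R) ->
    exists rr : int -> int -> int,
      (forall z1 z2, sqn R z1 z2 < (n * s ^+ 8) ^+ 2 ->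
         `|(rr (k1 + z1) (k2 + z2))%:~R - F (k1 + z1)%:~R (k2 + z2)%:~R|
           <= K * (n ^+ 2 * s ^+ 24)) /\
      forall q1 q2 : int, ~ (forall z1 z2 : int, (n * s ^+ 8 - 1) ^+ 2 <= sqn R z1 z2 ->
        sqn R z1 z2 < (n * s ^+ 8) ^+ 2 ->
        rr (k1 + z1) (k2 + z2) - g (l1 + z1) (l2 + z2) - (q1 * z1 + q2 * z2)
          <= rr k1 k2 - g l1 l2 - 1)
}.

Section Core.
Variable R : realType.
Variables (C D K n s : R) (W : R -> R -> Prop) (F : R -> R -> R)
  (g : int -> int -> int) (bad : seq (int * int)).
Hypothesis setup : doubling_setup C D K n s W F g bad.

Let C1 := setup_C setup.
Let D1 := setup_D setup.
Let K1 := setup_K setup.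
Let n1 := setup_n setup.
Let s0 := setup_s0 setup.
Let s1 := setup_s1 setup.
Let ns16 := setup_ns setup.
Let WD := setup_W setup.
Let cF := setup_cont setup.
Let vF := setup_visc setup.
Let vNF := setup_viscN setup.
Let F0 := setup_F0 setup.
Let g0 := setup_g0 setup.
Let glap := setup_lap setup.
Let FC := setup_F setup.
Let gC := setup_g setup.

Let E : R := 4 * C * (3 * D + 2) + 1.
Let n0 : 0 < n. Proof. exact: lt_le_trans ltr01 n1. Qed.
Let ns0 : 0 < n * s. Proof. exact: mulr_gt0. Qed.

Let spow k : s ^+ k.+1 <= s.
Proof.
have h := ltW s0; rewrite exprS -[leRHS]mulr1.
by apply: ler_wpM2l => //; exact: exprn_ile1.
Qed.

Let ns1 : 1 <= n * s.
Proof. by apply: le_trans ns16 _; rewrite ler_wpM2l ?spow // ltW. Qed.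

Let norm_le (x : R) : x <= `|x| /\ - x <= `|x|.
Proof. by split; [exact: ler_norm|rewrite -normrN; exact: ler_norm]. Qed.

Lemma far_outside : ~ W (D * n + 1) 0.
Proof.
move=> /WD [h _]; have [h' _] := norm_le (D * n + 1).
by move: h'; move: h; lra.
Qed.

Lemma F_le x y : F x y <= C * (3 * D + 2) * n ^+ 2.
Proof.
have p : 0 <= C * (3 * D + 2) * n ^+ 2.
  by rewrite mulr_ge0 ?sqr_ge0 // mulr_ge0; move: C1 D1; lra.
have [Wxy|nW] := pselect (W x y); last by rewrite F0.
apply: le_trans (FC Wxy far_outside) _; rewrite expr2.
have -> : C * (3 * D + 2) * (n * n) = C * n * ((3 * D + 2) * n) by ring.
have [h1 h2] := WD Wxy.
apply: ler_wpM2l; first by rewrite mulr_ge0 // ?ltW //; move: C1; lra.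
have := ler_normB x (D * n + 1); rewrite subr0 (@ger0_norm _ (D * n + 1)); last first.
  by rewrite addr_ge0 // mulr_ge0 //; move: D1 n1; lra.
by move: h1 h2; move: n1; lra.
Qed.

Lemma oppg_le i j : - (g i j)%:~R <= C * (3 * D + 2) * n ^+ 2.
Proof.
have p : 0 <= C * (3 * D + 2) * n ^+ 2.
  by rewrite mulr_ge0 ?sqr_ge0 // mulr_ge0; move: C1 D1; lra.
have [Wxy|nW] := pselect (W i%:~R j%:~R); last by rewrite g0 // oppr0.
apply: le_trans (gC Wxy far_outside) _; rewrite expr2.
have -> : C * (3 * D + 2) * (n * n) = C * n * ((3 * D + 2) * n) by ring.
have [h1 h2] := WD Wxy.
apply: ler_wpM2l; first by rewrite mulr_ge0 // ?ltW //; move: C1; lra.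
have := ler_normB (i%:~R : R) (D * n + 1); rewrite subr0 (@ger0_norm _ (D * n + 1)); last first.
  by rewrite addr_ge0 // mulr_ge0 //; move: D1 n1; lra.
by move: h1 h2; move: n1; lra.
Qed.

Variables (a de m : R) (N Q : nat).
Hypotheses (aE : a = s ^+ 2) (deE : de = 8 * (8402 + 2 * K) * s ^+ 8).
Hypotheses (N1 : D * n + 1 <= N%:R).
(* m is the assumed size of F - g: the first two conditions make the tilt terms
   small compared with it, the third makes boundary effects small. *)
Hypotheses (m1 : de * N%:R ^+ 2 <= m / 4) (m2 : 4 * Q%:R * N%:R <= m / 4)
  (m3 : 2 * C * (130 + 2 * E) * (n ^+ 2 * s) < m).

Let a0 : 0 < a. Proof. by rewrite aE exprn_gt0. Qed.
Let a1 : a <= 1. Proof. by rewrite aE expr_le1 // ltW. Qed.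
Let de0 : 0 <= de.
Proof.
rewrite deE; apply: mulr_ge0; last exact: exprn_ge0 (ltW s0).
by move: K1; lra.
Qed.
Let an : a != 0. Proof. by rewrite gt_eqF. Qed.

Lemma W_zbox (i j : int) : W i%:~R j%:~R ->
  [/\ `|i| + 1 <= N%:Z, `|j| + 1 <= N%:Z & (i, j) \in zbox N].
Proof.
move=> /WD [h1 h2].
have H (k : int) : `|k%:~R| <= D * n -> `|k| + 1 <= N%:Z.
  move=> h; rewrite -(@ler_int R) intrD intr_norm mulr1z.
  by move: N1 h; rewrite -[N%:R]/(N%:Z%:~R); intros; lra.
have := H _ h1; have := H _ h2; rewrite mem_zbox => k1 k2; split => //.
by apply/andP; split; [apply: le_trans k2|apply: le_trans k1]; rewrite lerDl.
Qed.

Lemma W_box x y : W x y -> `|x| <= N%:R /\ `|y| <= N%:R.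
Proof. by move=> /WD [h1 h2]; move: N1; move: h1 h2; lra. Qed.

Section OneContact.
Variables (k : int * int) (p : int * int) (x1 x2 : R) (y1 y2 : int).
Hypothesis kN : k \in zbox N.
Hypothesis km : m <= F k.1%:~R k.2%:~R - (g k.1 k.2)%:~R.
Hypotheses (p1 : `|p.1| <= Q%:Z) (p2 : `|p.2| <= Q%:Z).
Hypothesis ct : contact F g a de N p x1 x2 y1 y2.

Let zb (z : int * int) : z \in zbox N -> `|z.1%:~R| <= N%:R :> R /\ `|z.2%:~R| <= N%:R :> R.
Proof.
case: z => z1 z2; rewrite mem_zbox => /andP[h1 h2].
by rewrite -!intr_norm -[N%:R]/(N%:Z%:~R) !ler_int.
Qed.

Lemma contact_low : m / 2 <= F x1 x2 - (g y1 y2)%:~R - penalty a x1 x2 y1%:~R y2%:~R.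
Proof.
case: ct => b1 b2 yN mx; have [k1 k2] := zb kN; have [/= l1 l2] := zb yN.
have kN' : (k.1, k.2) \in zbox N by rewrite -surjective_pairing.
have := mx _ _ k.1 k.2 k1 k2 kN'.
rewrite /doubled {1}/penalty !subrr expr0n /= addr0 mulr0 subr0.
have sq (v : R) : `|v| <= N%:R -> v ^+ 2 <= N%:R ^+ 2.
  by move=> h; rewrite -[v ^+ 2]real_normK ?num_real // ler_pXn2r ?nnegrE.
have yq : de / 2 * sqn R y1 y2 <= de * N%:R ^+ 2.
  have -> : de * N%:R ^+ 2 = de / 2 * (2 * N%:R ^+ 2) by field.
  apply: ler_wpM2l; first by rewrite divr_ge0.
  by have := sq _ l1; have := sq _ l2; rewrite /sqn; intros; lra.
have kq : 0 <= de / 2 * sqn R k.1 k.2.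
  by rewrite mulr_ge0 ?divr_ge0 // addr_ge0 // sqr_ge0.
have bp (c : int) (v : R) : `|c| <= Q%:Z -> `|v| <= N%:R -> `|c%:~R * v| <= Q%:R * N%:R.
  move=> hc hv; rewrite normrM ler_pM // -intr_norm.
  by rewrite -[Q%:R]/(Q%:Z%:~R) ler_int.
have [_ A1] := norm_le (p.1%:~R * k.1%:~R); have [_ A2] := norm_le (p.2%:~R * k.2%:~R).
have [_ A3] := norm_le (p.1%:~R * y1%:~R); have [_ A4] := norm_le (p.2%:~R * y2%:~R).
have [A1' _] := norm_le (p.1%:~R * k.1%:~R); have [A2' _] := norm_le (p.2%:~R * k.2%:~R).
have B1 := bp _ _ p1 k1; have B2 := bp _ _ p2 k2.
have B3 := bp _ _ p1 l1; have B4 := bp _ _ p2 l2.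
have Q4 : 4 * Q%:R * N%:R = 4 * (Q%:R * N%:R) :> R by rewrite mulrA.
move: m2; rewrite Q4; move: (Q%:R * N%:R) B1 B2 B3 B4 A3 A4 A1' A2' yq kq m1 km.
move: (p.1%:~R * _) (p.2%:~R * _) (p.1%:~R * _) (p.2%:~R * _) (de * _) (de / 2 * _) (de / 2 * _).
move=> u1 u2 u3 u4 v1 v2 v3 QN *; lra.
Qed.

Let pen0 : 0 <= penalty a x1 x2 y1%:~R y2%:~R.
Proof.
apply: mulr_ge0; last by rewrite addr_ge0 // sqr_ge0.
by rewrite invr_ge0 mulr_ge0 // ltW.
Qed.

Let m0 : 0 < m.
Proof.
apply: le_lt_trans m3; apply: mulr_ge0; last by rewrite mulr_ge0 ?sqr_ge0 // ltW.
apply: mulr_ge0; first by move: C1; lra.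
have : 0 <= C * (3 * D + 2) by rewrite mulr_ge0 //; move: C1 D1; lra.
by rewrite /E; intros; lra.
Qed.

(** F - g is at most of order n^2, so the penalty is too, and a = s^2. *)
Lemma contact_dist : `|x1 - y1%:~R| <= E * (n * s) /\ `|x2 - y2%:~R| <= E * (n * s).
Proof.
have E0 : 1 <= E.
  have : 0 <= C * (3 * D + 2) by rewrite mulr_ge0 //; move: C1 D1; lra.
  by rewrite /E; intros; lra.
apply: sq_ball_le; first by rewrite mulr_ge0 ?(ltW ns0) //; move: E0; lra.
have h := contact_low; have Fu := F_le x1 x2; have gl := oppg_le y1 y2.
have pl : penalty a x1 x2 y1%:~R y2%:~R <= 2 * C * (3 * D + 2) * n ^+ 2.
  have -> : 2 * C * (3 * D + 2) * n ^+ 2 = 2 * (C * (3 * D + 2) * n ^+ 2) by rewrite !mulrA.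
  by move: h m0 Fu gl; move: (penalty _ _ _ _ _) (C * (3 * D + 2) * n ^+ 2); intros; lra.
have aa : 0 < 2 * a by rewrite mulr_gt0.
have -> : (x1 - y1%:~R) ^+ 2 + (x2 - y2%:~R) ^+ 2 = (2 * a) * penalty a x1 x2 y1%:~R y2%:~R.
  by rewrite /penalty mulrA mulfV ?mul1r // gt_eqF.
apply: le_trans (ler_wpM2l (ltW aa) pl) _; rewrite aE.
have -> : 2 * s ^+ 2 * (2 * C * (3 * D + 2) * n ^+ 2) = (E - 1) * (n * s) ^+ 2.
  by rewrite /E; ring.
rewrite [leRHS]exprMn; apply: ler_wpM2r; first by rewrite sqr_ge0.
have : 0 <= E * (E - 1) by rewrite mulr_ge0; move: E0; lra.
by rewrite expr2; intros; lra.
Qed.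

(** Within distance of order n s of the boundary, F and - g are at most of order
    n^2 s, whereas their sum at a contact is at least m / 2. *)
Lemma contact_deep u v : ~ W u v ->
  64 * (n * s) < `|x1 - u| + `|x2 - v| /\
  64 * (n * s) < `|y1%:~R - u| + `|y2%:~R - v|.
Proof.
move=> nW; have h := contact_low; have [d1 d2] := contact_dist.
have Cn : 0 <= C * n by rewrite mulr_ge0 ?(ltW n0) //; move: C1; lra.
pose dx := `|x1 - u| + `|x2 - v|; pose dy := `|y1%:~R - u| + `|y2%:~R - v|.
have dx0 : 0 <= dx by rewrite addr_ge0.
have dy0 : 0 <= dy by rewrite addr_ge0.
have t1 : dx <= dy + 2 * (E * (n * s)).
  have := ler_normD (x1 - y1%:~R) (y1%:~R - u).
  have := ler_normD (x2 - y2%:~R) (y2%:~R - v).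
  by rewrite !addrA !subrK /dx /dy; move: d1 d2; lra.
have t2 : dy <= dx + 2 * (E * (n * s)).
  have := ler_normD (y1%:~R - x1) (x1 - u).
  have := ler_normD (y2%:~R - x2) (x2 - v).
  rewrite !addrA !subrK (distrC _ x1) (distrC _ x2) /dx /dy.
  by move: d1 d2; lra.
have hF : F x1 x2 <= C * n * (dx + 1).
  have [Wx|nWx] := pselect (W x1 x2); first by have := FC Wx nW.
  by rewrite F0 // mulr_ge0 // addr_ge0.
have hg : - (g y1 y2)%:~R <= C * n * (dy + 1).
  have [Wy|nWy] := pselect (W y1%:~R y2%:~R); first by have := gC Wy nW.
  by rewrite g0 // oppr0 mulr_ge0 // addr_ge0.
have tot : m / 2 <= C * n * (dx + dy + 2).
  have -> : C * n * (dx + dy + 2) = C * n * (dx + 1) + C * n * (dy + 1) by ring.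
  by move: h pen0 hF hg; lra.
have key : (130 + 2 * E) * (n * s) < dx + dy + 2.
  rewrite ltNge; apply/negP => le.
  have := le_trans tot (ler_wpM2l Cn le).
  have -> : C * n * ((130 + 2 * E) * (n * s)) =
    (2 * C * (130 + 2 * E) * (n ^+ 2 * s)) / 2 by field.
  by move: m3; lra.
rewrite -/dx -/dy; move: key t1 t2 ns1.
have -> : (130 + 2 * E) * (n * s) = 130 * (n * s) + 2 * (E * (n * s)) by ring.
by split; lra.
Qed.

Lemma deep_x u v : `|x1 - u| + `|x2 - v| <= 64 * (n * s) -> W u v.
Proof. by move=> h; apply: contrapT => /contact_deep [+ _]; rewrite ltNge h. Qed.

Lemma deep_y u v : `|y1%:~R - u| + `|y2%:~R - v| <= 64 * (n * s) -> W u v.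
Proof. by move=> h; apply: contrapT => /contact_deep [_]; rewrite ltNge h. Qed.

Lemma contact_W : W x1 x2 /\ W y1%:~R y2%:~R.
Proof.
by split; [apply: deep_x|apply: deep_y]; rewrite !subrr normr0 addr0 mulr_ge0 // ltW.
Qed.

Let c0 := F x1 x2 - penalty a x1 x2 y1%:~R y2%:~R.

Lemma contact_parab u v : `|u| <= N%:R -> `|v| <= N%:R ->
  F u v <= ev (parab a c0 y1%:~R y2%:~R) u v.
Proof.
move=> hu hv; case: ct => b1 b2 yN mx; have := mx u v y1 y2 hu hv yN.
by rewrite ev_parab /c0 /doubled -/(penalty a u v _ _); lra.
Qed.

Lemma contact_parab_eq : F x1 x2 = ev (parab a c0 y1%:~R y2%:~R) x1 x2.
Proof. by rewrite ev_parab /c0 -/(penalty a x1 x2 _ _) subrK. Qed.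

Lemma disc_W u v : (u - x1) ^+ 2 + (v - x2) ^+ 2 <= 256 ->
  [/\ W u v, `|u| <= N%:R & `|v| <= N%:R].
Proof.
move=> h; have [h1 h2] : `|u - x1| <= 16 /\ `|v - x2| <= 16.
  by apply: sq_ball_le => //; move: h; lra.
have Wuv : W u v.
  by apply: deep_x; rewrite (distrC x1) (distrC x2); move: h1 h2 ns1; lra.
by have [] := W_box Wuv.
Qed.

End OneContact.

Variables (k : int * int).
Hypothesis kN : k \in zbox N.
Hypothesis km : m <= F k.1%:~R k.2%:~R - (g k.1 k.2)%:~R.

Let admissible (p : int * int) := `|p.1| <= Q%:Z /\ `|p.2| <= Q%:Z.

Lemma y_fiber p p' x1 x2 x1' x2' y1 y2 y1' y2' : admissible p -> admissible p' ->
  contact F g a de N p x1 x2 y1 y2 -> contact F g a de N p' x1' x2' y1' y2' ->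
  `|x1' - x1| <= 1 -> `|x2' - x2| <= 1 ->
  `|y1' - y1| <= 200 /\ `|y2' - y2| <= 200.
Proof.
move=> [p1 p2] [p1' p2'] ct ct' h1 h2.
have := @centres_close R F W a (F x1 x2 - penalty a x1 x2 y1%:~R y2%:~R)
  (F x1' x2' - penalty a x1' x2' y1'%:~R y2'%:~R) x1 x2 x1' x2'
  y1%:~R y2%:~R y1'%:~R y2'%:~R cF vF a0 a1 h1 h2.
move=> /(_ _ (contact_parab_eq _ _ _ _) (contact_parab_eq _ _ _ _)) H.
have {H} : `|y1'%:~R - y1%:~R| + `|y2'%:~R - y2%:~R| <= 200 :> R.
  apply: H => u v huv; have [Wuv u1 u2] := disc_W kN km p1 p2 ct huv.
  by split => //; [apply: (contact_parab ct)|apply: (contact_parab ct')].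
have q1 : 0 <= `|y1'%:~R - y1%:~R| :> R by [].
have q2 : 0 <= `|y2'%:~R - y2%:~R| :> R by [].
move=> h; rewrite -!(@ler_int R) !intr_norm !intrB.
by rewrite [(200 : int)%:~R](_ : _ = 200) //; move: q1 q2 h; lra.
Qed.

(** In each direction the slopes with a given y fill an interval whose length is
    the second difference of g plus O(1/a). The sum of the two second
    differences is at most 2, and neither can be very negative since both
    intervals are nonempty. *)
Lemma slope_fiber p p' x1 x2 x1' x2' y1 y2 : admissible p -> admissible p' ->
  contact F g a de N p x1 x2 y1 y2 -> contact F g a de N p' x1' x2' y1 y2 ->
  `|x1' - x1| <= 1 -> `|x2' - x2| <= 1 ->
  `|(p'.1 - p.1)%:~R| <= 5 / a /\ `|(p'.2 - p.2)%:~R| <= 5 / a.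
Proof.
move=> [p1 p2] [p1' p2'] ct ct' h1 h2.
have [_ Wy] := contact_W kN km p1 p2 ct.
have [N1' N2' _] := W_zbox Wy.
have [A1 A2 A3 A4] := contact_slope a0 ct N1' N2'.
have [B1 B2 B3 B4] := contact_slope a0 ct' N1' N2'.
have := glap Wy; rewrite -(@ler_int R) lapzR => lap.
have ia : 1 <= a^-1 by rewrite invf_ge1.
have xa (u v w : R) : `|u - v| <= 1 -> `|(u - w) / a - (v - w) / a| <= a^-1.
  move=> h; have -> : (u - w) / a - (v - w) / a = (u - v) / a by ring.
  by rewrite normrM (gtr0_norm (_ : 0 < a^-1)) ?invr_gt0 // ler_piMl // invr_ge0 ltW.
have /ler_normlP [X1 X1'] := xa _ _ y1%:~R h1.
have /ler_normlP [X2 X2'] := xa _ _ y2%:~R h2.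
rewrite !intrB.
move: ((x1 - _) / a) ((x1' - _) / a) ((x2 - _) / a) ((x2' - _) / a)
  A1 A2 A3 A4 B1 B2 B3 B4 X1 X1' X2 X2' ia de0 lap.
move: a^-1 (p.1%:~R) (p.2%:~R) (p'.1%:~R) (p'.2%:~R) (de * y1%:~R) (de * y2%:~R).
move: (g _ _)%:~R (g _ _)%:~R (g _ _)%:~R (g _ _)%:~R (g _ _)%:~R.
move=> *; split; apply/ler_normlP; split; lra.
Qed.

Definition nearest (v : R) : int := Num.floor (v + 2^-1).

Lemma nearest_dist v : `|(nearest v)%:~R - v| <= 2^-1.
Proof.
have /andP[] := floor_itv (v + 2^-1); rewrite -/(nearest v) intrD mulr1z => h1 h2.
by apply/ler_normlP; split; lra.
Qed.

Hypothesis n4 : 4 <= n.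

(** At a good point the contact would be strict on the lattice ball of radius
    rho around it, against the comparison principle. *)
Lemma contact_bad p x1 x2 y1 y2 : admissible p -> contact F g a de N p x1 x2 y1 y2 ->
  (nearest x1, nearest x2) \in bad.
Proof.
move=> [p1 p2] ct; apply/negPn/negP => nbad.
set rho := n * s ^+ 8.
have rho2 : 2 <= rho.
  rewrite -(@ler_pXn2r _ 2) ?nnegrE ?mulr_ge0 ?exprn_ge0 ?(ltW n0) ?(ltW s0) //.
  have -> : rho ^+ 2 = n * (n * s ^+ 16) by rewrite /rho; ring.
  apply: le_trans (_ : n <= _); first by rewrite expr2; move: n4; lra.
  by rewrite ler_peMr // ltW.
have rho_ns : rho <= n * s by rewrite ler_wpM2l ?(ltW n0) ?spow.
have r1 := nearest_dist x1; have r2 := nearest_dist x2.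
set k1 := nearest x1 in r1 nbad *; set k2 := nearest x2 in r2 nbad *.
have zl z1 z2 : sqn R z1 z2 < rho ^+ 2 -> `|z1%:~R| <= rho /\ `|z2%:~R| <= rho.
  by move=> h; apply: sq_ball_le; [move: rho2; lra|exact: ltW].
have nearx (z1 z2 : int) : `|z1%:~R| <= rho -> `|z2%:~R| <= rho ->
    W (k1%:~R + z1%:~R) (k2%:~R + z2%:~R).
  move=> h1 h2; apply: (deep_x kN km p1 p2 ct).
  have := ler_normB (x1 - k1%:~R) z1%:~R; have := ler_normB (x2 - k2%:~R) z2%:~R.
  rewrite -!addrA -!opprD (distrC x1 k1%:~R) (distrC x2 k2%:~R).
  by move: r1 r2 h1 h2 rho_ns ns1; lra.
have neary (z1 z2 : int) : `|z1%:~R| <= rho -> `|z2%:~R| <= rho ->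
    W (y1 + z1)%:~R (y2 + z2)%:~R.
  move=> h1 h2; apply: (deep_y kN km p1 p2 ct); rewrite !intrD.
  by rewrite !opprD !addrA !subrr !add0r !normrN; move: h1 h2 rho_ns ns1; lra.
have Wk : W k1%:~R k2%:~R.
  by have := nearx 0 0; rewrite normr0 !addr0; apply; move: rho2; lra.
have [rr [rrF rrq]] := setup_good setup n4 Wk nbad (fun z1 z2 hz =>
  let: conj h1 h2 := zl _ _ hz in neary z1 z2 h1 h2).
pose P1 : R := p.1%:~R - de * y1%:~R; pose P2 : R := p.2%:~R - de * y2%:~R.
have q1 := nearest_dist P1; have q2 := nearest_dist P2.
apply: (rrq (nearest P1) (nearest P2)) => z1 z2 zlow zhigh.
have [h1 h2] := zl _ _ zhigh.
have ia : a^-1 <= n ^+ 2 * s ^+ 24.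
  rewrite -div1r ler_pdivrMr // aE.
  have -> : n ^+ 2 * s ^+ 24 * s ^+ 2 = (n * s ^+ 16) * (n * s ^+ 10) by ring.
  have n10 : 1 <= n * s ^+ 10.
    apply: le_trans ns16 _; rewrite ler_wpM2l ?(ltW n0) //.
    by rewrite (exprD s 10 6) ler_piMr ?exprn_ge0 ?(ltW s0) // expr_le1 ?(ltW s0).
  by rewrite -[1]mulr1 ler_pM.
have rho_X : rho <= n ^+ 2 * s ^+ 24.
  have -> : n ^+ 2 * s ^+ 24 = (n * s ^+ 16) * rho by rewrite /rho; ring.
  by rewrite ler_peMl //; move: rho2; lra.
have rho_de : 8 * (8402 + 2 * K) * (n ^+ 2 * s ^+ 24) = de * rho ^+ 2.
  by rewrite deE /rho; ring.
have low : de * rho ^+ 2 / 8 <= de / 2 * sqn R z1 z2.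
  have -> : de * rho ^+ 2 / 8 = de / 2 * (rho ^+ 2 / 4) by field.
  apply: ler_wpM2l; first by rewrite divr_ge0.
  by apply: le_trans zlow; exact: quarter_sq.
have [b1 b2 yN mx] := ct.
have [kz1 kz2] := W_box (nearx _ _ h1 h2).
have [_ _ yzN] := W_zbox (neary _ _ h1 h2).
have {mx} := mx _ _ _ _ kz1 kz2 yzN.
have -> : doubled F g a de p (k1%:~R + z1%:~R) (k2%:~R + z2%:~R) (y1 + z1) (y2 + z2) =
    F (k1%:~R + z1%:~R) (k2%:~R + z2%:~R) - (g (y1 + z1) (y2 + z2))%:~R
    - penalty a k1%:~R k2%:~R y1%:~R y2%:~R
    + de / 2 * sqn R y1 y2 + de / 2 * sqn R z1 z2 - (P1 * z1%:~R + P2 * z2%:~R)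
    - (p.1%:~R * y1%:~R + p.2%:~R * y2%:~R).
  by rewrite /doubled /penalty /sqn /P1 /P2 !intrD; field.
rewrite {1}/doubled => mx.
have harn := @harnack R F W a (F x1 x2 - penalty a x1 x2 y1%:~R y2%:~R) x1 x2
  y1%:~R y2%:~R k1%:~R k2%:~R cF vF vNF a0 a1.
have {harn} : ev (parab a (F x1 x2 - penalty a x1 x2 y1%:~R y2%:~R) y1%:~R y2%:~R)
    k1%:~R k2%:~R - F k1%:~R k2%:~R <= 8400 / a.
  apply: harn; last 2 first.
  - exact: contact_parab_eq.
  - have hk1 := sq_le_half r1; have hk2 := sq_le_half r2.
    by apply: le_trans (lerD hk1 hk2) _; rewrite -[2^-1]div1r -splitr.
  move=> u v huv; have [|Wuv u1 u2] := @disc_W _ _ _ _ _ _ kN km p1 p2 ct u v.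
    by move: huv; lra.
  by split => //; apply: (contact_parab ct).
rewrite ev_parab -/(penalty a k1%:~R k2%:~R _ _) => harn.
have /ler_normlP [_ rz] := rrF z1 z2 zhigh.
have s00 : sqn R 0 0 < rho ^+ 2.
  by rewrite /sqn mulr0z expr0n /= addr0 exprn_gt0 // (lt_le_trans _ rho2).
have /ler_normlP [r0 _] := rrF 0 0 s00.
rewrite !addr0 in r0.
have qz (P z : R) (q : int) : `|q%:~R - P| <= 2^-1 -> `|z| <= rho -> P * z - q%:~R * z <= rho / 2.
  move=> hq hz; have [+ _] := norm_le (P * z - q%:~R * z).
  rewrite -mulrBl normrM distrC => h; apply: le_trans h _.
  by rewrite [rho / 2]mulrC ler_pM.
have qz1 := qz _ _ _ q1 h1; have qz2 := qz _ _ _ q2 h2.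
have X1 : 1 <= n ^+ 2 * s ^+ 24.
  by apply: le_trans rho_X; apply: le_trans rho2; rewrite ler1n.
have {}low : 8402 * (n ^+ 2 * s ^+ 24) + 2 * (K * (n ^+ 2 * s ^+ 24))
    <= de / 2 * sqn R z1 z2.
  apply: le_trans low; rewrite -rho_de le_eqVlt; apply/orP; left; apply/eqP.
  by field.
rewrite -(@ler_int R) !(intrB, intrD, intrM).
rewrite !intrD in rz.
apply: contact_arith mx harn _ _ low (lerD qz1 qz2) ia _ X1.
- exact: rz.
- by move: r0; rewrite opprB.
- by rewrite -splitr.
Qed.

Lemma nearest_eq_dist v w : nearest v = nearest w -> `|w - v| <= 1.
Proof.
move=> e; have /ler_normlP [h1 h2] := nearest_dist v; have /ler_normlP [h3 h4] := nearest_dist w.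
by rewrite e in h1 h2; apply/ler_normlP; split; lra.
Qed.

Lemma count_bound : ((2 * Q).+1 ^ 2 <=
  (2 * Num.truncn (5 / a)).+1 ^ 2 * ((2 * 200).+1 ^ 2 * size bad))%N.
Proof.
have [X hX] := choice (fun p => @contact_exists R F g a de N p cF).
pose phi p := ((nearest (X p).1.1, nearest (X p).1.2), (X p).2).
have admA p : p \in zbox Q -> admissible p.
  by case: p => i j; rewrite mem_zbox => /andP[].
rewrite -size_zbox.
have step1 := @fiber_size _ _ phi ((2 * Num.truncn (5 / a)).+1 ^ 2)
  (undup (map phi (zbox Q))) (zbox Q).
apply: leq_trans (step1 _ _) _.
- by move=> p pQ; rewrite mem_undup map_f.
- move=> b; apply: diam_size; first by rewrite filter_uniq // uniq_zbox.
  move=> p' p; rewrite !mem_filter => /andP[/eqP e' /admA A'] /andP[/eqP e /admA A].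
  move: e'; rewrite -e => -[/nearest_eq_dist r1 /nearest_eq_dist r2 ey].
  have c' := hX p'; have c := hX p; rewrite ey in c'.
  rewrite distrC in r1; rewrite distrC in r2.
  have [h1 h2] := slope_fiber A A' c c' r1 r2.
  by split; apply: int_le_norm; eassumption.
apply: leq_mul => //.
apply: (@fiber_size _ _ fst) => [b|x].
  rewrite mem_undup => /mapP [p /admA A ->] /=.
  exact: contact_bad A (hX p).
rewrite -(size_map snd); apply: diam_size.
  rewrite map_inj_in_uniq ?filter_uniq ?undup_uniq //.
  move=> [b1 b2] [c1 c2]; rewrite !mem_filter /= => /andP[/eqP -> _] /andP[/eqP -> _].
  by move=> ->.
move=> y' y /mapP [b' + ->] /mapP [b + ->].
rewrite !mem_filter !mem_undup => /andP[/eqP e' /mapP[p' /admA A' h']]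
  /andP[/eqP e /mapP[p /admA A h]].
move: e'; rewrite -e h h' => -[/nearest_eq_dist r1 /nearest_eq_dist r2].
rewrite distrC in r1; rewrite distrC in r2.
exact: y_fiber A A' (hX p) (hX p') r1 r2.
Qed.

End Core.

(** For n < 4 the bound is trivial, s being at least 1/4. *)
Lemma doubling_bound (R : realType) (C D K Kb : R) : 1 <= C -> 1 <= D -> 1 <= K -> 1 <= Kb ->
  exists2 L : R, 0 < L & forall n s W F g bad,
    doubling_setup C D K n s W F g bad ->
    (size bad)%:R <= Kb * (n ^+ 2 * s ^+ 8) ->
    forall i j : int, F i%:~R j%:~R - (g i j)%:~R <= L * (n ^+ 2 * s).
Proof.
move=> C1 D1 K1 Kb1.
have [H HE] : exists H, H = D + 2 by exists (D + 2).
have [Cd CdE] : exists Cd, Cd = 8 * (8402 + 2 * K) by exists (8 * (8402 + 2 * K)).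
have [B BE] : exists B, B = 2 * C * (130 + 2 * (4 * C * (3 * D + 2) + 1)).
  by exists (2 * C * (130 + 2 * (4 * C * (3 * D + 2) + 1))).
have [z zE] : exists z : R, z = 401 ^+ 2 by exists (401 ^+ 2).
have z0 : 0 <= z by rewrite zE sqr_ge0.
have [Z ZE] : exists Z, Z = 256 * H ^+ 2 * (121 * (z * Kb)).
  by exists (256 * H ^+ 2 * (121 * (z * Kb))).
have H0 : 1 <= H by move: D1; rewrite HE; goal_lra.
have Cd0 : 0 <= Cd by move: K1; rewrite CdE; goal_lra.
have B0 : 0 <= B.
  have h : 0 <= C * (3 * D + 2) by apply: mulr_ge0; move: C1 D1; goal_lra.
  by rewrite BE; apply: mulr_ge0; move: C1 h; goal_lra.
have Z0 : 0 <= Z.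
  rewrite ZE; apply: mulr_ge0; first by apply: mulr_ge0 => //; exact: sqr_ge0.
  apply: mulr_ge0 => //; apply: mulr_ge0 => //; exact: le_trans ler01 Kb1.
have CH0 : 0 <= 4 * Cd * H ^+ 2.
  by apply: mulr_ge0; [exact: mulr_ge0|exact: sqr_ge0].
have [A AE] : exists A, A = C * (3 * D + 2) by exists (C * (3 * D + 2)).
have A0 : 0 <= A by rewrite AE; apply: mulr_ge0; move: C1 D1; goal_lra.
have [L LE] : exists L, L = 4 * Cd * H ^+ 2 + B + Z + 8 * A + 1.
  by exists (4 * Cd * H ^+ 2 + B + Z + 8 * A + 1).
have L1 : 1 <= L by move: CH0 B0 Z0 A0; rewrite LE; goal_lra.
have L0 : 0 < L := lt_le_trans ltr01 L1.
exists L => // n s W F g bad st sb i j.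
have n1 := setup_n st; have s0 := setup_s0 st; have s1 := setup_s1 st.
have n0 : 0 < n := lt_le_trans ltr01 n1.
have n2s0 : 0 < n ^+ 2 * s by rewrite mulr_gt0 ?exprn_gt0.
have [n4|n4] := leP 4 n; last first.
  have s4 : 1 <= 4 * s.
    apply: le_trans (setup_ns st) _; apply: ler_pM; [exact: ltW|exact: exprn_ge0 (ltW s0)|exact: ltW|].
    have h := ltW s0; rewrite exprS -[leRHS]mulr1.
    by apply: ler_wpM2l => //; exact: exprn_ile1.
  have h1 := F_le st i%:~R j%:~R; have h2 := oppg_le st i j.
  rewrite -AE in h1 h2; have := ler_wpM2l (sqr_ge0 n) s4; rewrite mulr1 => h3.
  have h4 := ler_wpM2l A0 h3.
  have h5 : 8 * A * (n ^+ 2 * s) <= L * (n ^+ 2 * s).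
    rewrite ler_pM2r // LE; move: CH0 B0 Z0; move: (_ * _ ^+ 2); goal_lra.
  apply: le_trans h5; move: h1 h2 h4.
  have -> : A * (n ^+ 2 * (4 * s)) = 4 * (A * (n ^+ 2 * s)) by ring.
  by rewrite -(mulrA 8 A); move: (A * (n ^+ 2 * s)) (A * n ^+ 2); goal_lra.
have Dn0 : 0 <= D * n by apply: mulr_ge0; [exact: le_trans ler01 D1|exact: ltW].
rewrite leNgt; apply/negP => lt.
pose N := (Num.truncn (D * n)).+2.
have [N1 N2] : D * n + 1 <= N%:R /\ N%:R <= H * n.
  have /andP[h1 h2] := truncn_itv Dn0.
  have e : N%:R = (Num.truncn (D * n)).+1%:R + 1 :> R by rewrite natr1.
  have e' : (Num.truncn (D * n)).+1%:R = (Num.truncn (D * n))%:R + 1 :> R by rewrite natr1.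
  by move: h1 h2 n1; rewrite HE e e'; clear; intros; split; lra.
clearbody N.
have [m mE] : exists m, m = L * (n ^+ 2 * s) by exists (L * (n ^+ 2 * s)).
rewrite -mE in lt.
have m0 : 0 < m by rewrite mE mulr_gt0.
have H00 : 0 < H := lt_le_trans ltr01 H0.
have Hn : 0 < 16 * H * n by rewrite !mulr_gt0.
pose Q := Num.truncn (m / (16 * H * n)).
have q0 : 0 <= m / (16 * H * n) by rewrite divr_ge0 // ltW.
have /andP[Q1 Q2] := truncn_itv q0; rewrite -/Q in Q1 Q2.
clearbody Q.
have Wij : W i%:~R j%:~R.
  apply: contrapT => nW; move: lt.
  by rewrite (setup_F0 st) // (setup_g0 st) // subrr ltNge ltW.
have kN : (i, j) \in zbox N by have [] := W_zbox st N1 Wij.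
have h1 : Cd * s ^+ 8 * N%:R ^+ 2 <= m / 4.
  have : N%:R ^+ 2 <= H ^+ 2 * n ^+ 2.
    by rewrite -exprMn ler_pXn2r // nnegrE // mulr_ge0 // ltW.
  have sp : 0 <= Cd * s ^+ 8 by rewrite mulr_ge0 // exprn_ge0 // ltW.
  move=> /(ler_wpM2l sp) h; apply: le_trans h _.
  have -> : Cd * s ^+ 8 * (H ^+ 2 * n ^+ 2) = (Cd * H ^+ 2 * (n ^+ 2 * s)) * s ^+ 7 by ring.
  apply: le_trans (_ : Cd * H ^+ 2 * (n ^+ 2 * s) <= _).
    rewrite ler_piMr //; last by rewrite expr_le1 // ltW.
    by rewrite mulr_ge0 ?(ltW n2s0) // mulr_ge0 // sqr_ge0.
  have : 0 <= (L - 4 * Cd * H ^+ 2) * (n ^+ 2 * s).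
    apply: mulr_ge0; last exact: ltW.
    by move: B0 Z0 A0; rewrite LE; move: (_ * _ ^+ 2); goal_lra.
  rewrite mE; move: (n ^+ 2 * s) => X; clear => h;
  have -> : L * X / 4 = Cd * H ^+ 2 * X + (L - 4 * Cd * H ^+ 2) * X / 4 by field.
  by rewrite lerDl divr_ge0.
have h2 : 4 * Q%:R * N%:R <= m / 4.
  have : Q%:R * N%:R <= m / (16 * H * n) * (H * n) by apply: ler_pM.
  have -> : m / (16 * H * n) * (H * n) = m / 16.
    by field; rewrite !gt_eqF.
  by rewrite -mulrA; move: (Q%:R * _); goal_lra.
have h3 : B * (n ^+ 2 * s) < m.
  rewrite mE ltr_pM2r //; move: CH0 Z0 A0; rewrite LE; move: (_ * _ ^+ 2); goal_lra.
rewrite CdE in h1; rewrite BE in h3.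
have := @count_bound R C D K n s W F g bad st (s ^+ 2) _ m N Q erefl erefl
  N1 h1 h2 h3 (i, j) kN (ltW lt) n4.
set l := Num.truncn _; move=> cnt0.
have cnt : (2 * Q).+1%:R ^+ 2 <=
    (2 * l).+1%:R ^+ 2 * ((2 * 200).+1%:R ^+ 2 * (size bad)%:R) :> R.
  by rewrite -!natrX -!natrM ler_nat.
have s2 : 0 < s ^+ 2 by rewrite exprn_gt0.
have s21 : s ^+ 2 <= 1 by rewrite expr_le1 // ltW.
have l1 : (2 * l).+1%:R <= 11 / s ^+ 2.
  have /andP[+ _] := @truncn_itv _ (5 / s ^+ 2) (divr_ge0 (ler0n _ 5) (ltW s2)).
  have : 1 <= (s ^+ 2)^-1 by rewrite invf_ge1.
  rewrite -/l -[(2 * l).+1%:R]natr1 natrM; move: (s ^+ 2)^-1; goal_lra.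
have lhs : (m / (16 * H * n)) ^+ 2 <= (2 * Q).+1%:R ^+ 2.
  rewrite ler_pXn2r ?nnegrE // (le_trans (ltW Q2)) // ler_nat ltnS.
  by rewrite leq_pmull.
have rhs : (2 * l).+1%:R ^+ 2 * ((2 * 200).+1%:R ^+ 2 * (size bad)%:R) <=
   (11 / s ^+ 2) ^+ 2 * (z * (Kb * (n ^+ 2 * s ^+ 8))) :> R.
  apply: ler_pM.
  - exact: sqr_ge0.
  - by apply: mulr_ge0; [exact: sqr_ge0|exact: ler0n].
  - by rewrite ler_pXn2r ?nnegrE // (le_trans _ l1).
  by rewrite zE; apply: ler_wpM2l => //; exact: sqr_ge0.
have := le_trans lhs (le_trans cnt rhs).
have -> : (m / (16 * H * n)) ^+ 2 = L ^+ 2 * (n * s) ^+ 2 / (256 * H ^+ 2).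
  by rewrite mE; field; rewrite !gt_eqF.
have -> : (11 / s ^+ 2) ^+ 2 * (z * (Kb * (n ^+ 2 * s ^+ 8))) =
   (121 * (z * Kb)) * s ^+ 2 * (n * s) ^+ 2.
  by field; rewrite gt_eqF.
have H2 : 0 < 256 * H ^+ 2 by rewrite mulr_gt0 // exprn_gt0.
rewrite ler_pdivrMr // => fin.
have ns2 : 0 < (n * s) ^+ 2 by rewrite exprn_gt0 // mulr_gt0.
have : L ^+ 2 <= Z * s ^+ 2.
  rewrite -(ler_pM2r ns2); apply: le_trans fin _; rewrite le_eqVlt; apply/orP; left.
  by apply/eqP; rewrite ZE; ring.
have : Z * s ^+ 2 <= Z by rewrite ler_piMr.
have : L <= L ^+ 2 by rewrite expr2 ler_peMl // ltW.
have : Z < L by move: CH0 B0 A0; rewrite LE; move: (_ * _ ^+ 2); goal_lra.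
by move: (L ^+ 2) (Z * _); goal_lra.
Qed.

(** * Rescaling and the two applications *)

Section Rescaling.
Variables (R : realType) (Omega : set 'rV[R]_2).

Lemma embed_zpt (i j : int) : embed R (zpt i j) = pt i%:~R j%:~R.
Proof. by apply/rowP => k; rewrite !mxE; case: ifP. Qed.

Lemma dilateE n (p : 'rV[R]_2) : (1 <= n)%N ->
  dilate n Omega p <-> Omega (n%:R^-1 *: p).
Proof.
move=> n1; have nn : n%:R != 0 :> R by rewrite pnatr_eq0 -lt0n.
split; first by case=> x Ox <-; rewrite scalerA mulVf // scale1r.
by move=> O; exists (n%:R^-1 *: p) => //; rewrite scalerA divff // scale1r.
Qed.

Lemma lattice_in_eball (rho : R) (k1 k2 i j : int) : 0 <= rho ->
  lattice_in (eball (embed R (zpt k1 k2)) rho) (zpt i j) <->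
  sqn R (i - k1) (j - k2) < rho ^+ 2.
Proof.
move=> r0; rewrite /lattice_in /eball /= !embed_zpt.
have -> : enorm (pt (i%:~R) j%:~R - pt k1%:~R k2%:~R) =
    Num.sqrt (sqn R (i - k1) (j - k2)).
  rewrite /enorm big_ord_recl big_ord1 !mxE /= /sqn !intrB.
  by [].
have s0 : 0 <= sqn R (i - k1) (j - k2) by rewrite addr_ge0 // sqr_ge0.
by rewrite -(@ltr_pXn2r _ 2) ?nnegrE ?sqrtr_ge0 // sqr_sqrtr.
Qed.

Lemma convex_set_convex2 : convex_set Omega -> convex2 Omega.
Proof.
move=> cO p q t Op Oq t0 t1.
have := cO p q (Itv01 (ltW t0) (ltW t1)); rewrite !inE => /(_ Op Oq).
by [].
Qed.

Variable (n : R).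
Hypothesis n0 : 0 < n.

Let C : set 'rV[R]_2 := [set p | Omega (n^-1 *: p)].

Lemma open_blowup : open Omega -> open C.
Proof.
move=> oO; apply: (@open_comp _ _ (fun p : 'rV[R]_2 => n^-1 *: p)) => //.
by move=> p _; exact: scaler_continuous.
Qed.

Lemma convex_blowup : convex2 Omega -> convex2 C.
Proof.
move=> cO p q t Cp Cq t0 t1; rewrite /C /= scalerDr !scalerA.
by rewrite ![n^-1 * _]mulrC -!scalerA; exact: cO.
Qed.

Lemma box_blowup D : Omega `<=` box D -> C `<=` box (D * n).
Proof.
have ni : 0 < n^-1 by rewrite invr_gt0.
move=> OD p /OD; rewrite /box /= !mxE !normrM !(gtr0_norm ni).
by rewrite ![n^-1 * _]mulrC !ler_pdivrMr.
Qed.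

Lemma cont2_blowup u : continuous u -> cont2 (blowup n u).
Proof.
move=> cu; rewrite /cont2; have -> : onplane (blowup n u) = (fun p => n ^+ 2 * u (n^-1 *: p)).
  by apply/funext => p; rewrite /onplane /blowup -ptE.
move=> p; apply: (@continuous_comp _ _ _ (fun p : 'rV[R]_2 => u (n^-1 *: p))
  (fun t => n ^+ 2 * t)); last exact: mulrl_continuous.
apply: (@continuous_comp _ _ _ (fun p : 'rV[R]_2 => n^-1 *: p) u); last exact: cu.
exact: scaler_continuous.
Qed.

End Rescaling.

Lemma bounded_box (R : realType) (Omega : set 'rV[R]_2) :
  bounded_set Omega -> exists2 D : R, 1 <= D & Omega `<=` box D.
Proof.
move=> [M [_ hM]]; exists (`|M| + 1); first by rewrite lerDr.
move=> p Op; have hp : `|p| <= `|M| + 1.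
  by apply: hM => //; have := ler_norm M; lra.
have coord i : `|p 0 i| <= `|p|.
  by rewrite [leRHS]/Num.Def.normr/= mx_normrE; exact: (le_bigmax _ _ (0, i)).
by split; apply: le_trans (coord _) hp.
Qed.

Lemma card_lattice (R : realType) (C : set 'rV[R]_2) (M : R) (P : set lattice) :
  1 <= M -> C `<=` box M -> P `<=` (fun x => C (embed R x)) ->
  finite_set P /\ (#|` fset_set P|%:R <= 9 * M ^+ 2 :> R).
Proof.
move=> M1 CM PC; set T := Num.truncn M.
have inb x : P x -> (x 0 0, x 0 1) \in zbox T.
  move=> /PC /CM; rewrite /box /= !mxE => -[h1 h2].
  by rewrite mem_zbox !int_le_norm.
have fP : finite_set P.
  have /sub_finite_set : P `<=` (fun p : int * int => zpt p.1 p.2) @` [set` zbox T].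
    by move=> x /inb xT; exists (x 0 0, x 0 1) => //=; rewrite -zptE.
  by apply; apply: finite_image; exact: finite_seq.
split => //.
have sz : (#|` fset_set P| <= (2 * T).+1 ^ 2)%N.
  rewrite -size_zbox -(size_map (fun x : lattice => (x 0 0, x 0 1))).
  apply: uniq_leq_size.
    by rewrite map_inj_uniq ?fset_uniq // => x y [e0 e1]; rewrite (zptE x) (zptE y) e0 e1.
  move=> q /mapP [x + ->]; rewrite -[x \in _]/(x \in fset_set P) in_fset_set // inE.
  exact: inb.
apply: le_trans (_ : ((2 * T).+1 ^ 2)%:R <= _); first by rewrite ler_nat.
have /andP[T1 _] := @truncn_itv _ M (le_trans ler01 M1).
rewrite natrX (_ : 9 * M ^+ 2 = (3 * M) ^+ 2); last by ring.
rewrite ler_pXn2r ?nnegrE //; last by apply: mulr_ge0 => //; exact: le_trans ler01 M1.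
by rewrite -natr1 natrM; move: T1; rewrite -/T; lra.
Qed.

(** All powers of n in the statement are monomials in n and s = n^(-eps/8); the
    condition eps < 1/2 becomes n s^16 >= 1. *)
Lemma powR_root (R : realType) (N eps : R) : 1 <= N -> 0 < eps -> eps < 2^-1 ->
  exists s : R, [/\ 0 < s, s <= 1, 1 <= N * s ^+ 16 & [/\ N `^ (- eps) = s ^+ 8,
    N `^ (1 - eps) = N * s ^+ 8, N `^ (2 - 3 * eps) = N ^+ 2 * s ^+ 24 &
    N `^ (2 - eps / 8) = N ^+ 2 * s]].
Proof.
move=> N1 e0 e1; have N0 : 0 < N := lt_le_trans ltr01 N1.
have Nn : N != 0 by rewrite gt_eqF.
pose s := N `^ (- (eps / 8)).
have sX k : s ^+ k = N `^ (- (eps / 8) * k%:R).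
  by rewrite powRrM powR_mulrn // powR_ge0.
have NsX j k : N ^+ j * s ^+ k = N `^ (j%:R - (eps / 8) * k%:R).
  by rewrite sX -powR_mulrn ?(ltW N0) // -powRD ?mulNr // Nn implybT.
exists s; split.
- exact: powR_gt0.
- by rewrite -(powRr0 N) /s ler_powR // oppr_le0; lra.
- rewrite -{1}(powRr0 N) -[N in N * _]expr1 NsX ler_powR //; lra.
split.
- by rewrite sX; congr powR; field.
- by rewrite -[N in N * _]expr1 NsX; congr powR; field.
- by rewrite NsX; congr powR; field.
- by rewrite -[s in N ^+ 2 * s]expr1 NsX; congr powR; field.
Qed.

Lemma lapzN g i j : lapz (fun a b => - g a b) i j = - lapz g i j.
Proof. by rewrite /lapz; lia. Qed.

Lemma flip_le (a b c d q : int) :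
  - a - - b - q <= - c - - d - 1 -> b - a - q <= d - c - 1.
Proof. by lia. Qed.

Section Setup.
Variables (R : realType) (Omega : set 'rV[R]_2) (ubar : 'rV[R]_2 -> R) (D K eps s : R).
Variables (n : nat) (u : lattice -> int).
Hypotheses (oO : open Omega) (cO : convex2 Omega) (D1 : 1 <= D) (OD : Omega `<=` box D).
Hypotheses (us : is_viscosity_solution Omega ubar) (K1 : 1 <= K) (n1 : (1 <= n)%N).
Hypothesis ul : is_least (obstacle_class Omega n) u.
Let N : R := n%:R.
Hypotheses (s0 : 0 < s) (s1 : s <= 1) (ns : 1 <= N * s ^+ 16)
  (e1 : N `^ (- eps) = s ^+ 8) (e2 : N `^ (1 - eps) = N * s ^+ 8)
  (e3 : N `^ (2 - 3 * eps) = N ^+ 2 * s ^+ 24).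
Let P := lattice_in (dilate n Omega).
Hypothesis many : (1 - K * N `^ (- eps)) * #|` fset_set P|%:R
  <= #|` fset_set (P `&` good_point Omega ubar eps K n)|%:R.

Let W := region N Omega.
Let F := blowup N ubar.
Let g i j := u (zpt i j).
Let C : set 'rV[R]_2 := [set p | Omega (N^-1 *: p)].
Let N1 : 1 <= N. Proof. by rewrite ler1n. Qed.
Let N0 : 0 < N. Proof. exact: lt_le_trans ltr01 N1. Qed.
Let DN1 : 1 <= D * N. Proof. by rewrite -[1]mulr1 ler_pM. Qed.
Let oC : open C. Proof. exact: open_blowup. Qed.
Let cC : convex2 C. Proof. exact: convex_blowup. Qed.
Let CD : C `<=` box (D * N). Proof. exact: box_blowup. Qed.

Let P_W (i j : int) : P (zpt i j) <-> W i%:~R j%:~R.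
Proof. by rewrite /P /lattice_in /= dilateE // embed_zpt. Qed.

Lemma least_lattice : least_obstacle W g.
Proof.
case: ul => -[ule uge] umin; split; first split.
- by move=> i j /P_W Pij; rewrite -laplacian_zpt; exact: ule.
- by move=> i j nW; apply: uge => /P_W.
move=> v [vle vge] i j.
have := umin (fun x => v (x 0 0) (x 0 1)) _ (zpt i j); rewrite zpt0 zpt1; apply.
split => x; rewrite (zptE x); move: (x 0 0) (x 0 1) => a b Px.
  rewrite laplacian_zpt /lapz !zpt0 !zpt1; apply: vle; exact/P_W.
by rewrite !zpt0 !zpt1; apply: vge => Wab; apply: Px; exact/P_W.
Qed.

Let bad := [seq (x 0 0, x 0 1) | x : lattice <-
  (fset_set P `\` fset_set (P `&` good_point Omega ubar eps K n))%fset].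

Lemma bad_size : (size bad)%:R <= 9 * D ^+ 2 * K * (N ^+ 2 * s ^+ 8).
Proof.
have [fP cP] : finite_set P /\ (#|` fset_set P|%:R <= 9 * (D * N) ^+ 2 :> R).
  apply: (card_lattice DN1 CD) => x; rewrite (zptE x) => /P_W.
  by rewrite embed_zpt.
have sub : (fset_set (P `&` good_point Omega ubar eps K n) `<=` fset_set P)%fset.
  rewrite -fset_set_sub //; last exact: finite_setIl.
rewrite size_map -/(#|` _|) cardfsDS // natrB ?fsubset_leq_card //.
have : K * s ^+ 8 * #|` fset_set P|%:R <= K * s ^+ 8 * (9 * (D * N) ^+ 2).
  apply: ler_wpM2l => //; apply: mulr_ge0; first exact: le_trans ler01 K1.
  by apply: exprn_ge0; exact: ltW.
move: many; rewrite e1.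
have -> : K * s ^+ 8 * (9 * (D * N) ^+ 2) = 9 * D ^+ 2 * K * (N ^+ 2 * s ^+ 8) by ring.
by rewrite mulrBl mul1r; lra.
Qed.

Lemma not_bad (k1 k2 : int) : W k1%:~R k2%:~R -> (k1, k2) \notin bad ->
  good_point Omega ubar eps K n (zpt k1 k2).
Proof.
move=> /P_W Pk; apply: contraNP => ng; apply/mapP; exists (zpt k1 k2); last by rewrite zpt0 zpt1.
have [fP _] : finite_set P /\ (#|` fset_set P|%:R <= 9 * (D * N) ^+ 2 :> R).
  apply: (card_lattice DN1 CD) => x; rewrite (zptE x) => /P_W.
  by rewrite embed_zpt.
rewrite in_fsetD !in_fset_set //; last exact: finite_setIl.
rewrite [X in _ && X]mem_set // andbT; apply/negP => /set_mem [_ h].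
exact: ng h.
Qed.

Lemma good_recurrent (k1 k2 : int) : W k1%:~R k2%:~R -> (k1, k2) \notin bad ->
  exists r : int -> int -> int, [/\
    has_comparison r (fun i j => sqn R (i - k1) (j - k2) < (N * s ^+ 8) ^+ 2),
    forall i j, sqn R (i - k1) (j - k2) < (N * s ^+ 8) ^+ 2 -> lapz r i j <= 2
    & forall i j, sqn R (i - k1) (j - k2) < (N * s ^+ 8) ^+ 2 ->
      `|(r i j)%:~R - F i%:~R j%:~R| <= K * (N ^+ 2 * s ^+ 24)].
Proof.
move=> Wk nb; have [_ [r [rec close]]] := not_bad Wk nb.
have rho0 : 0 <= N * s ^+ 8 by rewrite mulr_ge0 ?exprn_ge0 ?(ltW N0) ?(ltW s0).
rewrite -/N e2 in rec close.
have inB i j := lattice_in_eball k1 k2 i j rho0.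
exists (fun i j => r (zpt i j)); split.
- apply: (comparison_sub _ (recurrent_comparison rec)) => i j h; exact/inB.
- by move=> i j h; rewrite -laplacian_zpt; apply: rec.1; exact/inB.
move=> i j /inB h; have := close _ h; rewrite -/N e3.
by rewrite embed_zpt /F /blowup.
Qed.

Let rho_gt1 : 4 <= N -> 1 < N * s ^+ 8.
Proof.
move=> n4; have rho0 : 0 <= N * s ^+ 8 by rewrite mulr_ge0 ?exprn_ge0 ?(ltW N0) ?(ltW s0).
rewrite -(@ltr_pXn2r _ 2) ?nnegrE // expr1n.
have -> : (N * s ^+ 8) ^+ 2 = N * (N * s ^+ 16) by ring.
apply: lt_le_trans (_ : N <= _); first by apply: lt_le_trans n4; rewrite ltr1n.
by rewrite ler_peMr // ltW.
Qed.

Let shiftK (k z : int) : k + z - k = z. Proof. by rewrite addrC addKr. Qed.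

Lemma setup_upper : doubling_setup (20 * D) D K N s W F g bad.
Proof.
have ll := least_lattice; have [[gle gge] _] := ll.
split=> //.
- by have := D1; lra.
- by move=> x y /CD; rewrite /box /= pt0 pt1.
- by apply: cont2_blowup; case: us.
- exact: visc_blowup.
- exact: viscN_blowup.
- by move=> x y nW; rewrite /F /blowup; case: us => _ _ -> //; rewrite mulr0.
- by move=> i j nW; apply: (least_eq0 ll).
- move=> x1 x2 y1 y2 Wx nWy.
  have [cu _ u0] := us.
  have b := half_plane_barrier oC cC CD (lt_le_trans ltr01 DN1) (cont2_blowup (n := N) cu)
    (visc_blowup N0 us) _ Wx nWy.
  apply: le_trans (b _) _; first by move=> x y nW; rewrite /blowup u0 // mulr0.
  have d0 : 0 <= `|x1 - y1| + `|x2 - y2| by rewrite addr_ge0.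
  have -> : 20 * D * N * (`|x1 - y1| + `|x2 - y2| + 1) =
    8 * (D * N) * (`|x1 - y1| + `|x2 - y2| + 1)
      + 12 * ((D * N) * (`|x1 - y1| + `|x2 - y2| + 1)) by ring.
  rewrite lerDl mulr_ge0 // mulr_ge0 ?addr_ge0 //; exact: le_trans ler01 DN1.
- move=> x1 x2 y1 y2 Wx nWy.
  have [ob _] := ll.
  apply: le_trans (lattice_barrier oC cC CD DN1 ob Wx nWy) _.
  have d0 : 0 <= `|x1%:~R - y1| + `|x2%:~R - y2| by rewrite addr_ge0.
  have M0 : 0 <= D * N := le_trans ler01 DN1.
  have -> : 20 * D * N * (`|x1%:~R - y1| + `|x2%:~R - y2| + 1) =
    10 * (D * N) * (`|x1%:~R - y1| + `|x2%:~R - y2| + 2) +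
    10 * ((D * N) * (`|x1%:~R - y1| + `|x2%:~R - y2|)) by ring.
  by rewrite lerDl mulr_ge0 // mulr_ge0.
move=> n4 k1 k2 Wk nb l1 l2 Wl.
have [r [mp rlap close]] := good_recurrent Wk nb.
exists r; split.
  by move=> z1 z2 hz; have := close (k1 + z1) (k2 + z2); rewrite !shiftK !intrD; exact.
move=> q1 q2 bd; apply: (@translation_contact R r g k1 k2 l1 l2 q1 q2 _ (rho_gt1 n4)) => //.
by move=> z1 z2 hz; apply: gle; exact: Wl.
Qed.

Lemma setup_lower : doubling_setup (20 * D) D K N s W
  (fun x y => - F x y) (fun i j => - g i j) bad.
Proof.
have ll := least_lattice; have [[gle gge] _] := ll.
have FNN : (fun x y => - - F x y) = F.
  by apply/funext => x; apply/funext => y; rewrite opprK.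
have S := setup_upper.
split=> //.
- exact: setup_C S.
- exact: setup_W S.
- by apply: cont2N; exact: setup_cont S.
- exact: setup_viscN S.
- by rewrite FNN; exact: setup_visc S.
- by move=> x y nW; rewrite (setup_F0 S) // oppr0.
- by move=> i j nW; rewrite (setup_g0 S) // oppr0.
- move=> i j Wij; rewrite lapzN; apply: le_trans (_ : 1 <= _) => //.
  by rewrite lerNl; exact: least_lap_ge ll Wij.
- move=> x1 x2 y1 y2 Wx nWy.
  have [cu _ u0] := us.
  have b := half_plane_barrier oC cC CD (lt_le_trans ltr01 DN1) (cont2N (cont2_blowup (n := N) cu))
    (viscN_blowup N0 us) _ Wx nWy.
  apply: le_trans (b _) _; first by move=> x y nW; rewrite /blowup u0 // mulr0 oppr0.
  have d0 : 0 <= `|x1 - y1| + `|x2 - y2| by rewrite addr_ge0.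
  have -> : 20 * D * N * (`|x1 - y1| + `|x2 - y2| + 1) =
    8 * (D * N) * (`|x1 - y1| + `|x2 - y2| + 1)
      + 12 * ((D * N) * (`|x1 - y1| + `|x2 - y2| + 1)) by ring.
  rewrite lerDl mulr_ge0 // mulr_ge0 ?addr_ge0 //; exact: le_trans ler01 DN1.
- move=> x1 x2 y1 y2 Wx nWy; rewrite intrN opprK.
  apply: le_trans (_ : 0 <= _); first by rewrite lerz0; exact: least_le0 ll _ _.
  have D0 : 0 <= D := le_trans ler01 D1.
  by rewrite !mulr_ge0 ?addr_ge0 // ltW.
move=> n4 k1 k2 Wk nb l1 l2 Wl.
have [r [mp rlap close]] := good_recurrent Wk nb.
exists (fun i j => - r i j); split.
  move=> z1 z2 hz; have := close (k1 + z1) (k2 + z2); rewrite !shiftK !intrD.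
  by rewrite intrN -opprB normrN opprK addrC; exact.
move=> q1 q2 bd; apply: (@translation_contact R g r l1 l2 k1 k2 q1 q2 _ (rho_gt1 n4)).
- apply: (comparison_sub _ (least_comparison ll)) => i j h.
  by have := Wl _ _ h; rewrite !subrKC.
- by move=> z1 z2 hz; apply: rlap; rewrite !shiftK.
by move=> z1 z2 h1 h2; apply: flip_le; exact: bd.
Qed.

End Setup.

Theorem theorem22 (R : realType) (Omega : set 'rV[R]_2)
    (Omega_bounded : bounded_set Omega)
    (Omega_open : open Omega)
    (Omega_convex : convex_set Omega)
    (u : nat -> lattice -> int)
    (u_least : forall n : nat, (1 <= n)%N ->
       is_least (obstacle_class Omega n) (u n))
    (ubar : 'rV[R]_2 -> R)
    (ubar_solution : is_viscosity_solution Omega ubar)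
    (eps : R)
    (ubar_approximated : approximated Omega ubar eps) :
  exists L : R, 0 < L /\
    forall n : nat, (1 <= n)%N ->
      (ereal_sup
         (range (fun x : lattice =>
            (`|(u n x)%:~R - n%:R ^+ 2 * ubar (n%:R^-1 *: embed R x)|)%:E))
       <= (L * n%:R `^ (2 - eps / 8))%:E)%E.
Proof.
have [/andP[e0 e1] [K [K1 many]]] := ubar_approximated.
have [D D1 OD] := bounded_box Omega_bounded.
have cO := convex_set_convex2 Omega_convex.
have C1 : 1 <= 20 * D by lra.
have Kb1 : 1 <= 9 * D ^+ 2 * K.
  have D2 : 1 <= D ^+ 2 by rewrite exprn_ege1.
  have DK : 1 <= D ^+ 2 * K by rewrite -[1]mulr1 ler_pM.
  by rewrite -mulrA; move: DK; lra.
have [L L0 HL] := doubling_bound C1 D1 K1 Kb1.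
exists L; split => // n n1.
have N1 : 1 <= n%:R :> R by rewrite ler1n.
have [s [s0 s1 ns [E1 E2 E3 E4]]] := powR_root N1 e0 e1.
apply: ge_ereal_sup => _ [x _ <-]; rewrite lee_fin E4.
(* The same list of bad points serves for both signs. *)
have many' := many n n1.
have Su := setup_upper Omega_open cO D1 OD ubar_solution K1 n1
  (u_least n n1) s0 s1 ns E2 E3.
have Sl := setup_lower Omega_open cO D1 OD ubar_solution K1 n1
  (u_least n n1) s0 s1 ns E2 E3.
have sz := bad_size D1 OD K1 n1 s0 E1 many'.
have up := HL _ _ _ _ _ _ Su sz (x 0 0) (x 0 1).
have lo := HL _ _ _ _ _ _ Sl sz (x 0 0) (x 0 1).
have FE : blowup n%:R ubar (x 0 0)%:~R (x 0 1)%:~R = n%:R ^+ 2 * ubar (n%:R^-1 *: embed R x).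
  by rewrite /blowup -embed_zpt -zptE.
move: up lo; rewrite FE -!zptE intrN => up lo.
by apply/ler_normlP; split; [rewrite opprB|rewrite -[(u n x)%:~R]opprK addrC].
Qed.
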